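(* Let $p(n)$ be the number of partitions of $n$. Let $S=S(n):=\pi(2/3)^{1/2}(n-1/24)^{1/2}$, and set $$A(n):=\frac{\pi^2}{3}\left(\frac{1}{S-1}-\frac{3}{S^2}\right),\qquad \delta(n):=\frac{\pi^2}{3}\left(\frac{1}{2S(S-1)^2}-\frac{3}{S^4}\right)^{1/2}.$$ Then for every degree $m\ge2$, the sequence $p(n)$ is log-polynomial with data $\{A(n),-1,\delta(n)\}$. Consequently, $p(n)$ is Hermite-Jensen of every positive integer degree $d$ with data $\{A(n),-1,\delta(n)\}$. It is also Hermite-Jensen of every positive integer degree $d$ with the data $\{A^*(n),-1,\delta^*(n)\}$, where $$A^*(n):=\frac{\pi}{6^{1/2}n^{1/2}},\qquad \delta^*(n):=\frac{\sqrt\pi}{2\cdot6^{1/4}n^{3/4}}.$$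
   Context: A partition of $n$ is a non-increasing sequence of positive integers summing to $n$. Jensen polynomials: $J_\alpha^{d,n}(X)=\sum_{j=0}^d\binom{d}{j}\alpha(n+j)X^j$ and $K_\alpha^{d,n}(X)=X^dJ_\alpha^{d,n}(1/X)$. $H_d$ is the physicists' Hermite polynomial, $e^{2Xt-t^2}=\sum_d H_d(X)t^d/d!$. Log-polynomial: let $m\ge2$ be an integer and $\kappa\in\{1,-1\}$. A sequence of positive reals $\alpha(n)$ is log-polynomial of degree $m$ with data $\{A(n),\kappa,\delta(n)\}$ if there are real sequences $A(n),\delta(n),g_k(n)$ ($3\le k\le m$) such that $$\log\left(\frac{\alpha(n+j)}{\alpha(n)}\right)=A(n)j+\kappa\delta(n)^2j^2+\sum_{k=3}^m g_k(n)j^k+o(\delta(n)^{m+1})\quad(n\to\infty)$$ for $j=1,\dots,m+1$. In addition, $\delta(n)>0$, $\delta(n)\to0$ and $g_k(n)=o(\delta(n)^k)$. Hermite-Jensen: a sequence of positive reals $\alpha(n)$ is Hermite-Jensen of degree $d\ge1$ with data $\{A(n),\kappa,\delta(n)\}$ if, as $n\to\infty$, both $$\frac{\delta(n)^{-d}}{\alpha(n)}J_\alpha^{d,n}\!\left(\frac{\delta(n)X-1}{e^{A(n)}}\right)\quad\text{and}\quad\frac{(e^{A(n)}\delta(n))^{-d}}{\alpha(n)}K_\alpha^{d,n}\!\left(e^{A(n)}(\delta(n)X-1)\right)$$ converge coefficientwise to $H_d(X/2)$ if $\kappa=-1$, and to $i^{-d}H_d(iX/2)$ if $\kappa=1$.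 *)

(* Defs.v *)
From HB Require Import structures.
From mathcomp Require Import all_boot all_order all_algebra.
From mathcomp Require Import all_classical all_reals all_analysis.
Set Implicit Arguments. Unset Strict Implicit. Unset Printing Implicit Defensive.
Import Order.TTheory GRing.Theory Num.Theory.
Import numFieldNormedType.Exports.
Local Open Scope classical_set_scope.
Local Open Scope ring_scope.

Definition is_partition (n : nat) (s : seq nat) : bool :=
  [&& sorted geq s, all (fun x => 0 < x)%N s & sumn s == n].

Fixpoint seqs_len (b k : nat) : seq (seq nat) :=
  if k is k'.+1 then [seq x :: s | x <- iota 0 b, s <- seqs_len b k'] else [:: [::]].

(* Every partition of n has length <= n and parts <= n, so it occurs exactly
   once in the following list. *)
Definition partitions (n : nat) : seq (seq nat) :=
  [seq s <- flatten [seq seqs_len n.+1 k | k <- iota 0 n.+1] | is_partition n s].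

Definition npart (n : nat) : nat := size (partitions n).

Section Defs.
Variable R : realType.

(* H_d(X) = d! * [t^d] (e^{2Xt} e^{-t^2}), i.e. the coefficient of t^d/d! in the
   formal Cauchy product of sum_a (2X)^a t^a / a! and sum_b (-1)^b t^{2b} / b!. *)
Definition hermite (d : nat) : {poly R} :=
  (d`!)%:R *: \sum_(a < d.+1) \sum_(b < d.+1 | (a + 2 * b)%N == d)
     (((-1) ^+ b / (a`!)%:R / (b`!)%:R) *: (2%:R *: 'X) ^+ a).

Definition jensenJ (alpha : nat -> R) (d n : nat) : {poly R} :=
  \sum_(j < d.+1) ('C(d, j)%:R * alpha (n + j)%N) *: 'X^j.

(* K = X^d J(1/X) *)
Definition jensenK (alpha : nat -> R) (d n : nat) : {poly R} :=
  \sum_(j < d.+1) ('C(d, j)%:R * alpha (n + j)%N) *: 'X^(d - j).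

Definition log_polynomial (m : nat) (alpha A : nat -> R) (kappa : R)
    (delta : nat -> R) : Prop :=
  (2 <= m)%N /\ (kappa = 1 \/ kappa = -1) /\ (forall n, 0 < alpha n) /\
  (\forall n \near \oo, 0 < delta n) /\ delta @ \oo --> 0 /\
  exists g : nat -> nat -> R,
    (forall k, (3 <= k <= m)%N -> (fun n => g k n / delta n ^+ k) @ \oo --> 0) /\
    (forall j, (1 <= j <= m.+1)%N ->
       (fun n => (ln (alpha (n + j)%N / alpha n)
                  - (A n * j%:R + kappa * delta n ^+ 2 * j%:R ^+ 2
                     + \sum_(3 <= k < m.+1) g k n * j%:R ^+ k))
                 / delta n ^+ m.+1) @ \oo --> 0).

(* ---------- Hermite-Jensen sequences (case kappa = -1) ---------- *)
Definition hermite_jensen_neg (d : nat) (alpha A delta : nat -> R) : Prop :=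
  (1 <= d)%N /\ (forall n, 0 < alpha n) /\
  forall k : nat,
    (fun n => (((delta n) ^- d / alpha n) *:
                 (jensenJ alpha d n \Po ((expR (A n))^-1 *: (delta n *: 'X - 1))))`_k)
      @ \oo --> (hermite d \Po (2^-1 *: 'X))`_k
  /\
    (fun n => (((expR (A n) * delta n) ^- d / alpha n) *:
                 (jensenK alpha d n \Po (expR (A n) *: (delta n *: 'X - 1))))`_k)
      @ \oo --> (hermite d \Po (2^-1 *: 'X))`_k.

Definition pR (n : nat) : R := (npart n)%:R.
Definition S_ (n : nat) : R := pi * Num.sqrt (2 / 3) * Num.sqrt (n%:R - 24^-1).
Definition A_ (n : nat) : R := pi ^+ 2 / 3 * ((S_ n - 1)^-1 - 3 / S_ n ^+ 2).
Definition delta_ (n : nat) : R :=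
  pi ^+ 2 / 3 * Num.sqrt ((2 * S_ n * (S_ n - 1) ^+ 2)^-1 - 3 / S_ n ^+ 4).
Definition Astar (n : nat) : R := pi / (Num.sqrt 6 * Num.sqrt n%:R).
Definition deltastar (n : nat) : R :=
  Num.sqrt pi / (2 * Num.sqrt (Num.sqrt 6) * (Num.sqrt n%:R * Num.sqrt (Num.sqrt n%:R))).

End Defs.

(* Main.v *)
(* Let a = pi^2/3, S = S(n), so that S^2 = 2a(n - 1/24), and phi(y) = e^y (y - 1) / y^3, the
   main term of the Hardy-Ramanujan-Rademacher formula up to a constant factor.  The circle
   method is avoided: only ratios p(n + j) / p(n) matter, and these are controlled by the
   recursion n p(n) = sum_k sigma(k) p(n - k).

   Since D(b) = sum_k sigma(k) e^(-kb) equals pi^2/(6 b^2) - 1/(2b) + 1/24 up to O(b^K) for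
   all K (an elementary form of the modularity of the eta function, by halving b repeatedly),
   and phi(S(n - k)) / phi(S(n)) is a combination of exponentials in k up to O(S^-K), the
   function f(n) = phi(S(n)) solves the recursion up to O(S^-K) for all K; the constants
   1/24 and pi^2/6 enter exactly here.  Dividing the recursion by f, the ratio r = p / f
   becomes an average of its previous values, for a kernel whose jumps in S are of order 1,
   and a coupling argument shows that |r(n + j) - r(n)| is O(S^-K), while r stays between
   positive constants.  Hence log(p(n + j) / p(n)) = log f(n + j) - log f(n) + O(S^-K).

   With F = log f as a function of n, F' = A and F'' = -2 delta^2, and the k-th derivative is
   O(S^(1 - 2k)), whereas delta is of order S^(-3/2): Taylor's formula gives the
   log-polynomial expansion.  Finally E_n(j) = p(n + j) e^(-A j) / p(n) is
   exp(-(delta j)^2) up to o(delta^d) in the sense of asymptotic polynomials in delta j, and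
   the coefficients of the rescaled Jensen polynomials are e-th finite differences of E_n
   divided by delta^e, which extract e! times the coefficient of t^e in exp(-t^2). *)

Require Import Defs.
From HB Require Import structures.
From mathcomp Require Import all_boot all_order all_algebra.
From mathcomp Require Import all_classical all_reals all_analysis.
From mathcomp Require Import ring lra zify.
Set Implicit Arguments. Unset Strict Implicit. Unset Printing Implicit Defensive.
Import Order.TTheory GRing.Theory Num.Theory.
Import numFieldNormedType.Exports.

(** * The divisor-sum recursion for partitions *)

(** Remainders below every power of [S] are forced by the quantifier over [m]: an expansion of
    degree [m] tolerates only o(delta^(m+1)), so the leading asymptotics of p(n) would not be
    enough. No limit of the ratio r has to be identified, because a constant factor cancels in p(n +
    j) / p(n); this is why an elementary recursion can replace the circle method. What remains is a
    stability question, and its obstacle is that averaging preserves constants, so that no single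
    value of r is contracted. Contraction is therefore extracted from pairs of indices: the kernels
    of close indices overlap by a fixed mass, and for distant ones the larger index drifts down by a
    fixed mean amount on the scale of [S]. The saddle-point expansion is phrased with exponentials
    in k, rather than powers of k, because sums of sigma(k) against exponentials are what the
    expansion of D controls, and it does so uniformly for rates b of order 1/S. *)

Definition sigma (n : nat) : nat := \sum_(1 <= d < n.+1 | (d %| n)%N) d.

Lemma mem_seqs_len b k s :
  (s \in seqs_len b k) = (size s == k) && all (fun x => x < b)%N s.
Proof.
elim: k s => [|k IHk] s /=.
  by rewrite inE; case: s.
apply/allpairsP/idP => [[[x t] /= [+ + ->]]|].
  by rewrite IHk mem_iota /= add0n => xb /andP[/eqP <- ->]; rewrite eqxx /= xb.
case: s => [//|x s] /= /andP[/eqP[sk] /andP[xb sb]].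
by exists (x, s); rewrite /= mem_iota IHk sk eqxx.
Qed.

Lemma uniq_seqs_len b k : uniq (seqs_len b k).
Proof.
elim: k => //= k IHk; apply: allpairs_uniq => //; first exact: iota_uniq.
by move=> [x s] [y t] _ _ /= [-> ->].
Qed.

Lemma mem_leq_sumn (s : seq nat) x : x \in s -> (x <= sumn s)%N.
Proof. by elim: s => //= y s IHs; rewrite inE => /orP[/eqP ->|/IHs]; lia. Qed.

Lemma size_leq_sumn (s : seq nat) : all (fun x => 0 < x)%N s -> (size s <= sumn s)%N.
Proof. by elim: s => //= y s IHs /andP[y0 /IHs]; lia. Qed.

Lemma mem_partitions n s : (s \in partitions n) = is_partition n s.
Proof.
rewrite mem_filter andbC; case: (boolP (is_partition n s)) => [|_]; rewrite (andbT, andbF)//.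
move=> /and3P[_ s0 /eqP sn]; apply/flattenP; exists (seqs_len n.+1 (size s)).
  apply/mapP; exists (size s) => //; rewrite mem_iota /= add0n ltnS -sn.
  exact: size_leq_sumn.
rewrite mem_seqs_len eqxx /=; apply/allP => x /mem_leq_sumn.
by rewrite sn ltnS.
Qed.

Lemma uniq_partitions n : uniq (partitions n).
Proof.
apply: filter_uniq; have: uniq (iota 0 n.+1) by exact: iota_uniq.
elim: (iota _ _) => //= k r IHr /andP[kr ur].
rewrite cat_uniq uniq_seqs_len IHr// andbT.
apply/hasPn => s /flattenP[_ /mapP[j jr ->]]; rewrite !mem_seqs_len => /andP[/eqP sj _].
by apply/negP => /andP[/eqP sk]; move: kr; rewrite -sk sj jr.
Qed.

Lemma geq_trans : transitive geq.
Proof. by move=> x y z /= xy yz; exact: leq_trans yz xy. Qed.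

Lemma geq_anti : antisymmetric geq.
Proof. by move=> x y /= /andP[xy yx]; apply/eqP; rewrite eqn_leq xy yx. Qed.

Lemma geq_total : total geq.
Proof. by move=> x y /=; exact: leq_total. Qed.

Lemma partition_perm_inj n n' s t : is_partition n s -> is_partition n' t ->
  perm_eq s t -> s = t.
Proof.
move=> /and3P[ss _ _] /and3P[st _ _].
exact: (sorted_eq geq_trans geq_anti).
Qed.

Lemma sumn_perm (s t : seq nat) : perm_eq s t -> sumn s = sumn t.
Proof. by move=> st; rewrite !sumnE; exact: perm_big. Qed.

Lemma is_partition_sort n s : all (fun x => 0 < x)%N s -> sumn s = n ->
  is_partition n (sort geq s).
Proof.
move=> s0 sn; rewrite /is_partition (sort_sorted geq_total) /=.
have p : perm_eq (sort geq s) s by apply/permPl; exact: perm_sort.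
by rewrite (perm_all _ p) s0 (sumn_perm p) sn eqxx.
Qed.

Lemma perm_sort_geq (s : seq nat) : perm_eq (sort geq s) s.
Proof. by apply/permPl; exact: perm_sort. Qed.

(** Adding [m] parts equal to [d] and sorting again ([F]) is a bijection from the partitions of
    [n - d * m]. *)
Lemma count_partitions n d m : (0 < d)%N -> (d * m <= n)%N ->
  count (fun s => m <= count_mem d s)%N (partitions n) = npart (n - d * m).
Proof.
move=> d0 dmn; rewrite -size_filter.
pose F s := sort geq (nseq m d ++ s).
have sumF s : sumn (nseq m d ++ s) = (d * m + sumn s)%N by rewrite sumn_cat sumn_nseq.
rewrite /npart -(size_map F); apply: perm_size; apply: uniq_perm.
- by apply: filter_uniq; exact: uniq_partitions.
- rewrite map_inj_in_uniq ?uniq_partitions// => s t; rewrite !mem_partitions => ps pt Fst.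
  apply: (partition_perm_inj ps pt).
  have : perm_eq (nseq m d ++ s) (nseq m d ++ t).
    apply: perm_trans (perm_sort_geq _); rewrite perm_sym.
    by apply: perm_trans (perm_sort_geq _); rewrite -/(F s) Fst.
  by rewrite perm_cat2l.
move=> s; rewrite mem_filter mem_partitions; apply/andP/mapP => [[ms ps]|[t]].
  have [/= ss s0 /eqP sn] := and3P ps.
  (* The preimage is built by removing exactly [m] of the parts equal to [d] and keeping the surplus
     ones. *)
  have cc : perm_eq (nseq m d ++ [seq x <- s | x != d] ++ nseq (count_mem d s - m) d) s.
    apply/allP => x _ /=; rewrite !count_cat !count_nseq count_filter /=.
    case: (eqVneq d x) => [<-|dx] /=.
      rewrite (@eq_count _ (predI _ _) pred0) => [|y /=]; last by case: eqP.
      by rewrite count_pred0 !mul1n add0n subnKC.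
    rewrite !mul0n add0n addn0; apply/eqP/eq_count => y /=.
    by case: (eqVneq y x) => //= ->; rewrite eq_sym dx.
  set t' := [seq x <- s | x != d] ++ _ in cc.
  have st' : sumn t' = n - d * m.
    by rewrite -sn -(sumn_perm cc) sumF addKn.
  have t'0 : all (fun x => 0 < x)%N t'.
    by move: s0; rewrite -(perm_all _ cc) all_cat => /andP[].
  exists (sort geq t'); first by rewrite mem_partitions; exact: is_partition_sort.
  apply: (@partition_perm_inj n n) => //.
    apply: is_partition_sort; last by rewrite sumF (sumn_perm (perm_sort_geq _)) st'; lia.
    by rewrite all_cat all_nseq d0 orbT (perm_all _ (perm_sort_geq _)).
  rewrite perm_sym (perm_trans (perm_sort_geq _))//.
  by apply: perm_trans cc; rewrite perm_cat2l perm_sort_geq.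
rewrite mem_partitions => /and3P[_ t0 /eqP tn] ->; split.
  rewrite (permP (perm_sort_geq _)) count_cat count_nseq /= eqxx mul1n; exact: leq_addr.
apply: is_partition_sort; last by rewrite sumF tn; lia.
by rewrite all_cat all_nseq d0 orbT.
Qed.

(** A part [d] of multiplicity c is counted once for each [m <= c]. The common cut-off [n] makes the
    ranges independent of [s], so that the sums can be exchanged with a sum over partitions. *)
Lemma sumn_count (n : nat) (s : seq nat) : all (fun x => 0 < x)%N s -> (sumn s <= n)%N ->
  sumn s = \sum_(1 <= d < n.+1) \sum_(1 <= m < n.+1) (d * (m <= count_mem d s))%N.
Proof.
move=> s0 sn.
have cn d : (count_mem d s <= n)%N.
  by apply: leq_trans sn; apply: leq_trans (size_leq_sumn s0); exact: count_size.
transitivity (\sum_(1 <= d < n.+1) (d * count_mem d s)%N).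
  elim: s s0 sn {cn} => [|x s IHs] /=; first by rewrite big1// => d _; rewrite muln0.
  move=> /andP[x0 s0] xsn; rewrite IHs//; last by lia.
  under [in RHS]eq_bigr => d _ do rewrite mulnDr.
  rewrite big_split /=; congr (_ + _)%N.
  rewrite (bigD1_seq x) ?mem_index_iota ?iota_uniq//=; last by lia.
  rewrite eqxx muln1 big1 ?addn0// => d dx.
  by rewrite eq_sym (negbTE dx) muln0.
apply: eq_bigr => d _; rewrite -big_distrr /=; congr muln.
rewrite (big_cat_nat (n := (count_mem d s).+1)) //=; last by rewrite ltnS.
rewrite (eq_big_nat _ _ (F2 := fun=> 1%N)) => [|m /andP[_]]; last by rewrite ltnS => ->.
rewrite [X in (_ + X)%N]big1_seq ?addn0; first by rewrite sum_nat_const_nat muln1 subn1.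
by move=> m /andP[_]; rewrite mem_index_iota => /andP[h _]; rewrite leqNgt h.
Qed.

(** Regroups k as a product of the divisor [d] and its cofactor [m]. The semiring is arbitrary
    because the lemma serves both the recursion in [nat] and the real exponential sums. *)
Lemma sum_sigma (V : pzSemiRingType) (F : nat -> V) (n : nat) :
  (\sum_(1 <= k < n.+1) (sigma k)%:R * F k =
   \sum_(1 <= m < n.+1) \sum_(1 <= d < n.+1 | (d * m <= n)%N) d%:R * F (d * m)%N)%R.
Proof.
rewrite [RHS](exchange_big_dep predT) //=.
under [LHS]eq_bigr => k _ do rewrite /sigma natr_sum big_distrl /=.
transitivity (\sum_(1 <= d < n.+1) \sum_(1 <= k < n.+1 | (d %| k)%N) d%:R * F k)%R.
  rewrite [RHS](exchange_big_dep predT) //=; apply: eq_big_nat => k /andP[k0 kn].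
  rewrite [RHS](big_cat_nat (n := k.+1)) //= [X in (_ + X)%R]big1_seq ?addr0//.
  move=> d /andP[dk]; rewrite mem_index_iota => /andP[kd _].
  by have := dvdn_leq k0 dk; rewrite leqNgt kd.
apply: eq_big_nat => d /andP[d0 dn].
rewrite -[LHS](big_filter _ (fun k => d %| k)%N) -[RHS](big_filter _ (fun m => d * m <= n)%N).
suff pe : perm_eq [seq (d * m)%N | m <- [seq m <- index_iota 1 n.+1 | (d * m <= n)%N]]
    [seq k <- index_iota 1 n.+1 | (d %| k)%N].
  by rewrite -(perm_big _ pe) big_map.
apply: uniq_perm.
- rewrite map_inj_uniq ?filter_uniq ?iota_uniq// => x y /eqP.
  by rewrite eqn_pmul2l// => /eqP.
- by rewrite filter_uniq ?iota_uniq.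
move=> k; rewrite mem_filter mem_index_iota; apply/mapP/andP => [[m]|[/dvdnP[m ->] mk]].
  rewrite mem_filter mem_index_iota => /andP[dmn /andP[m0 mn]] ->.
  by rewrite dvdn_mulr// muln_gt0 d0 m0 ltnS.
exists m; rewrite ?mem_filter ?mem_index_iota; last by rewrite mulnC.
rewrite mulnC; nia.
Qed.

Lemma sigma_leq k : (sigma k <= k * k)%N.
Proof.
rewrite /sigma big_mkcond /=; apply: leq_trans (_ : \sum_(1 <= d < k.+1) k <= _)%N.
  rewrite !big_nat; apply: leq_sum => d /andP[_]; rewrite ltnS => dk; by case: ifP.
by rewrite sum_nat_const_nat subn1.
Qed.

Lemma sigma_geq k : (k <= sigma k)%N.
Proof.
case: k => // k; rewrite /sigma big_mkcond big_nat_recr//= dvdnn; exact: leq_addl.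
Qed.

(** Double counting of the total of all parts of all partitions of [n]: a pair (d, m) contributes
    [d] for every partition with at least [m] parts [d], and there are [npart (n - d * m)] of
    these. *)
Lemma npart_rec (n : nat) : (n * npart n)%N = \sum_(1 <= k < n.+1) sigma k * npart (n - k).
Proof.
have -> : (n * npart n = \sum_(s <- partitions n) sumn s)%N.
  rewrite mulnC /npart -sum1_size big_distrl /=; apply: eq_big_seq => s.
  by rewrite mem_partitions mul1n => /and3P[_ _ /eqP].
transitivity (\sum_(1 <= d < n.+1) \sum_(1 <= m < n.+1)
   if (d * m <= n)%N then d * npart (n - d * m) else 0)%N.
  rewrite (eq_big_seq (fun s => \sum_(1 <= d < n.+1) \sum_(1 <= m < n.+1)
      (d * (m <= count_mem d s)))%N); last first.
    move=> s; rewrite mem_partitions => /and3P[_ s0 /eqP sn].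
    by apply: sumn_count => //; rewrite sn.
  rewrite exchange_big /=; apply: eq_big_nat => d /andP[d0 dn].
  rewrite exchange_big /=; apply: eq_big_nat => m /andP[m0 mn].
  rewrite -big_distrr /=; case: ifPn => [dmn|dmn].
    by rewrite -(count_partitions d0 dmn) -sum1_count [in RHS]big_mkcond.
  rewrite big1_seq ?muln0// => s /andP[_]; rewrite mem_partitions => /and3P[_ _ /eqP sn].
  apply/eqP; rewrite eqb0 -ltnNge; move: dmn; rewrite -ltnNge -sn.
  apply: contraTltn => h; rewrite -leqNgt.
  apply: leq_trans (_ : d * count_mem d s <= _)%N; first by rewrite leq_mul2l h orbT.
  elim: s {sn h} => [|x s IHs] /=; rewrite ?muln0// mulnDr leq_add//.
  by case: eqP => [->|]; rewrite ?muln1 ?muln0.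
rewrite exchange_big /=; under eq_bigr => m _ do rewrite -big_mkcond.
have natRE m : (m%:R)%R = m by exact: natn.
have := sum_sigma (fun k => npart (n - k)) n.
move=> e; transitivity (\sum_(1 <= k < n.+1) (sigma k)%:R * npart (n - k))%R.
  by rewrite e; apply: eq_bigr => m _; apply: eq_bigr => d _; rewrite natRE.
by apply: eq_bigr => k _; rewrite natRE.
Qed.

Local Open Scope classical_set_scope.
Local Open Scope ring_scope.

(** * The Basel sum *)

Section Calculus.
Variable R : realType.
Implicit Types (f df : R -> R) (a b x y z : R) (u v : R^nat).

Lemma mean_value f df a b : a <= b ->
  (forall x, a <= x <= b -> is_derive x 1 f (df x)) ->
  exists2 c, a <= c <= b & f b - f a = df c * (b - a).
Proof.
move=> ab fdf; have [||c] := @MVT_segment R f df a b ab.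
- by move=> x; rewrite in_itv /= => /andP[/ltW ax /ltW xb]; apply: fdf; rewrite ax.
- apply: derivable_within_continuous => x; rewrite in_itv /= => axb.
  by have [] := fdf x axb.
by rewrite in_itv /= => acb fba; exists c.
Qed.

Lemma le_lim_bound u l B : u @ \oo --> l -> (exists N, forall n, (N <= n)%N -> u n <= B) ->
  l <= B.
Proof.
move=> ul [N uB]; rewrite -(cvg_lim (@Rhausdorff R) ul).
apply: limr_le; first by apply/cvg_ex; exists l.
by exists N.
Qed.

Lemma ge_lim_bound u l B : u @ \oo --> l -> (exists N, forall n, (N <= n)%N -> B <= u n) ->
  B <= l.
Proof.
move=> ul [N uB]; rewrite -lerN2; apply: (@le_lim_bound (fun n => - u n)).
  exact: cvgN.
by exists N => n Nn; rewrite lerN2 uB.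
Qed.

Lemma norm_lim_bound u l x B : u @ \oo --> l ->
  (exists N, forall n, (N <= n)%N -> `|u n - x| <= B) -> `|l - x| <= B.
Proof.
move=> ul [N uB]; rewrite ler_norml; apply/andP; split.
  rewrite lerBrDr; apply: (ge_lim_bound ul); exists N => n Nn.
  by have := uB n Nn; rewrite ler_norml => /andP[+ _]; rewrite lerBrDr.
rewrite lerBlDr; apply: (le_lim_bound ul); exists N => n Nn.
by have := uB n Nn; rewrite ler_norml => /andP[_]; rewrite lerBlDr.
Qed.

Lemma cvg_half_pow : (fun n => 2^-1 ^+ n : R) @ \oo --> (0 : R).
Proof. by apply: cvg_expr; rewrite ger0_norm; lra. Qed.

Lemma cvg_pos_sum u B : (forall n, 0 <= u n) ->
  (forall n, \sum_(1 <= m < n.+1) u m <= B) ->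
  exists2 s, (fun n => \sum_(1 <= m < n.+1) u m) @ \oo --> s & s <= B.
Proof.
move=> u0 uB; have c : cvgn (fun n => \sum_(1 <= m < n.+1) u m).
  apply: nondecreasing_is_cvgn; last by exists B => _ [n _ <-].
  apply/nondecreasing_seqP => n; rewrite [leRHS]big_nat_recr//=.
  by rewrite lerDl.
exists (limn (fun n => \sum_(1 <= m < n.+1) u m)) => //.
by apply: (le_lim_bound c); exists 0%N => n _.
Qed.

Lemma pos_sum_le_lim u s n : (forall n, 0 <= u n) ->
  (fun n => \sum_(1 <= m < n.+1) u m) @ \oo --> s -> \sum_(1 <= m < n.+1) u m <= s.
Proof.
move=> u0 us; apply: (ge_lim_bound us); exists n => k nk.
rewrite (big_cat_nat (n := n.+1) (p := k.+1))//= lerDl.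
by apply: sumr_ge0.
Qed.

(** This is sinh b >= b, proved through cosh >= 1; it is the source of the bound 1/x^2 for
    [bose]. *)
Lemma exp_sub_ge a b : 0 <= b -> 2 * b <= expR b - expR (- b).
Proof.
move=> b0; have [|c /andP[c0 _]] := @mean_value (fun x => expR x - expR (- x))
   (fun x => expR x + expR (- x)) 0 b b0.
  move=> x _; apply: is_derive_eq.
  by rewrite /GRing.scale/=; ring.
rewrite oppr0 subrr !subr0 => e.
suff : 2 <= expR c + expR (- c) by nra.
have e0 := expR_gt0 c; rewrite expRN.
have : 0 <= (expR c - 1) ^+ 2 / expR c by rewrite divr_ge0 ?sqr_ge0 ?ltW.
have -> : (expR c - 1) ^+ 2 / expR c = expR c - 2 + (expR c)^-1 by field; rewrite gt_eqF.
lra.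
Qed.

(* A function whose halving increments are [O(b^k)] is [O(b^k)]-close to its limit
   along the dyadic sequence. *)
Lemma dyadic_telescope (g : R -> R) (C : R) (k : nat) (L : R) : (0 < k)%N -> 0 <= C ->
  (forall b, 0 < b <= 1 -> `|g (b / 2) - g b| <= C * b ^+ k) ->
  (forall b, 0 < b <= 1 -> (fun n => g (b * 2^-1 ^+ n)) @ \oo --> L) ->
  forall b, 0 < b <= 1 -> `|g b - L| <= 2 * C * b ^+ k.
Proof.
move=> k0 C0 gh gL b /andP[b0 b1]; rewrite distrC.
apply: (norm_lim_bound (gL b _)); first by rewrite b0.
exists 0%N => n _.
(* The factor [1 - 2^-n] makes the induction close: as [k] is positive, the n-th increment is at
   most C b^k 2^-n. *)
suff : `|g (b * 2^-1 ^+ n) - g b| <= 2 * C * b ^+ k * (1 - 2^-1 ^+ n).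
  move=> /le_trans; apply; rewrite -[leRHS]mulr1 ler_wpM2l//.
    by rewrite !mulr_ge0// exprn_ge0// ltW.
elim: n => [|n IHn]; first by rewrite expr0 mulr1 !subrr mulr0 normr0.
rewrite -(subrKA (g (b * 2^-1 ^+ n))) (le_trans (ler_normD _ _))//.
have h0 : 0 < 2^-1 ^+ n :> R by rewrite exprn_gt0.
have h1 : 2^-1 ^+ n <= 1 :> R by rewrite exprn_ile1; lra.
have bn : 0 < b * 2^-1 ^+ n <= 1.
  by rewrite mulr_gt0//= mulr_ile1// ltW.
have {gh gL} := gh _ bn; rewrite -mulrA -exprSr => h.
apply: le_trans (lerD h IHn) _.
have : C * (b * 2^-1 ^+ n) ^+ k <= C * b ^+ k * 2^-1 ^+ n.
  rewrite exprMn mulrA ler_wpM2l ?mulr_ge0 ?exprn_ge0 ?(ltW b0)//.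
  by rewrite -[leRHS]expr1 ler_wiXn2l// ltW.
rewrite exprS; set x := 2^-1 ^+ n; set y := C * b ^+ k.
have -> : 2 * C * b ^+ k = 2 * y by rewrite mulrA.
lra.
Qed.

End Calculus.

(** * Inverse squares of sines at dyadic angles *)

Section Basel.
Variable R : realType.
Implicit Types x : R.

Lemma sin_le_id x : 0 <= x -> sin x <= x.
Proof.
move=> x0; have dv y : 0 <= y <= x -> is_derive y 1 (fun y => y - sin y) (1 - cos y).
  by move=> _; apply: is_derive_eq.
have [c _] := mean_value x0 dv.
rewrite sin0 !subr0 => /eqP; rewrite -subr_ge0 => /eqP ->.
by rewrite mulr_ge0// subr_ge0 cos_le1.
Qed.

Lemma mul_cos_le_sin x : 0 <= x <= pi / 2 -> x * cos x <= sin x.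
Proof.
move=> /andP[x0 xpi].
have dv y : 0 <= y <= x -> is_derive y 1 (fun y => sin y - y * cos y) (y * sin y).
  by move=> _; apply: is_derive_eq; rewrite /GRing.scale/=; ring.
have [c /andP[c0 cx]] := mean_value x0 dv.
rewrite sin0 mul0r !subr0 => e; rewrite -subr_ge0 e !mulr_ge0//.
apply: sin_ge0_pi; rewrite c0 (le_trans cx)// (le_trans xpi)//.
have := pi_ge0 R; lra.
Qed.

(** Doubling the angle passes from level n+1 to level n, and the reflection of k into 2^(n+1) - k
    exchanges sine and cosine. *)
Definition cot_angle (n k : nat) : R := k%:R * (pi / 2 ^+ n.+1).

Lemma cot_angle_bounds n k : (0 < k < 2 ^ n)%N -> 0 < cot_angle n k < pi / 2.
Proof.
move=> /andP[k0 kn]; rewrite /cot_angle exprS invfM mulrCA mulrC.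
have p2 : 0 < 2 ^+ n :> R by rewrite exprn_gt0.
have -> : k%:R * (2^-1 / 2 ^+ n) * pi = k%:R / 2 ^+ n * (pi / 2) :> R by ring.
have pi2 : 0 < pi / 2 :> R by have := pi_gt0 R; lra.
apply/andP; split; first by apply: mulr_gt0 => //; rewrite divr_gt0 ?ltr0n.
by rewrite -[ltRHS]mul1r ltr_pM2r// ltr_pdivrMr// mul1r -natrX ltr_nat.
Qed.

(** Folding the sum at its middle angle pi/4 and using 1/sin^2 x + 1/cos^2 x = 4/sin^2(2x), level
    n+1 equals 4 times level n, plus 2. *)
Lemma sin_inv_sq_sum n :
  \sum_(1 <= k < 2 ^ n) (sin (cot_angle n k) ^+ 2)^-1 = 2 / 3 * (4 ^+ n - 1) :> R.
Proof.
elim: n => [|n IHn]; first by rewrite expn0 big_geq// expr0 subrr mulr0.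
have ang k : cot_angle n k = cot_angle n.+1 k *+ 2.
  by rewrite /cot_angle [in RHS]exprS invfM mulr2n; field; rewrite expf_neq0.
have n2 : (0 < 2 ^ n)%N by rewrite expn_gt0.
rewrite (big_cat_nat (n := 2 ^ n)) ?leq_exp2l//= [X in _ + X]big_ltn ?ltn_exp2l//.
have -> : sin (cot_angle n.+1 (2 ^ n)) ^+ 2 = 2^-1.
  have -> : cot_angle n.+1 (2 ^ n) = pi / 4.
    by rewrite /cot_angle natrX !exprS; field; rewrite expf_neq0.
  have h : cos (pi / 4 *+ 2) = 0 :> R.
    by rewrite -cos_pihalf; congr cos; rewrite mulr2n; lra.
  by move: h; rewrite cos_mulr2n cos2sin2 mulr2n; lra.
rewrite invrK.
have refl : \sum_((2 ^ n).+1 <= k < 2 ^ n.+1) (sin (cot_angle n.+1 k) ^+ 2)^-1 =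
   \sum_(1 <= k < 2 ^ n) (cos (cot_angle n.+1 k) ^+ 2)^-1 :> R.
  rewrite big_nat_rev /= (_ : (2 ^ n).+1 = 1 + 2 ^ n)%N//.
  rewrite -[X in \sum_(_ <= _ < X) _](subnK (leq_pexp2l (isT : (0 < 2)%N) (leqnSn n))) expnS.
  rewrite big_addn mul2n -addnn !addnK; apply: eq_big_nat => k /andP[k1 kn].
  rewrite (_ : 1 + 2 ^ n + (2 ^ n + 2 ^ n) - (k + 2 ^ n).+1 = 2 ^ n + 2 ^ n - k)%N; last by lia.
  have -> : cot_angle n.+1 (2 ^ n + 2 ^ n - k) = pi / 2 - cot_angle n.+1 k.
    rewrite /cot_angle natrB; last by lia.
    rewrite addnn -mul2n natrM natrX !exprS; field; rewrite expf_neq0//.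
  by rewrite -opprB sinN sinBpihalf opprK.
rewrite refl addrCA -big_split /=.
under eq_big_nat => k /andP[k1 kn].
  have /andP[a0 a1] := @cot_angle_bounds n.+1 k ltac:(rewrite k1/= expnS; lia).
  have s0 : sin (cot_angle n.+1 k) != 0.
    by rewrite gt_eqF// sin_gt0_pihalf// a0 a1.
  have c0 : cos (cot_angle n.+1 k) != 0.
    by rewrite gt_eqF// cos_gt0_pihalf// a1 andbT (lt_trans _ a0)// oppr_lt0 (lt_trans a0).
  have -> : (sin (cot_angle n.+1 k) ^+ 2)^-1 + (cos (cot_angle n.+1 k) ^+ 2)^-1 =
     4 * (sin (cot_angle n k) ^+ 2)^-1.
    have {1}-> : 4 = 4 * (cos (cot_angle n.+1 k) ^+ 2 + sin (cot_angle n.+1 k) ^+ 2) :> R.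
      by rewrite cos2Dsin2 mulr1.
    by rewrite ang sin_mulr2n -mulr_natl; field; rewrite s0 c0.
  over.
rewrite -big_distrr /= IHn exprS; lra.
Qed.

(** Since x cos x <= sin x <= x, replacing sin^-2 by x^-2 loses at most 1 per angle, and a loss of
    2^n is negligible against 4^n. Monotonicity passes from the cut-offs 2^n to all of them. *)
Lemma basel_cvg : (fun n => \sum_(1 <= k < n.+1) (k%:R ^+ 2)^-1 : R) @ \oo --> (pi ^+ 2 / 6 : R).
Proof.
have p0 := pi_gt0 R.
pose Z n : R := \sum_(1 <= k < 2 ^ n) (k%:R ^+ 2)^-1.
have bnd n : (pi ^+ 2 / 4 * (2 / 3 * (1 - 4^-1 ^+ n) - 2^-1 ^+ n) <= Z n) /\
   Z n <= pi ^+ 2 / 6.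
  have p4 : 0 < 4 ^+ n :> R by rewrite exprn_gt0.
  have e k : (0 < k)%N -> (k%:R ^+ 2)^-1 = pi ^+ 2 / 4 / 4 ^+ n * (cot_angle n k ^+ 2)^-1.
    move=> k0; have -> : 4 ^+ n = (2 ^+ n) ^+ 2 :> R.
      by rewrite exprAC; congr (_ ^+ n); lra.
    rewrite /cot_angle (exprS 2 n); move: pi p0 => p p0; field.
    by rewrite ?expf_neq0 ?gt_eqF ?ltr0n.
  have -> : Z n = pi ^+ 2 / 4 / 4 ^+ n * \sum_(1 <= k < 2 ^ n) (cot_angle n k ^+ 2)^-1 :> R.
    by rewrite /Z big_distrr; apply: eq_big_nat => k /andP[k0 _]; exact: e.
  have pp : 0 <= pi ^+ 2 / 4 / 4 ^+ n :> R by rewrite !divr_ge0 ?sqr_ge0// ltW.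
  have ub : \sum_(1 <= k < 2 ^ n) (cot_angle n k ^+ 2)^-1 <= 2 / 3 * (4 ^+ n - 1) :> R.
    rewrite -sin_inv_sq_sum; apply: ler_sum_nat => k kn.
    have /andP[a0 a1] := cot_angle_bounds kn.
    have s0 : 0 < sin (cot_angle n k) by rewrite sin_gt0_pihalf// a0.
    by rewrite lef_pV2 ?posrE ?exprn_gt0// ler_sqr ?nnegrE ?(ltW a0) ?(ltW s0)// sin_le_id// ltW.
  have lb : 2 / 3 * (4 ^+ n - 1) - 2 ^+ n <= \sum_(1 <= k < 2 ^ n) (cot_angle n k ^+ 2)^-1 :> R.
    rewrite -sin_inv_sq_sum lerBlDr.
    have : \sum_(1 <= k < 2 ^ n) ((cot_angle n k ^+ 2)^-1 + 1) <=
       \sum_(1 <= k < 2 ^ n) (cot_angle n k ^+ 2)^-1 + 2 ^+ n :> R.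
      by rewrite big_split /= lerD2l sumr_const_nat -natrX ler_nat leq_subr.
    apply: le_trans; apply: ler_sum_nat => k kn.
    have /andP[a0 a1] := cot_angle_bounds kn.
    have s0 : 0 < sin (cot_angle n k) by rewrite sin_gt0_pihalf// a0.
    have h : cot_angle n k * cos (cot_angle n k) <= sin (cot_angle n k).
      by rewrite mul_cos_le_sin// (ltW a0) (ltW a1).
    have c0 : 0 <= cos (cot_angle n k).
      by rewrite ltW// cos_gt0_pihalf// a1 andbT (lt_trans _ a0)// oppr_lt0 (lt_trans a0).
    have : (cot_angle n k * cos (cot_angle n k)) ^+ 2 <= sin (cot_angle n k) ^+ 2.
      by rewrite ler_sqr// nnegrE; [exact: mulr_ge0 (ltW a0) c0|exact: ltW].
    rewrite exprMn cos2sin2; set s := sin _; set t := cot_angle _ _ => hh.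
    have s2 : 0 < s ^+ 2 by rewrite exprn_gt0.
    have t2 : 0 < t ^+ 2 by rewrite exprn_gt0.
    rewrite -(ler_pM2l s2) mulfV ?gt_eqF// -(ler_pM2l t2).
    have -> : t ^+ 2 * (s ^+ 2 * ((t ^+ 2)^-1 + 1)) = s ^+ 2 + t ^+ 2 * s ^+ 2.
      by field; rewrite gt_eqF.
    lra.
  split.
    apply: le_trans (ler_wpM2l pp lb).
    have -> : 2^-1 ^+ n = 2 ^+ n * 4^-1 ^+ n :> R.
      by rewrite -exprMn; congr (_ ^+ n); lra.
    rewrite exprVn [leLHS](_ : _ = pi ^+ 2 / 4 / 4 ^+ n * (2 / 3 * (4 ^+ n - 1) - 2 ^+ n))//.
    by field; rewrite gt_eqF.
  apply: le_trans (ler_wpM2l pp ub) _.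
  have -> : pi ^+ 2 / 4 / 4 ^+ n * (2 / 3 * (4 ^+ n - 1)) = pi ^+ 2 / 6 * (1 - (4 ^+ n)^-1) :> R.
    by field; rewrite gt_eqF.
  rewrite -[leRHS]mulr1 ler_wpM2l ?divr_ge0 ?sqr_ge0//.
have u0 k : 0 <= (k%:R ^+ 2)^-1 :> R by rewrite invr_ge0 sqr_ge0.
have mono n m : (n <= m)%N -> \sum_(1 <= k < n.+1) (k%:R ^+ 2)^-1 <=
    \sum_(1 <= k < m.+1) (k%:R ^+ 2)^-1 :> R.
  by move=> nm; rewrite [leRHS](big_cat_nat (n := n.+1))//= lerDl sumr_ge0.
have [|s ss sle] := @cvg_pos_sum R (fun k => (k%:R ^+ 2)^-1) (pi ^+ 2 / 6) u0.
  move=> n; have [_] := bnd n.+1; apply: le_trans; rewrite /Z.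
  have := @ltn_expl 2 n.+1 isT; case: (2 ^ n.+1)%N => // m.
  by rewrite ltnS => /ltnW /mono.
suff -> : pi ^+ 2 / 6 = s by [].
apply/eqP; rewrite eq_le sle andbT.
have lim : (fun n => pi ^+ 2 / 4 * (2 / 3 * (1 - 4^-1 ^+ n) - 2^-1 ^+ n)) @ \oo -->
    (pi ^+ 2 / 4 * (2 / 3 * (1 - 0) - 0) : R).
  apply: cvgM; first exact: cvg_cst.
  apply: cvgB; last exact: cvg_half_pow.
  apply: cvgM; first exact: cvg_cst.
  apply: cvgB; first exact: cvg_cst.
  by apply: cvg_expr; rewrite ger0_norm; lra.
have -> : pi ^+ 2 / 6 = pi ^+ 2 / 4 * (2 / 3 * (1 - 0) - 0) :> R by lra.
apply: (le_lim_bound lim); exists 0%N => n _.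
have [h _] := bnd n; apply: le_trans h _; rewrite /Z.
apply: le_trans (pos_sum_le_lim (2 ^ n) u0 ss).
by rewrite [leRHS]big_nat_recr ?expn_gt0//= lerDl.
Qed.

End Basel.

(** * Sums of the derivative of the logistic function *)

Section ForwardDifference.
Variable R : realType.
Implicit Types (u : R -> R) (c x : R) (k j : nat).

Fixpoint fwd_diff c k u x : R :=
  if k is k'.+1 then fwd_diff c k' u (x + c) - fwd_diff c k' u x else u x.

Lemma is_derive_fwd_diff c (U : nat -> R -> R) k j x :
  (forall i (y : R), is_derive y 1 (U i) (U i.+1 y)) ->
  is_derive x 1 (fwd_diff c k (U j)) (fwd_diff c k (U j.+1) x).
Proof.
move=> dU; elim: k j x => [|k IHk] j x /=; first exact: dU.
have ds : is_derive x 1 (fun y : R => y + c) 1 by apply: is_derive_eq; rewrite addr0.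
have := @is_derive1_comp R (fwd_diff c k (U j)) (fun y => y + c) x _ _ (IHk j (x + c)) ds; rewrite mulr1 => d1.
exact: is_deriveB.
Qed.

Lemma fwd_diff_mean_value c (U : nat -> R -> R) k j x : 0 <= c ->
  (forall i (y : R), is_derive y 1 (U i) (U i.+1 y)) ->
  exists2 xi, x <= xi <= x + k%:R * c & fwd_diff c k (U j) x = c ^+ k * U (j + k)%N xi.
Proof.
move=> c0 dU; elim: k j x => [|k IHk] j x.
  by exists x; rewrite ?mul0r ?addr0 ?lexx ?expr0 ?mul1r ?addn0.
have xc : x <= x + c by rewrite lerDl.
have [y /andP[xy yc] /= e] := mean_value xc (fun y _ => is_derive_fwd_diff c k j y dU).
have [xi /andP[yxi xiy] exi] := IHk j.+1 y.
exists xi; first by rewrite (le_trans xy yxi) (le_trans xiy)// -natr1; nra.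
by rewrite e exi addrAC subrr add0r addnS addSn exprSr; ring.
Qed.

Lemma alternating_sum_by_parts (v : nat -> R) M :
  2 * \sum_(i < M) (-1) ^+ i * v i =
  v 0%N - (-1) ^+ M * v M - \sum_(i < M) (-1) ^+ i * (v i.+1 - v i).
Proof.
elim: M => [|M IHM]; first by rewrite !big_ord0; ring.
by rewrite !big_ord_recr/= mulrDr IHM exprS; ring.
Qed.

(** Each summation by parts against (-1)^i replaces the function by its forward difference, smaller
    by a factor [c] for a smooth function, at the price of two boundary terms. *)
Lemma alternating_sum_le u c x M k :
  `|\sum_(i < M) (-1) ^+ i * u (x + i%:R * c)| <=
  \sum_(i < M) `|fwd_diff c k u (x + i%:R * c)| +
  \sum_(l < k) (`|fwd_diff c l u x| + `|fwd_diff c l u (x + M%:R * c)|).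
Proof.
have sgn i (y : R) : `|(-1) ^+ i * y| = `|y| by rewrite normrM normrX normrN1 expr1n mul1r.
suff : `|\sum_(i < M) (-1) ^+ i * u (x + i%:R * c)| <=
  `|\sum_(i < M) (-1) ^+ i * fwd_diff c k u (x + i%:R * c)| +
  \sum_(l < k) (`|fwd_diff c l u x| + `|fwd_diff c l u (x + M%:R * c)|).
  move/le_trans; apply; rewrite lerD2r (le_trans (ler_norm_sum _ _ _))//.
  by apply: ler_sum => i _; rewrite sgn.
elim: k => [|k IHk]; first by rewrite big_ord0 addr0.
apply: le_trans IHk _; rewrite big_ord_recr/=.
have := alternating_sum_by_parts (fun i => fwd_diff c k u (x + i%:R * c)) M.
rewrite mul0r addr0; under [in X in _ - X]eq_bigr => i _.
  have -> : x + i.+1%:R * c = x + i%:R * c + c by rewrite -natr1; ring.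
  over.
set S := \sum_(i < M) (-1) ^+ i * fwd_diff c k u _.
set T := \sum_(i < M) _; set p := fwd_diff c k u x.
set q := fwd_diff c k u (x + _) => e.
have := sgn M q; set w := _ * q in e *; move=> wq.
set A := \sum_(l < k) _; rewrite -wq.
have : `|2 * S| <= `|p| + `|w| + `|T|.
  by rewrite e; apply: le_trans (ler_normB _ _) _; rewrite lerD2r ler_normB.
rewrite normrM (@ger0_norm _ 2)//; have := normr_ge0 S; lra.
Qed.

End ForwardDifference.

(** * The logistic function and its derivatives *)

Section Logistic.
Variable R : realType.
Implicit Types (x c b : R) (k : nat).

(** One quarter of the squared hyperbolic secant of x/2, the derivative of [logistic]. *)
Definition sech2 x : R := (expR x + 2 + expR (- x))^-1.
Definition logistic x : R := (1 + expR (- x))^-1.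

Lemma sech2_gt0 x : 0 < sech2 x.
Proof. by rewrite invr_gt0 !addr_gt0 ?expR_gt0. Qed.

Lemma sech2N x : sech2 (- x) = sech2 x.
Proof. by rewrite /sech2 opprK; congr (_^-1); ring. Qed.

Lemma sech2_0 : sech2 0 = 4^-1.
Proof. by rewrite /sech2 oppr0 expR0; congr (_^-1); lra. Qed.

Lemma sech2D_le x c : 0 <= c -> sech2 (x + c) <= expR c * sech2 x.
Proof.
move=> c0; rewrite /sech2 opprD !expRD !expRN.
have e0 := expR_gt0 x; set e := expR x in e0 *.
have f1 : 1 <= expR c by rewrite -expR0 ler_expR.
set f := expR c in f1 *.
have ei0 : 0 < e^-1 by rewrite invr_gt0.
have fi0 : 0 < f^-1 by rewrite invr_gt0; lra.
have ff : f * f^-1 = 1 by rewrite mulfV// gt_eqF; lra.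
rewrite -[leLHS]mul1r ler_pdivrMr; last by nra.
rewrite mulrAC ler_pdivlMr; last by nra.
have -> : f * (e * f + 2 + e^-1 / f) = e * (f * f) + 2 * f + e^-1 * (f * f^-1) by ring.
rewrite ff; have : 1 <= f * f by nra.
nra.
Qed.

Lemma sech2_le x y : 0 <= x <= y -> sech2 y <= sech2 x.
Proof.
move=> /andP[x0 xy]; rewrite /sech2 !expRN.
have e1 : 1 <= expR x by rewrite -expR0 ler_expR.
have ef : expR x <= expR y by rewrite ler_expR.
set e := expR x in e1 ef *; set f := expR y in ef *.
have ei0 : 0 < e^-1 by rewrite invr_gt0; lra.
have fi0 : 0 < f^-1 by rewrite invr_gt0; lra.
rewrite lef_pV2 ?posrE; [|lra|lra].
have ee : e * e^-1 = 1 by rewrite mulfV// gt_eqF; lra.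
have ff : f * f^-1 = 1 by rewrite mulfV// gt_eqF; lra.
have : e^-1 - f^-1 = (f - e) * (e^-1 * f^-1) by field; apply/andP; split; rewrite gt_eqF//; lra.
have e_1 : e^-1 <= 1 by nra.
have f_1 : f^-1 <= 1 by nra.
have : e^-1 * f^-1 <= 1 by nra.
nra.
Qed.

Lemma sech2_mul_le x : 0 < x -> x * sech2 x <= 1.
Proof.
move=> x0; rewrite /sech2 ler_pdivrMr ?mul1r; last by rewrite !addr_gt0 ?expR_gt0.
have := expR_ge1Dx x; have := expR_gt0 (- x); lra.
Qed.

Lemma logistic_bounds x : 0 < logistic x < 1.
Proof.
have q0 := expR_gt0 (- x); rewrite /logistic invr_gt0 addr_gt0//=.
by rewrite invf_lt1 ?addr_gt0//; lra.
Qed.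

Lemma logistic_mul x : logistic x * (1 - logistic x) = sech2 x.
Proof.
have q0 := expR_gt0 (- x); rewrite /logistic /sech2.
have -> : expR x = (expR (- x))^-1 by rewrite expRN invrK.
set q := expR (- x) in q0 *; field.
by rewrite !gt_eqF//; nra.
Qed.

Lemma logistic0 : logistic 0 = 2^-1.
Proof. by rewrite /logistic oppr0 expR0; congr (_^-1); lra. Qed.

Lemma logistic_ge x : 0 < x -> 1 - x^-1 <= logistic x.
Proof.
move=> x0; rewrite /logistic expRN; have e0 := expR_gt0 x; have := expR_ge1Dx x.
set e := expR x in e0 * => ex.
have -> : (1 + e^-1)^-1 = 1 - (1 + e)^-1.
  by field; rewrite !gt_eqF//; lra.
rewrite lerD2l lerN2 lef_pV2 ?posrE; lra.
Qed.

Lemma is_derive_logistic x : is_derive x 1 logistic (sech2 x).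
Proof.
have q0 := expR_gt0 (- x).
have d : is_derive x 1 (fun y => 1 + expR (- y)) (- expR (- x)).
  by apply: is_derive_eq; rewrite /GRing.scale/=; ring.
have n0 : 1 + expR (- x) != 0 by rewrite gt_eqF// addr_gt0.
have := @is_deriveV R (fun y => 1 + expR (- y)) x _ 1 n0 d; congr (is_derive _ _ _ _); rewrite /GRing.scale/= /sech2.
have -> : expR x = (expR (- x))^-1 by rewrite expRN invrK.
set q := expR (- x) in q0 *; field.
by rewrite !gt_eqF//; nra.
Qed.

(** As l' = l (1 - l) for the logistic function l, every derivative of [sech2] is a polynomial in l
    divisible by X (1 - X); the divisibility keeps it comparable to [sech2]. *)
Fixpoint logistic_poly k : {poly R} :=
  if k is k'.+1 then (logistic_poly k')^`() * ('X * (1 - 'X)) else 'X * (1 - 'X).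

Definition dsech2 k x := (logistic_poly k).[logistic x].

Lemma dsech2_0 : dsech2 0 = sech2.
Proof. by apply/funext => x; rewrite /dsech2 /= !hornerE logistic_mul. Qed.

Lemma is_derive_dsech2 k x : is_derive x 1 (dsech2 k) (dsech2 k.+1 x).
Proof.
apply: is_derive_eq (is_derive1_comp (is_derive_poly _ _) (is_derive_logistic x)) _.
by rewrite /dsech2 /= hornerM -logistic_mul !hornerE.
Qed.

Lemma dsech2_le k : exists2 C, 0 <= C & forall x, `|dsech2 k x| <= C * sech2 x.
Proof.
have [Q eQ] : exists Q, logistic_poly k = Q * ('X * (1 - 'X)).
  by case: k => [|k]; [exists 1; rewrite mul1r|exists (logistic_poly k)^`()].
exists (\sum_(i < size Q) `|Q`_i|); first exact: sumr_ge0.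
move=> x; have /andP[l0 l1] := logistic_bounds x.
rewrite /dsech2 eQ hornerM normrM !hornerE logistic_mul (ger0_norm (ltW (sech2_gt0 x))).
rewrite ler_wpM2r ?(ltW (sech2_gt0 x))// horner_coef (le_trans (ler_norm_sum _ _ _))//.
apply: ler_sum => i _; rewrite normrM ler_piMr// normrX ger0_norm ?(ltW l0)//.
exact: exprn_ile1 (ltW l0) (ltW l1).
Qed.

(** The difference is c^k times a k-th derivative at a point within k of x, because c <= 1;
    [sech2D_le] moves that point back to x at the cost of a factor e^k. *)
Lemma fwd_diff_sech2_le k : exists2 C, 0 <= C & forall c x, 0 < c <= 1 ->
  `|fwd_diff c k sech2 x| <= C * c ^+ k * sech2 x.
Proof.
have [C C0 hC] := dsech2_le k; exists (C * expR k%:R); first by rewrite mulr_ge0 ?expR_ge0.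
move=> c x /andP[c0 c1].
have [xi /andP[xxi xik]] := fwd_diff_mean_value k 0%N x (ltW c0) is_derive_dsech2.
rewrite dsech2_0 add0n => ->; rewrite normrM normrX (gtr0_norm c0).
rewrite (_ : C * _ * _ * _ = c ^+ k * (C * (expR k%:R * sech2 x))); last by ring.
rewrite ler_wpM2l ?exprn_ge0 ?(ltW c0)//.
apply: le_trans (hC xi) _; rewrite ler_wpM2l//.
have xi0 : 0 <= xi - x by rewrite subr_ge0.
have := sech2D_le x xi0; rewrite addrC subrK => /le_trans; apply.
rewrite ler_wpM2r ?(ltW (sech2_gt0 x))// ler_expR lerBlDl (le_trans xik)// lerD2l.
by rewrite ler_piMr.
Qed.

End Logistic.

(** * Sums over the multiples of a small step *)

Section LogisticSum.
Variable R : realType.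
Implicit Types (x c b : R) (k N : nat).

Definition sech2_psum c N : R := \sum_(1 <= m < N.+1) sech2 (m%:R * c).
Definition sech2_sum c : R := limn (sech2_psum c).

Lemma sech2_psum_le c N : 0 < c -> c * sech2_psum c N <= 2^-1.
Proof.
move=> c0; apply: le_trans (_ : logistic (N%:R * c) - logistic 0 <= _); last first.
  by rewrite logistic0; have /andP[_] := logistic_bounds (N%:R * c); lra.
elim: N => [|N IHN]; first by rewrite /sech2_psum big_geq// mulr0 mul0r subrr.
rewrite /sech2_psum big_nat_recr//= -/(sech2_psum c N) mulrDr.
have xc : N%:R * c <= N.+1%:R * c by rewrite ler_wpM2r ?(ltW c0)// ler_nat.
have [y /andP[Ny yN] e] := mean_value xc (fun y _ => is_derive_logistic y).
have : sech2 (N.+1%:R * c) <= sech2 y.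
  by apply: sech2_le; rewrite yN andbT (le_trans _ Ny)// mulr_ge0// ltW.
move: e; rewrite -natr1 mulrDl mul1r (addrC (N%:R * c)) addrK => e h.
have : c * sech2 (c + N%:R * c) <= c * sech2 y by rewrite ler_pM2l.
rewrite (mulrC c (sech2 y)) -e; lra.
Qed.

Lemma sech2_psum_ge c N : 0 < c ->
  logistic (N%:R * c) - 2^-1 <= c * (4^-1 + sech2_psum c N).
Proof.
move=> c0; rewrite -logistic0 -sech2_0.
apply: le_trans (_ : c * \sum_(0 <= m < N) sech2 (m%:R * c) <= _).
  elim: N => [|N IHN]; first by rewrite big_geq// mul0r subrr mulr0.
  have xc : N%:R * c <= N.+1%:R * c by rewrite ler_wpM2r ?(ltW c0)// ler_nat.
  have [y /andP[Ny yN] e] := mean_value xc (fun y _ => is_derive_logistic y).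
  have : c * sech2 y <= c * sech2 (N%:R * c).
    by rewrite ler_pM2l//; apply: sech2_le; rewrite Ny andbT mulr_ge0// ltW.
  have e1 : N.+1%:R * c - N%:R * c = c by rewrite -natr1; ring.
  by rewrite e1 in e; rewrite big_nat_recr//= mulrDr; lra.
rewrite ler_pM2l//; case: N => [|N]; first by rewrite /sech2_psum !big_geq// addr0 ltW ?sech2_gt0.
rewrite big_ltn// mul0r lerD2l /sech2_psum [leRHS]big_nat_recr//= lerDl.
by rewrite ltW ?sech2_gt0.
Qed.

Lemma cvg_sech2_psum c : 0 < c -> sech2_psum c @ \oo --> sech2_sum c.
Proof.
move=> c0; have [||s h _] := @cvg_pos_sum R (fun m => sech2 (m%:R * c)) (2^-1 / c).
- by move=> n; rewrite ltW// sech2_gt0.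
- by move=> n; rewrite ler_pdivlMr// mulrC sech2_psum_le.
by apply/cvg_ex; exists s.
Qed.

(** With the central value [sech2 0 = 1/4] counted by half, this is a trapezoidal sum: the upper and
    lower Riemann sums of a decreasing function of integral 1/2 lie c/8 on either side of it. *)
Lemma sech2_sum_bounds c : 0 < c -> `|c / 8 + c * sech2_sum c - 2^-1| <= c / 8.
Proof.
move=> c0; have cv := cvg_sech2_psum c0.
have ub : c * sech2_sum c <= 2^-1.
  have cm : (fun N => c * sech2_psum c N) @ \oo --> c * sech2_sum c.
    by apply: cvgM => //; exact: cvg_cst.
  by apply: (le_lim_bound cm); exists 0%N => n _; exact: sech2_psum_le.
have lb : 2^-1 <= c * (4^-1 + sech2_sum c).
  (* The multiple of the harmonic sequence compensates the deficit of [logistic (N c)] from 1, so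
     that the lower bound holds at every finite stage. *)
  have cm : (fun N => c * (4^-1 + sech2_psum c N.+1) + c^-1 * harmonic N) @ \oo -->
      c * (4^-1 + sech2_sum c) + c^-1 * 0.
    apply: cvgD; apply: cvgM; try exact: cvg_cst; last exact: cvg_harmonic.
    by apply: cvgD; [exact: cvg_cst|rewrite cvg_shiftS].
  rewrite mulr0 addr0 in cm; apply: (ge_lim_bound cm); exists 0%N => n _.
  have := sech2_psum_ge n.+1 c0; have := @logistic_ge R (n.+1%:R * c).
  rewrite mulr_gt0// => /(_ isT).
  have -> : c^-1 * harmonic n = (n.+1%:R * c)^-1 by rewrite /harmonic invfM mulrC.
  set z := (_ * c)^-1; set y := logistic _; set t := c * _; lra.
rewrite ler_norml; apply/andP; split; lra.
Qed.

Lemma sum_even_split (G : nat -> R) n :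
  \sum_(i < n.*2.+1) G i = G n + \sum_(1 <= m < n.+1) (G (n + m)%N + G (n - m)%N).
Proof.
rewrite -(big_mkord xpredT) (big_cat_nat (n := n)) //=; last by lia.
rewrite [X in _ + X]big_ltn; last by lia.
rewrite addrCA; congr (_ + _); rewrite big_split /= addrC; congr (_ + _).
  rewrite -[n.+1 in LHS]addn1 addnC -[n.*2.+1](_ : (n.+1 + n)%N = _); last by lia.
  by rewrite big_addn addnK; apply: eq_bigr => m _; rewrite addnC.
rewrite [RHS]big_nat_rev /= big_add1 /=; apply: eq_big_nat => i /andP[_ i_n].
by congr (G _); lia.
Qed.

Lemma alternating_sech2_le k : exists2 C, 0 <= C & forall c N, 0 < c <= 1 -> (0 < N)%N ->
  `|8^-1 + \sum_(1 <= m < N.+1) (-1) ^+ m * sech2 (m%:R * c)| <=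
    C * c ^+ k + C / (N%:R * c).
Proof.
(* One order more than [k], because summing [sech2] over the grid of step [c] costs a factor 1/c. *)
have [C C0 hC] := fwd_diff_sech2_le R k.+1.
have [B B0 hB] : exists2 B, 0 <= B & forall c x, 0 < c <= 1 ->
    \sum_(l < k.+1) `|fwd_diff c l (@sech2 R) x| <= B * sech2 x.
  elim: k.+1 {C C0 hC} => [|j [B B0 hB]].
    by exists 0 => // c x _; rewrite big_ord0 mul0r.
  have [A A0 hA] := fwd_diff_sech2_le R j.
  exists (B + A) => [|c x c01]; first exact: addr_ge0.
  rewrite big_ord_recr/= mulrDl lerD ?hB// (le_trans (hA _ _ c01))//.
  have /andP[c0 c1] := c01.
  rewrite ler_wpM2r ?(ltW (sech2_gt0 _))// ler_piMr// exprn_ile1// ltW//.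
exists (2 * C + 2 * B); first by rewrite addr_ge0 ?mulr_ge0.
move=> c N /[dup] c01 /andP[c0 c1] N0.
(* The grid runs from -Nc to Nc, which moves the boundary terms of the summations by parts from 0 to
   distant points; evenness of [sech2] folds it back, and 1/8 is half of the central term. *)
pose x0 := - (N%:R * c).
have := alternating_sum_le (@sech2 R) c x0 N.*2.+1 k.+1.
set S := \sum_(i < _) _; set T := \sum_(i < _) _; set U := \sum_(i < _) _ => STU.
have xi m : x0 + (N + m)%:R * c = m%:R * c by rewrite /x0 natrD; ring.
have xi' m : (m <= N)%N -> x0 + (N - m)%:R * c = - (m%:R * c).
  by move=> mN; rewrite /x0 natrB//; ring.
have sg m : (m <= N)%N -> (-1) ^+ (N - m) = (-1) ^+ N * (-1) ^+ m :> R.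
  by move=> mN; rewrite -signr_odd oddB// signr_addb !signr_odd.
have eS : S = (-1) ^+ N * (2 * (8^-1 + \sum_(1 <= m < N.+1) (-1) ^+ m * sech2 (m%:R * c))).
  rewrite /S (sum_even_split (fun i => (-1) ^+ i * sech2 (x0 + i%:R * c))).
  have -> : x0 + N%:R * c = 0 by rewrite /x0; ring.
  rewrite sech2_0 !mulrDr; congr (_ + _); first by congr (_ * _); lra.
  rewrite !big_distrr /=; apply: eq_big_nat => m /andP[_]; rewrite ltnS => mN.
  rewrite xi xi'// sech2N sg// exprD; ring.
have eT : T <= C * c ^+ k.+1 * (4^-1 + 2 * sech2_psum c N).
  apply: le_trans (_ : \sum_(i < N.*2.+1) C * c ^+ k.+1 * sech2 (x0 + i%:R * c) <= _).
    by apply: ler_sum => i _; exact: hC.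
  rewrite -big_distrr /= ler_wpM2l ?mulr_ge0 ?exprn_ge0 ?(ltW c0)//.
  rewrite (sum_even_split (fun i => sech2 (x0 + i%:R * c))).
  have -> : x0 + N%:R * c = 0 by rewrite /x0; ring.
  rewrite sech2_0 lerD2l /sech2_psum big_distrr/= le_eqVlt; apply/orP; left; apply/eqP.
  apply: eq_big_nat => m /andP[_]; rewrite ltnS => mN.
  by rewrite xi xi'// sech2N; ring.
have Nc0 : 0 < N%:R * c by rewrite mulr_gt0 ?ltr0n.
have sN : sech2 (N%:R * c) <= (N%:R * c)^-1.
  by rewrite -[leRHS]mul1r ler_pdivlMr// mulrC sech2_mul_le.
have eU : U <= 2 * B / (N%:R * c).
  rewrite /U big_split /=; have := hB c x0 c01; have := hB c (x0 + N.*2.+1%:R * c) c01.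
  have -> : x0 + N.*2.+1%:R * c = N.+1%:R * c by rewrite /x0 -addnn -!natr1 natrD; ring.
  rewrite /x0 sech2N => h1 h2; apply: le_trans (lerD h2 h1) _.
  have : sech2 (N.+1%:R * c) <= sech2 (N%:R * c).
    by apply: sech2_le; rewrite ltW//= ler_wpM2r ?(ltW c0)// ler_nat.
  move: sN; set z := (_ * _)^-1; nra.
have Tk : C * c ^+ k.+1 * (4^-1 + 2 * sech2_psum c N) <= 2 * C * c ^+ k.
  rewrite exprSr; have := @sech2_psum_le c N c0.
  have : 0 <= C * c ^+ k by rewrite mulr_ge0 ?exprn_ge0 ?(ltW c0).
  have -> : C * (c ^+ k * c) * (4^-1 + 2 * sech2_psum c N) =
     C * c ^+ k * (c / 4 + 2 * (c * sech2_psum c N)) by field.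
  have -> : 2 * C * c ^+ k = C * c ^+ k * 2 by ring.
  move=> h1 h2; rewrite ler_wpM2l//; lra.
move: STU; rewrite eS normrM normrX normrN1 expr1n mul1r normrM (@ger0_norm _ 2)//.
have z0 : 0 <= (N%:R * c)^-1 by rewrite invr_ge0 ltW.
have ck : 0 <= c ^+ k by rewrite exprn_ge0// ltW.
set A := `|_|; set z := (N%:R * c)^-1 in eU z0 *; move: (c ^+ k) ck Tk => y y0 Tk.
have := normr_ge0 (8^-1 + \sum_(1 <= m < N.+1) (-1) ^+ m * sech2 (m%:R * c)).
rewrite -/A; nra.
Qed.

(** The even multiples of [c] are the multiples of [2 * c], so comparing two consecutive dyadic
    steps produces an alternating sum. *)
Lemma sech2_psum_double c N :
  sech2_psum c N.*2 - 2 * sech2_psum (2 * c) N =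
  - \sum_(1 <= m < N.*2.+1) (-1) ^+ m * sech2 (m%:R * c).
Proof.
elim: N => [|N IHN]; first by rewrite /sech2_psum !big_geq//; ring.
rewrite doubleS /sech2_psum !(@big_nat_recr _ _ _ _.+1)//=.
rewrite -/(sech2_psum c N.*2) -/(sech2_psum (2 * c) N) !exprS -signr_odd odd_double expr0.
have -> : N.+1%:R * (2 * c) = N.*2.+2%:R * c.
  by rewrite -[N.*2.+2]doubleS -mul2n natrM; ring.
move: IHN; lra.
Qed.

(** Halving the step changes the trapezoidal sum only by an alternating sum, hence by O(c^k) for
    every k; [dyadic_telescope] adds these changes up, down to the limit 1/2. *)
Lemma sech2_sum_asymp k : exists2 C, 0 <= C & forall c, 0 < c <= 1 ->
  `|sech2_sum c - ((2 * c)^-1 - 8^-1)| <= C * c ^+ k.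
Proof.
have [C C0 hC] := alternating_sech2_le k.+1.
have step b : 0 < b <= 1 ->
  `|(b / 2 / 8 + b / 2 * sech2_sum (b / 2)) - (b / 8 + b * sech2_sum b)| <= C * b ^+ k.+1.
  move=> /andP[b0 b1]; have b20 : 0 < b / 2 by lra.
  have cv : (fun N => (b / 2 / 8 + b / 2 * sech2_psum (b / 2) N.*2) -
       (b / 8 + b * sech2_psum b N)) @ \oo -->
     (b / 2 / 8 + b / 2 * sech2_sum (b / 2)) - (b / 8 + b * sech2_sum b).
    apply: cvgB; apply: cvgD; try exact: cvg_cst; apply: cvgM; try exact: cvg_cst.
      have := @cvg_comp _ _ _ (muln 2) _ _ _ _ (@cvg_mulnl 2 isT) (cvg_sech2_psum b20).
      rewrite (_ : _ \o _ = fun n => sech2_psum (b / 2) n.*2)//.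
      by apply/funext => n /=; rewrite mul2n.
    exact: cvg_sech2_psum.
  apply/ler_addgt0Pr => e e0; rewrite -[X in `|X|]subr0.
  apply: (norm_lim_bound cv).
  have [N0 hN0] : exists N0, forall n, (N0 <= n)%N -> C / n.+1%:R <= e.
    exists (Num.trunc (C / e)) => n nN.
    rewrite ler_pdivrMr ?ltr0n// mulrC -ler_pdivrMr// ltW//.
    have := @truncnS_gt R (C / e).
    by move/lt_le_trans; apply; rewrite ler_nat.
  exists N0.+1 => n nN; rewrite subr0.
  have n0 : (0 < n.*2)%N by rewrite double_gt0; lia.
  have b2 : b = 2 * (b / 2) by lra.
  have := sech2_psum_double (b / 2) n; rewrite -b2 => e1.
  have b21 : 0 < b / 2 <= 1 by apply/andP; split; lra.
  have := hC (b / 2) n.*2 b21 n0.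
  set A := \sum_(_ <= _ < _) _ in e1 *; set u := sech2_psum _ _ in e1 *; set v := sech2_psum _ _ in e1 *.
  have -> : b / 2 / 8 + b / 2 * u - (b / 8 + b * v) = - (b / 2 * (8^-1 + A)).
    have -> : A = 2 * v - u by lra.
    by field.
  rewrite normrN normrM (gtr0_norm b20) => h.
  have := ler_wpM2l (ltW b20) h => /le_trans; apply.
  rewrite mulrDr lerD//.
    rewrite mulrCA ler_wpM2l// (le_trans (_ : _ <= (b / 2) ^+ k.+1))//.
      by rewrite ler_piMl ?exprn_ge0 ?(ltW b20)//; lra.
    by rewrite lerXn2r ?nnegrE ?(ltW b20) ?(ltW b0)//; lra.
  have -> : b / 2 * (C / (n.*2%:R * (b / 2))) = C / n.*2%:R.
    by field; rewrite ?gt_eqF ?ltr0n//.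
  case: n nN n0 {e1 A u v h cv} => // n nN n0; rewrite doubleS.
  by apply: hN0; lia.
have lim b : 0 < b <= 1 -> (fun n => b * 2^-1 ^+ n / 8 + b * 2^-1 ^+ n * sech2_sum (b * 2^-1 ^+ n))
    @ \oo --> (2^-1 : R).
  move=> /andP[b0 b1]; apply/cvgrPdist_le => e e0.
  have h : (fun n => b * 2^-1 ^+ n / 8 : R) @ \oo --> b * 0 / 8.
    by apply: cvgM; [apply: cvgM; [exact: cvg_cst|exact: cvg_half_pow]|exact: cvg_cst].
  rewrite mulr0 mul0r in h; move/cvgrPdist_le : h => /(_ e e0); apply: filterS => n /=.
  rewrite sub0r normrN => h; rewrite distrC.
  have bn : 0 < b * 2^-1 ^+ n by rewrite mulr_gt0// exprn_gt0.
  apply: le_trans (sech2_sum_bounds bn) _; apply: le_trans h; exact: ler_norm.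
have := @dyadic_telescope R (fun c => c / 8 + c * sech2_sum c) C k.+1 2^-1 isT C0 step lim.
move=> h; exists (2 * C); first by rewrite mulr_ge0.
move=> c c01; have /andP[c0 c1] := c01.
have := h c c01; have -> : c / 8 + c * sech2_sum c - 2^-1 =
    c * (sech2_sum c - ((2 * c)^-1 - 8^-1)) by field; rewrite gt_eqF.
by rewrite normrM (gtr0_norm c0) exprS mulrCA ler_pM2l.
Qed.

End LogisticSum.

(** * The sums [bose_sum b] of [sigma k * expR (- k b)] *)

Section BoseSum.
Variable R : realType.
Implicit Types (x b : R) (k N : nat).

(** The sum of d e^(-dx) over d >= 1, that is 1/(4 sinh^2(x/2)); summed over the multiples of b it
    gives the series of sigma(k) e^(-kb). *)
Definition bose x : R := expR (- x) / (1 - expR (- x)) ^+ 2.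

Lemma expN_lt1 x : 0 < x -> 0 < expR (- x) < 1.
Proof. by move=> x0; rewrite expR_gt0 expR_lt1 oppr_lt0. Qed.

Lemma bose_ge0 x : 0 <= bose x.
Proof. by rewrite /bose divr_ge0 ?sqr_ge0 ?expR_ge0. Qed.

Lemma bose_le x : 0 < x -> bose x <= (x ^+ 2)^-1.
Proof.
move=> x0; have /andP[q0 q1] := expN_lt1 x0.
have x2 : 0 < x ^+ 2 by rewrite exprn_gt0.
rewrite /bose ler_pdivrMr; last by rewrite exprn_gt0// subr_gt0.
rewrite mulrC ler_pdivlMr//.
have e1 : expR (- x) = expR (- (x / 2)) ^+ 2 by rewrite -expRM_natl; congr expR; lra.
have := @exp_sub_ge R 0 (x / 2) ltac:(lra).
have p0 := expR_gt0 (- (x / 2)); have -> : expR (x / 2) = (expR (- (x / 2)))^-1.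
  by rewrite expRN invrK.
rewrite e1; move: (expR (- (x / 2))) p0 => p p0 h.
have {}h : x * p <= 1 - p ^+ 2.
  have := ler_wpM2r (ltW p0) h; rewrite mulrBl mulVf ?gt_eqF//; lra.
rewrite -[p ^+ 2 * _]exprMn (mulrC p) ler_sqr ?nnegrE ?mulr_ge0 ?(ltW x0) ?(ltW p0)//.
by apply: le_trans h; apply: mulr_ge0; exact: ltW.
Qed.

Lemma bose_ge x : 0 < x -> expR (- x) / x ^+ 2 <= bose x.
Proof.
move=> x0; have /andP[q0 q1] := expN_lt1 x0; rewrite /bose ler_wpM2l ?expR_ge0//.
have h : 1 - expR (- x) <= x by have := expR_ge1Dx (- x); lra.
rewrite lef_pV2 ?posrE ?exprn_gt0 ?subr_gt0// ler_sqr ?nnegrE ?(ltW x0)//; lra.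
Qed.

(** The link to the logistic sums: up to the factor 4, halving the argument of [bose_sum] adds only
    a [sech2_sum]. *)
Lemma bose_double x : 0 < x -> bose x - 4 * bose (2 * x) = sech2 x.
Proof.
move=> x0; have /andP[q0 q1] := expN_lt1 x0; rewrite /bose /sech2.
have -> : expR (- (2 * x)) = expR (- x) ^+ 2 by rewrite -expRM_natl; congr expR; lra.
have -> : expR x = (expR (- x))^-1 by rewrite expRN invrK.
move: (expR _) q0 q1 => q q0 q1; field.
have : 1 - q ^+ 2 != 0 by rewrite gt_eqF//; nra.
have : 1 - q != 0 by rewrite gt_eqF//; lra.
have : q != 0 by rewrite gt_eqF.
have : 1 + 2 * q + q * q != 0 by rewrite gt_eqF//; nra.
have : 1 + q * (2 + q) != 0 by rewrite gt_eqF//; nra.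
by move=> _ -> -> -> ->.
Qed.

Lemma inv_sq_sum_le N : \sum_(1 <= m < N.+1) (m%:R ^+ 2)^-1 <= 3 :> R.
Proof.
apply: le_trans (_ : pi ^+ 2 / 6 <= _).
  by apply: pos_sum_le_lim (@basel_cvg R) => n; rewrite invr_ge0 sqr_ge0.
have := pihalf_lt2 R; have := pi_gt0 R; move: pi => p p0 p2; nra.
Qed.

Definition bose_psum b N : R := \sum_(1 <= m < N.+1) bose (m%:R * b).
Definition bose_sum b : R := limn (bose_psum b).

Lemma bose_psum_le b N : 0 < b -> b ^+ 2 * bose_psum b N <= \sum_(1 <= m < N.+1) (m%:R ^+ 2)^-1.
Proof.
move=> b0; rewrite big_distrr /= !big_nat; apply: ler_sum => m /andP[m0 _].
rewrite mulrC -ler_pdivlMr ?exprn_gt0// -invfM -exprMn; apply: bose_le.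
by rewrite mulr_gt0 ?ltr0n.
Qed.

Lemma cvg_bose_psum b : 0 < b -> bose_psum b @ \oo --> bose_sum b.
Proof.
move=> b0; have [||s h _] := @cvg_pos_sum R (fun m => bose (m%:R * b)) (3 / b ^+ 2).
- by move=> n; exact: bose_ge0.
- move=> n; rewrite ler_pdivlMr ?exprn_gt0// mulrC.
  exact: le_trans (bose_psum_le n b0) (inv_sq_sum_le n).
by apply/cvg_ex; exists s.
Qed.

Lemma bose_sum_half b : 0 < b -> bose_sum (b / 2) = 4 * bose_sum b + sech2_sum (b / 2).
Proof.
move=> b0; have b20 : 0 < b / 2 by lra.
have h : (fun N => 4 * bose_psum b N + sech2_psum (b / 2) N) @ \oo -->
    4 * bose_sum b + sech2_sum (b / 2).
  apply: cvgD; last exact: cvg_sech2_psum.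
  by apply: cvgM; [exact: cvg_cst|exact: cvg_bose_psum].
apply: (cvg_unique _ (cvg_bose_psum b20)); first exact: Rhausdorff.
suff -> : bose_psum (b / 2) = (fun N => 4 * bose_psum b N + sech2_psum (b / 2) N) by [].
apply/funext => N; rewrite /bose_psum big_distrr -big_split /=; apply: eq_big_nat => m /andP[m0 _].
rewrite -bose_double ?mulr_gt0 ?ltr0n//.
have -> : 2 * (m%:R * (b / 2)) = m%:R * b by field.
ring.
Qed.

(** From e^(-x)/x^2 <= bose x <= 1/x^2, with a fixed cut-off [N] in the lower bound: the first N
    terms then lose at most c N, which vanishes with c. *)
Lemma bose_sum_lim b : 0 < b <= 1 ->
  (fun n => (b * 2^-1 ^+ n) ^+ 2 * bose_sum (b * 2^-1 ^+ n)) @ \oo --> (pi ^+ 2 / 6 : R).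
Proof.
move=> /andP[b0 b1]; apply/cvgrPdist_le => e e0.
have [N hN] : exists N, pi ^+ 2 / 6 - e / 2 <= \sum_(1 <= m < N.+1) (m%:R ^+ 2)^-1 :> R.
  have := @basel_cvg R; move/cvgrPdist_le => /(_ (e / 2) ltac:(lra)) [N _ hN].
  exists N; have := hN N (leqnn N); rewrite ler_norml => /andP[_] /=; lra.
have h : (fun n => b * 2^-1 ^+ n * N%:R : R) @ \oo --> b * 0 * N%:R.
  by apply: cvgM; [apply: cvgM; [exact: cvg_cst|exact: cvg_half_pow]|exact: cvg_cst].
rewrite mulr0 mul0r in h; move/cvgrPdist_le : h => /(_ (e / 2) ltac:(lra)).
apply: filterS => n /=; rewrite sub0r normrN.
have c0 : 0 < b * 2^-1 ^+ n by rewrite mulr_gt0// exprn_gt0.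
move: (b * _) c0 => c c0 /(le_trans (ler_norm _)) hc.
have cv : (fun M => c ^+ 2 * bose_psum c M) @ \oo --> c ^+ 2 * bose_sum c.
  by apply: cvgM; [exact: cvg_cst|exact: cvg_bose_psum].
have ub : c ^+ 2 * bose_sum c <= pi ^+ 2 / 6.
  apply: (le_lim_bound cv); exists 0%N => M _; apply: le_trans (bose_psum_le M c0) _.
  by apply: pos_sum_le_lim (@basel_cvg R) => k; rewrite invr_ge0 sqr_ge0.
have lb : \sum_(1 <= m < N.+1) (m%:R ^+ 2)^-1 - c * N%:R <= c ^+ 2 * bose_sum c.
  apply: le_trans (_ : c ^+ 2 * bose_psum c N <= _); last first.
    rewrite ler_pM2l ?exprn_gt0//; apply: pos_sum_le_lim (cvg_bose_psum c0) => k.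
    exact: bose_ge0.
  have -> : c * N%:R = \sum_(1 <= m < N.+1) c by rewrite sumr_const_nat subn1 mulr_natr.
  rewrite -sumrB big_distrr /= !big_nat; apply: ler_sum => m /andP[m0 _].
  have m0' : 0 < m%:R :> R by rewrite ltr0n.
  have mc0 : 0 < m%:R * c by rewrite mulr_gt0.
  apply: le_trans (_ : c ^+ 2 * (expR (- (m%:R * c)) / (m%:R * c) ^+ 2) <= _); last first.
    by rewrite ler_pM2l ?exprn_gt0// bose_ge.
  have -> : c ^+ 2 * (expR (- (m%:R * c)) / (m%:R * c) ^+ 2) = expR (- (m%:R * c)) / m%:R ^+ 2.
    by field; rewrite !gt_eqF.
  apply: le_trans (_ : (1 - m%:R * c) / m%:R ^+ 2 <= _); last first.
    by rewrite ler_wpM2r ?invr_ge0 ?sqr_ge0//; have := expR_ge1Dx (- (m%:R * c)); lra.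
  have -> : (1 - m%:R * c) / m%:R ^+ 2 = (m%:R ^+ 2)^-1 - c / m%:R by field; rewrite gt_eqF.
  rewrite lerD2l lerN2 ler_piMr ?(ltW c0)// invf_le1//.
  by rewrite ler1n.
rewrite ler_norml; apply/andP; split; lra.
Qed.

Definition bose_main b : R := pi ^+ 2 / 6 / b ^+ 2 - (2 * b)^-1 + 24^-1.

(** After multiplication by b^2 and removal of the terms in 1/b and 1, the halving increments are
    b^2/4 times the error in [sech2_sum_asymp]. Dividing by b^2 again costs two powers, hence
    [k.+2]. *)
Lemma bose_sum_asymp k : exists2 C, 0 <= C & forall b, 0 < b <= 1 ->
  `|bose_sum b - bose_main b| <= C * b ^+ k.
Proof.
have [C C0 hC] := sech2_sum_asymp R k.+2.
have step b : 0 < b <= 1 ->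
  `|(b / 2) ^+ 2 * (bose_sum (b / 2) + (2 * (b / 2))^-1 - 24^-1) -
    b ^+ 2 * (bose_sum b + (2 * b)^-1 - 24^-1)| <= C * b ^+ k.+2.
  move=> /andP[b0 b1]; rewrite bose_sum_half//.
  have := hC (b / 2) ltac:(lra); set s := sech2_sum _; set t := bose_sum b.
  have -> : (b / 2) ^+ 2 * (4 * t + s + (2 * (b / 2))^-1 - 24^-1) -
    b ^+ 2 * (t + (2 * b)^-1 - 24^-1) = b ^+ 2 / 4 * (s - ((2 * (b / 2))^-1 - 8^-1)).
    by field; rewrite gt_eqF.
  have b24 : 0 <= b ^+ 2 / 4 by rewrite divr_ge0 ?sqr_ge0.
  move=> h; rewrite normrM (ger0_norm b24); apply: le_trans (ler_wpM2l b24 h) _.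
  rewrite mulrCA ler_wpM2l//.
  apply: le_trans (_ : 1 * (b / 2) ^+ k.+2 <= _).
    by rewrite ler_wpM2r ?exprn_ge0//; nra.
  by rewrite mul1r lerXn2r ?nnegrE; lra.
have lim b : 0 < b <= 1 -> (fun n => (b * 2^-1 ^+ n) ^+ 2 *
    (bose_sum (b * 2^-1 ^+ n) + (2 * (b * 2^-1 ^+ n))^-1 - 24^-1)) @ \oo --> (pi ^+ 2 / 6 : R).
  move=> /[dup] b01 /andP[b0 b1].
  have -> : pi ^+ 2 / 6 = pi ^+ 2 / 6 + b * 0 / 2 - (b * 0) * (b * 0) / 24 :> R by lra.
  have -> : (fun n => (b * 2^-1 ^+ n) ^+ 2 *
    (bose_sum (b * 2^-1 ^+ n) + (2 * (b * 2^-1 ^+ n))^-1 - 24^-1)) =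
    (fun n => (b * 2^-1 ^+ n) ^+ 2 * bose_sum (b * 2^-1 ^+ n) + b * 2^-1 ^+ n / 2 -
      (b * 2^-1 ^+ n) * (b * 2^-1 ^+ n) / 24).
    apply/funext => n; have c0 : 0 < b * 2^-1 ^+ n by rewrite mulr_gt0// exprn_gt0.
    by move: (b * _) c0 => c c0; field; rewrite gt_eqF.
  have hb : (fun n => b * 2^-1 ^+ n) @ \oo --> b * 0.
    by apply: cvgM; [exact: cvg_cst|exact: cvg_half_pow].
  apply: cvgB; last by apply: cvgM; [exact: cvgM|exact: cvg_cst].
  by apply: cvgD; [exact: bose_sum_lim|apply: cvgM => //; exact: cvg_cst].
have := @dyadic_telescope R (fun b => b ^+ 2 * (bose_sum b + (2 * b)^-1 - 24^-1)) C k.+2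
   (pi ^+ 2 / 6) isT C0 step lim.
move=> h; exists (2 * C) => [|b /[dup] b01 /andP[b0 b1]]; first by rewrite mulr_ge0.
have b2 : 0 < b ^+ 2 by rewrite exprn_gt0.
have := h b b01.
have -> : b ^+ 2 * (bose_sum b + (2 * b)^-1 - 24^-1) - pi ^+ 2 / 6 =
   b ^+ 2 * (bose_sum b - bose_main b) by rewrite /bose_main; move: pi => p; field; rewrite gt_eqF.
by rewrite normrM (gtr0_norm b2) -[k.+2]add2n exprD mulrCA ler_pM2l.
Qed.

Lemma geom_arith_sum (q : R) T : q != 1 ->
  \sum_(1 <= d < T.+1) d%:R * q ^+ d =
  q / (1 - q) ^+ 2 - q ^+ T.+1 * (T.+1%:R - T%:R * q) / (1 - q) ^+ 2.
Proof.
move=> q1; have q10 : 1 - q != 0 by rewrite subr_eq0 eq_sym.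
elim: T => [|T IHT]; first by rewrite big_geq//; field.
by rewrite big_nat_recr//= IHT !exprS -!natr1; field.
Qed.

Lemma bose_sub_geom b T m N : 0 < b -> (0 < m <= N)%N -> T = (N %/ m)%N ->
  0 <= bose (m%:R * b) - \sum_(1 <= d < T.+1) d%:R * expR (- (m%:R * b)) ^+ d <=
  (N.+1)%:R * expR (- (N%:R * b / 2)) / b ^+ 2 * (m%:R ^+ 2)^-1.
Proof.
move=> b0 /andP[m0 mN] TE; have m0' : 0 < m%:R :> R by rewrite ltr0n.
have mb0 : 0 < m%:R * b by rewrite mulr_gt0.
have /andP[q0 q1] := expN_lt1 mb0.
rewrite geom_arith_sum ?lt_eqF// /bose opprB addrC subrK.
have T1 : (1 <= T)%N by rewrite TE divn_gt0.
have TN : (T <= N)%N by rewrite TE leq_div.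
have h1 : T%:R * expR (- (m%:R * b)) <= T%:R by rewrite ler_piMr// ltW.
have T0 : 0 <= T%:R :> R by [].
have num0 : 0 <= T.+1%:R - T%:R * expR (- (m%:R * b)).
  by rewrite subr_ge0 (le_trans h1)// ler_nat.
apply/andP; split.
  by rewrite divr_ge0 ?sqr_ge0// mulr_ge0// exprn_ge0// ltW.
(* The largest multiple m T of m below N exceeds N/2: it is at least m and differs from N by less
   than m. *)
have qT : expR (- (m%:R * b)) ^+ T <= expR (- (N%:R * b / 2)).
  rewrite -expRM_natl ler_expR mulrN lerN2 mulrA mulrAC ler_wpM2r ?(ltW b0)//.
  rewrite ler_pdivrMr// -!natrM ler_nat TE.
  have := divn_eq N m; have := ltn_pmod N m0; rewrite -TE; nia.
apply: le_trans (_ : bose (m%:R * b) * (N.+1%:R * expR (- (N%:R * b / 2))) <= _).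
  have q10 : 1 - expR (- (m%:R * b)) != 0 by rewrite gt_eqF// subr_gt0.
  set q := expR (- (m%:R * b)) in q0 q1 h1 num0 qT q10 *; set X := _ - _ * q in num0 *.
  have -> : q ^+ T.+1 * X / (1 - q) ^+ 2 = bose (m%:R * b) * (X * q ^+ T).
    by rewrite /bose -/q exprS; field.
  rewrite ler_wpM2l ?bose_ge0// ler_pM ?exprn_ge0 ?(ltW q0)//.
  by rewrite /X lerBlDr (le_trans (_ : _ <= N.+1%:R)) ?ler_nat// lerDl mulr_ge0 ?(ltW q0).
rewrite [leLHS]mulrC -[leRHS]mulrA ler_wpM2l ?mulr_ge0 ?expR_ge0//.
by apply: le_trans (bose_le mb0) _; rewrite exprMn invfM mulrC.
Qed.

(** One half of the exponential provides the decay in N, the other half an inverse square that can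
    be summed. *)
Lemma bose_tail b M N : 0 < b -> (N <= M)%N ->
  bose_psum b M - bose_psum b N <= 12 * expR (- (N%:R * b / 2)) / b ^+ 2.
Proof.
move=> b0 NM; rewrite /bose_psum (big_cat_nat (n := N.+1) (p := M.+1))//= addrAC subrr add0r.
have hx x : 0 < x -> bose x <= expR (- (x / 2)) * (4 / x ^+ 2).
  move=> x0; have x20 : 0 < x / 2 by lra.
  have /andP[p0 p1] := expN_lt1 x20; have := bose_le x20; rewrite /bose.
  have -> : expR (- x) = expR (- (x / 2)) ^+ 2 by rewrite -expRM_natl; congr expR; lra.
  have -> : ((x / 2) ^+ 2)^-1 = 4 / x ^+ 2 by field; rewrite gt_eqF.
  move: (expR _) p0 p1 => p p0 p1 h.
  rewrite expr2 -mulrA ler_pM2l//; apply: le_trans h; rewrite ler_pM2l//.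
  rewrite lef_pV2 ?posrE ?exprn_gt0 ?subr_gt0//; last by nra.
  by rewrite ler_sqr ?nnegrE; nra.
apply: le_trans (_ : \sum_(N.+1 <= m < M.+1) 4 * expR (- (N%:R * b / 2)) / b ^+ 2 *
    (m%:R ^+ 2)^-1 <= _).
  rewrite !big_nat; apply: ler_sum => m /andP[Nm _].
  have m0 : 0 < m%:R :> R by rewrite ltr0n; lia.
  apply: le_trans (hx _ _) _; first by rewrite mulr_gt0.
  have -> : 4 * expR (- (N%:R * b / 2)) / b ^+ 2 / m%:R ^+ 2 =
    expR (- (N%:R * b / 2)) * (4 / (m%:R * b) ^+ 2) by field; rewrite !gt_eqF.
  rewrite ler_wpM2r ?divr_ge0 ?sqr_ge0// ler_expR lerN2 ler_wpM2r// ler_wpM2r ?(ltW b0)//.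
  by rewrite ler_nat ltnW.
rewrite -big_distrr /=; apply: le_trans (_ : 4 * expR (- (N%:R * b / 2)) / b ^+ 2 * 3 <= _).
  rewrite ler_wpM2l ?divr_ge0 ?sqr_ge0 ?mulr_ge0 ?expR_ge0//.
  apply: le_trans (inv_sq_sum_le M).
  rewrite [leRHS](big_cat_nat (n := N.+1))//= lerDr.
  by apply: sumr_ge0 => m _; rewrite invr_ge0 exprn_ge0.
lra.
Qed.

Lemma sigma_exp_psum b N :
  \sum_(1 <= k < N.+1) (sigma k)%:R * expR (- (k%:R * b)) =
  \sum_(1 <= m < N.+1) \sum_(1 <= d < (N %/ m).+1) d%:R * expR (- (m%:R * b)) ^+ d.
Proof.
rewrite (sum_sigma (fun k => expR (- (k%:R * b)))); apply: eq_big_nat => m /andP[m0 mN].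
rewrite (eq_bigr (fun d => d%:R * expR (- (m%:R * b)) ^+ d)); last first.
  by move=> d _; rewrite -expRM_natl natrM; congr (_ * expR _); ring.
rewrite (eq_bigl (fun d => d <= N %/ m)%N) => [|d]; last by rewrite leq_divRL.
rewrite (big_cat_nat (n := (N %/ m).+1)) //=; last by rewrite ltnS leq_div.
rewrite [X in _ + X]big1_seq ?addr0; last first.
  by move=> d /andP[dN]; rewrite mem_index_iota => /andP[]; lia.
rewrite big_nat_cond [RHS]big_nat_cond; apply: eq_bigl => d.
by rewrite andbT ltnS; case: (d <= _)%N; rewrite ?andbT ?andbF.
Qed.

Lemma sigma_exp_psum_bounds b N : 0 < b ->
  0 <= bose_psum b N - \sum_(1 <= k < N.+1) (sigma k)%:R * expR (- (k%:R * b)) <=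
  N.+1%:R * expR (- (N%:R * b / 2)) / b ^+ 2 * 3.
Proof.
move=> b0; rewrite sigma_exp_psum -sumrB; apply/andP; split.
  rewrite big_nat; apply: sumr_ge0 => m mN.
  by have /andP[] := bose_sub_geom b0 (mN : (0 < m <= N)%N) erefl.
apply: le_trans (_ : N.+1%:R * expR (- (N%:R * b / 2)) / b ^+ 2 *
   \sum_(1 <= m < N.+1) (m%:R ^+ 2)^-1 <= _).
  rewrite big_distrr /= !big_nat; apply: ler_sum => m mN.
  by have /andP[] := bose_sub_geom b0 (mN : (0 < m <= N)%N) erefl.
by rewrite ler_wpM2l ?divr_ge0 ?sqr_ge0 ?mulr_ge0 ?expR_ge0// inv_sq_sum_le.
Qed.

Lemma sigma_exp_psum_le b N : 0 < b ->
  \sum_(1 <= k < N.+1) (sigma k)%:R * expR (- (k%:R * b)) <= 3 / b ^+ 2.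
Proof.
move=> b0; have /andP[h _] := sigma_exp_psum_bounds N b0.
rewrite subr_ge0 in h; apply: le_trans h _; rewrite ler_pdivlMr ?exprn_gt0// mulrC.
exact: le_trans (bose_psum_le N b0) (inv_sq_sum_le N).
Qed.

(** The recursion sums only up to n, so the infinite sum has to be cut; with b of order n^(-1/2) the
    cut is exponentially small in n^(1/2). *)
Lemma sigma_exp_sum b N : 0 < b ->
  `|bose_sum b - \sum_(1 <= k < N.+1) (sigma k)%:R * expR (- (k%:R * b))| <=
  (15 + 3 * N%:R) * expR (- (N%:R * b / 2)) / b ^+ 2.
Proof.
move=> b0; apply: (norm_lim_bound (cvg_bose_psum b0)); exists N => M NM.
have /andP[S0 SN] := sigma_exp_psum_bounds N b0.
have tl := bose_tail b0 NM.
have tl0 : 0 <= bose_psum b M - bose_psum b N.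
  rewrite /bose_psum (big_cat_nat (n := N.+1) (p := M.+1))//= addrAC subrr add0r.
  by apply: sumr_ge0 => *; exact: bose_ge0.
set S := \sum_(_ <= _ < _) _ in S0 SN *.
have -> : bose_psum b M - S = (bose_psum b M - bose_psum b N) + (bose_psum b N - S) by ring.
rewrite ger0_norm; last exact: addr_ge0.
apply: le_trans (lerD tl SN) _.
by rewrite -natr1; lra.
Qed.

End BoseSum.

(** * Saddle-point expansion of the comparison function *)

Section ExpTaylor.
Variable R : realType.
Implicit Types (t x y : R).

(** The derivative of a remainder is minus the preceding one, so the mean value theorem raises the
    order by one; the factorial is given away. *)
Lemma expN_taylor L t : 0 <= t ->
  `|expR (- t) - \sum_(l < L) (- t) ^+ l / l`!%:R| <= t ^+ L.
Proof.
elim: L t => [|L IHL] t t0.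
  by rewrite big_ord0 subr0 ger0_norm ?expR_ge0// -[leRHS]expR0 ler_expR oppr_le0.
pose p M : {poly R} := \sum_(l < M) l`!%:R^-1 *: 'X^l.
have pE M x : (p M).[- x] = \sum_(l < M) (- x) ^+ l / l`!%:R.
  by rewrite horner_sum; apply: eq_bigr => l _; rewrite hornerZ hornerXn mulrC.
have dp M : (p M.+1)^`() = p M.
  rewrite /p big_ord_recl/= derivD expr0 derivZ derivC scaler0 add0r raddf_sum.
  apply: eq_bigr => l _ /=; rewrite derivZ derivXn /bump /= add1n factS natrM invfM.
  by rewrite add0n -(scaler_nat l.+1 'X^l) scalerA mulrAC mulVf ?mul1r// pnatr_eq0.
rewrite -pE; pose F M (x : R) := expR (- x) - (p M).[- x].
have dF x : 0 <= x <= t -> is_derive x 1 (F L.+1) (- F L x).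
  move=> _; have d1 : is_derive x 1 (horner (p L.+1) \o -%R) ((p L).[- x] * -1).
    by rewrite -(dp L); exact: (is_derive1_comp (is_derive_poly _ _) (is_deriveNid _ _)).
  rewrite /F opprB; apply: is_derive_eq; rewrite /GRing.scale/=; ring.
have [c /andP[c0 ct] e] := mean_value t0 dF.
have F0 : F L.+1 0 = 0.
  rewrite /F pE oppr0 expR0 big_ord_recl/= expr0 fact0 divr1 big1 ?addr0 ?subrr// => l _.
  by rewrite /bump /= add1n expr0n/= mul0r.
move: e; rewrite F0 !subr0 -/(F L.+1 t) => ->.
rewrite normrM normrN (ger0_norm t0) exprSr ler_wpM2r// /F pE.
by apply: le_trans (IHL c c0) _; rewrite lerXn2r ?nnegrE.
Qed.

Lemma exp_poly_bound N : exists2 C, 0 <= C & forall t, 0 <= t -> (1 + t) ^+ N * expR (- t) <= C.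
Proof.
case: N => [|N].
  exists 1 => // t t0; rewrite mul1r -[leRHS]expR0 ler_expR; lra.
exists (N.+1%:R ^+ N.+1) => [|t t0]; first by rewrite exprn_ge0.
have N0 : 0 < N.+1%:R :> R by rewrite ltr0n.
have h : 1 + t <= N.+1%:R * expR (t / N.+1%:R).
  apply: le_trans (_ : N.+1%:R * (1 + t / N.+1%:R) <= _).
    by rewrite mulrDr mulr1 mulrCA mulfV ?gt_eqF// mulr1 lerD2r ler1n.
  by rewrite ler_pM2l// expR_ge1Dx.
have : (1 + t) ^+ N.+1 <= (N.+1%:R * expR (t / N.+1%:R)) ^+ N.+1.
  by rewrite lerXn2r ?nnegrE ?mulr_ge0 ?expR_ge0//; lra.
rewrite exprMn -expRM_natl mulrCA mulfV ?gt_eqF// mulr1 => {}h.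
apply: le_trans (ler_wpM2r (expR_ge0 _) h) _.
by rewrite -mulrA -expRD subrr expR0 mulr1.
Qed.

Lemma expN_le_quad y : 0 <= y -> 0 <= y - (1 - expR (- y)) <= y ^+ 2.
Proof.
move=> y0; have h := expR_ge1Dx (- y); apply/andP; split; first by lra.
have h2 := expR_ge1Dx y; have e0 := expR_gt0 y.
rewrite expRN; have ei0 : 0 < (expR y)^-1 by rewrite invr_gt0.
have e1 : expR y * (expR y)^-1 = 1 by rewrite mulfV// gt_eqF.
have : (expR y)^-1 * (1 + y) <= 1 by nra.
have : 0 <= y ^+ 3 by rewrite exprn_ge0.
move: (expR y)^-1 ei0 => q q0; rewrite !exprS expr0 !mulr1 => y3 h3.
nra.
Qed.

End ExpTaylor.

(** * Approximation by exponentials, uniform in the shift *)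

Section SaddleExpansion.
Variables (R : realType) (a : R).
Hypothesis a_ge1 : 1 <= a.
Implicit Types (s x : R) (q : R -> R -> R) (K N D H : nat).

(** With s = S(n), [saddle_y s k] is S(n - k); [saddle_z] is its drop from s to first order, and
    [saddle_u] the exact drop relative to s. *)
Definition saddle_y s x := Num.sqrt (s ^+ 2 - 2 * a * x).
Definition saddle_z s x := a * x / s.
Definition saddle_u s x := 1 - saddle_y s x / s.
Definition saddle_dom s x := [/\ 2 <= s, 0 <= x & 1 <= s ^+ 2 - 2 * a * x].

Lemma saddle_domE s x : saddle_dom s x ->
  [/\ 0 <= saddle_z s x, 1 <= saddle_y s x, saddle_y s x <= s &
      saddle_y s x ^+ 2 = s ^+ 2 - 2 * a * x].
Proof.
have a1 := a_ge1; move=> [s2 x0 y1]; split.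
- by apply: divr_ge0; [apply: mulr_ge0|]; lra.
- by rewrite -[leLHS]sqrtr1 ler_sqrt//; lra.
- have : saddle_y s x <= Num.sqrt (s ^+ 2) by rewrite ler_wsqrtr// lerBlDr lerDl !mulr_ge0//; lra.
  by rewrite sqrtr_sqr ger0_norm//; lra.
- by rewrite sqr_sqrtr//; lra.
Qed.

Definition saddle_growth q := exists N, exists2 C, 0 <= C &
  forall s x, saddle_dom s x -> `|q s x| <= C * (s * (1 + saddle_z s x)) ^+ N.

(* The node [expR (- x / s ^+ H)] plays the role of a variable infinitely close to [1]:
   polynomials in it are sums of exponentials, and approximate polynomials in [x]. *)
Definition saddle_node H s x := expR (- (x / s ^+ H)).

(** [N] and [H0] depend on [K] alone and every larger [H] is allowed, so that two approximants can
    share a node and be added or multiplied; degree and size in [s] may depend on [H]. The factor (1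
    + z)^N is later absorbed by e^(-z). *)
Definition saddle_approx q := saddle_growth q /\
  forall K, exists N H0, forall H, (H0 <= H)%N ->
  exists D (P : R -> {poly R}), exists2 C, 0 <= C &
  (forall s, 2 <= s -> (size (P s) <= D)%N /\ forall i, `|(P s)`_i| <= C * s ^+ D) /\
  (forall s x, saddle_dom s x ->
    `|q s x - (P s).[saddle_node H s x]| <= C * (1 + saddle_z s x) ^+ N / s ^+ K).

Lemma pow_le (y : R) m n : 1 <= y -> (m <= n)%N -> y ^+ m <= y ^+ n.
Proof. by move=> y1 mn; rewrite ler_weXn2l. Qed.

Lemma saddle_approxC (c : R -> R) N C : 0 <= C -> (forall s, 2 <= s -> `|c s| <= C * s ^+ N) ->
  saddle_approx (fun s _ => c s).
Proof.
move=> C0 hc; split.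
  exists N, C => // s x /[dup] sd [s2 x0 _]; have [z0 _ _ _] := saddle_domE sd.
  apply: le_trans (hc s s2) _; rewrite ler_wpM2l// lerXn2r ?nnegrE ?mulr_ge0 ?addr_ge0//; try lra.
  by rewrite ler_peMr; lra.
move=> K; exists 0%N, 0%N => H _; exists N.+1, (fun s => (c s)%:P), C => //; split.
  move=> s s2; split; first by rewrite (leq_trans (size_polyC_leq1 _)).
  move=> i; have h : `|c s| <= C * s ^+ N.+1.
    by apply: le_trans (hc s s2) _; rewrite ler_wpM2l// pow_le//; lra.
  by rewrite coefC; case: eqP => // _; rewrite normr0 (le_trans _ h).
move=> s x [s2 _ _]; rewrite hornerC subrr normr0 expr0 mulr1 divr_ge0// exprn_ge0//; lra.
Qed.

Lemma saddle_growthD q1 q2 : saddle_growth q1 -> saddle_growth q2 ->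
  saddle_growth (fun s x => q1 s x + q2 s x).
Proof.
move=> [N1 [C1 C10 h1]] [N2 [C2 C20 h2]].
exists (N1 + N2)%N, (C1 + C2); first exact: addr_ge0.
move=> s x /[dup] sd [s2 x0 _]; have [z0 _ _ _] := saddle_domE sd.
have y1 : 1 <= s * (1 + saddle_z s x) by nra.
rewrite mulrDl (le_trans (ler_normD _ _))// lerD//.
  by apply: le_trans (h1 _ _ sd) _; rewrite ler_wpM2l// pow_le// leq_addr.
by apply: le_trans (h2 _ _ sd) _; rewrite ler_wpM2l// pow_le// leq_addl.
Qed.

Lemma saddle_growthM q1 q2 : saddle_growth q1 -> saddle_growth q2 ->
  saddle_growth (fun s x => q1 s x * q2 s x).
Proof.
move=> [N1 [C1 C10 h1]] [N2 [C2 C20 h2]].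
exists (N1 + N2)%N, (C1 * C2); first exact: mulr_ge0.
move=> s x /[dup] sd [s2 x0 _].
by rewrite normrM exprD mulrACA ler_pM// (h1, h2).
Qed.

Lemma saddle_approxD q1 q2 : saddle_approx q1 -> saddle_approx q2 ->
  saddle_approx (fun s x => q1 s x + q2 s x).
Proof.
move=> [g1 h1] [g2 h2]; split; first exact: saddle_growthD.
move=> K; have [N1 [H1 {}h1]] := h1 K; have [N2 [H2 {}h2]] := h2 K.
exists (N1 + N2)%N, (maxn H1 H2) => H; rewrite geq_max => /andP[HH1 HH2].
have [D1 [P1 [C1 C10 [b1 e1]]]] := h1 H HH1; have [D2 [P2 [C2 C20 [b2 e2]]]] := h2 H HH2.
exists (D1 + D2)%N, (fun s => P1 s + P2 s), (C1 + C2); first exact: addr_ge0.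
split=> [s s2|s x /[dup] sd [s2 x0 _]].
  have [sz1 c1] := b1 s s2; have [sz2 c2] := b2 s s2; split.
    rewrite (leq_trans (size_polyD _ _))// geq_max (leq_trans sz1) ?leq_addr//.
    by rewrite (leq_trans sz2) ?leq_addl.
  move=> i; rewrite coefD mulrDl (le_trans (ler_normD _ _))// lerD//.
    by apply: le_trans (c1 i) _; rewrite ler_wpM2l// pow_le ?leq_addr//; lra.
  by apply: le_trans (c2 i) _; rewrite ler_wpM2l// pow_le ?leq_addl//; lra.
have [z0 _ _ _] := saddle_domE sd; have z1 : 1 <= 1 + saddle_z s x by lra.
have sK : 0 <= (s ^+ K)^-1 by rewrite invr_ge0 exprn_ge0//; lra.
rewrite hornerD opprD addrACA (le_trans (ler_normD _ _))// !mulrDl lerD//.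
  by apply: le_trans (e1 _ _ sd) _; rewrite ler_wpM2r// ler_wpM2l// pow_le// leq_addr.
by apply: le_trans (e2 _ _ sd) _; rewrite ler_wpM2r// ler_wpM2l// pow_le// leq_addl.
Qed.

Lemma coef_mul_bound (P Q : {poly R}) D1 D2 B1 B2 : (size P <= D1)%N -> (size Q <= D2)%N ->
  (forall i, `|P`_i| <= B1) -> (forall i, `|Q`_i| <= B2) ->
  forall i, `|(P * Q)`_i| <= (D1 + D2)%:R * (B1 * B2).
Proof.
move=> s1 s2 b1 b2 i.
have B10 : 0 <= B1 := le_trans (normr_ge0 _) (b1 0%N).
have B20 : 0 <= B2 := le_trans (normr_ge0 _) (b2 0%N).
have [Di|iD] := leqP (D1 + D2) i.
  rewrite nth_default ?normr0 ?mulr_ge0//.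
  apply: leq_trans (size_polyMleq _ _) _; apply: leq_trans Di.
  by apply: leq_trans (leq_pred _) _; exact: leq_add.
rewrite coefM (le_trans (ler_norm_sum _ _ _))//.
apply: le_trans (_ : \sum_(j < i.+1) B1 * B2 <= _).
  by apply: ler_sum => j _; rewrite normrM ler_pM.
by rewrite sumr_const card_ord -[leLHS]mulr_natl ler_wpM2r ?mulr_ge0// ler_nat.
Qed.

Lemma saddle_approxM q1 q2 : saddle_approx q1 -> saddle_approx q2 ->
  saddle_approx (fun s x => q1 s x * q2 s x).
Proof.
move=> [g1 h1] [g2 h2]; split; first exact: saddle_growthM.
have [M1 [B1 B10 {}g1]] := g1; have [M2 [B2 B20 {}g2]] := g2.
(* Each factor is approximated beyond order [K] by the growth exponent of the other one, which
   consumes that many powers of [s]. *)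
move=> K; have [N2 [H2 {}h2]] := h2 (K + M1)%N.
have [N1 [H1 {}h1]] := h1 (K + M2)%N.
exists (M1 + M2 + N1 + N2)%N, (maxn H1 H2) => H; rewrite geq_max => /andP[HH1 HH2].
have [D1 [P1 [C1 C10 [b1 e1]]]] := h1 H HH1; have [D2 [P2 [C2 C20 [b2 e2]]]] := h2 H HH2.
pose C := (D1 + D2)%:R * (C1 * C2) + B1 * C2 + C1 * B2 + C1 * C2.
exists (D1 + D2)%N, (fun s => P1 s * P2 s), C; first by rewrite /C !addr_ge0 ?mulr_ge0.
split=> [s s2|s x /[dup] sd [s2 x0 _]].
  have [sz1 c1] := b1 s s2; have [sz2 c2] := b2 s s2; split.
    apply: leq_trans (size_polyMleq _ _) _.
    by apply: leq_trans (leq_pred _) _; exact: leq_add.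
  move=> i; apply: le_trans (coef_mul_bound sz1 sz2 c1 c2 i) _.
  have -> : (D1 + D2)%:R * (C1 * s ^+ D1 * (C2 * s ^+ D2)) =
    (D1 + D2)%:R * (C1 * C2) * s ^+ (D1 + D2) by rewrite exprD; ring.
  rewrite ler_wpM2r ?exprn_ge0//; first by lra.
  by rewrite /C -!addrA lerDl !addr_ge0 ?mulr_ge0.
have [z0 _ _ _] := saddle_domE sd; set z := saddle_z s x in z0 *.
have s0 : 0 < s by lra.
have sp n : 0 < s ^+ n by rewrite exprn_gt0.
have zp n : 1 <= (1 + z) ^+ n by rewrite exprn_ege1//; lra.
have {}g1 := g1 _ _ sd; have {}g2 := g2 _ _ sd; have {}e1 := e1 _ _ sd; have {}e2 := e2 _ _ sd.
rewrite -/z in g1 g2 e1 e2.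
set p1 := (P1 s).[_] in e1; set p2 := (P2 s).[_] in e2.
rewrite hornerM -/p1 -/p2.
have -> : q1 s x * q2 s x - p1 * p2 = q1 s x * (q2 s x - p2) +
   ((q1 s x - p1) * q2 s x - (q1 s x - p1) * (q2 s x - p2)) by ring.
have E1 : `|q1 s x * (q2 s x - p2)| <= B1 * C2 * (1 + z) ^+ (M1 + M2 + N1 + N2) / s ^+ K.
  rewrite normrM; apply: le_trans (ler_pM _ _ g1 e2) _ => //.
  rewrite exprMn (exprD s) invfM.
  have -> : B1 * (s ^+ M1 * (1 + z) ^+ M1) * (C2 * (1 + z) ^+ N2 * ((s ^+ K)^-1 * (s ^+ M1)^-1)) =
     B1 * C2 * (1 + z) ^+ (M1 + N2) / s ^+ K by rewrite exprD; field; rewrite !gt_eqF.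
  rewrite ler_wpM2r ?invr_ge0 ?(ltW (sp _))// ler_wpM2l ?mulr_ge0// pow_le//; first by lra.
  by clear; lia.
have E2 : `|(q1 s x - p1) * q2 s x| <= C1 * B2 * (1 + z) ^+ (M1 + M2 + N1 + N2) / s ^+ K.
  rewrite normrM; apply: le_trans (ler_pM _ _ e1 g2) _ => //.
  rewrite exprMn (exprD s) invfM.
  have -> : C1 * (1 + z) ^+ N1 * ((s ^+ K)^-1 * (s ^+ M2)^-1) * (B2 * (s ^+ M2 * (1 + z) ^+ M2)) =
     C1 * B2 * (1 + z) ^+ (M2 + N1) / s ^+ K by rewrite exprD; field; rewrite !gt_eqF.
  rewrite ler_wpM2r ?invr_ge0 ?(ltW (sp _))// ler_wpM2l ?mulr_ge0// pow_le//; first by lra.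
  by clear; lia.
have E3 : `|(q1 s x - p1) * (q2 s x - p2)| <=
    C1 * C2 * (1 + z) ^+ (M1 + M2 + N1 + N2) / s ^+ K.
  rewrite normrM; apply: le_trans (ler_pM _ _ e1 e2) _ => //.
  rewrite !(exprD s) !invfM.
  have -> : C1 * (1 + z) ^+ N1 * ((s ^+ K)^-1 * (s ^+ M2)^-1) *
     (C2 * (1 + z) ^+ N2 * ((s ^+ K)^-1 * (s ^+ M1)^-1)) =
     C1 * C2 * (1 + z) ^+ (N1 + N2) / s ^+ K * (s ^+ (M2 + K + M1))^-1.
    by rewrite !exprD; field; rewrite !gt_eqF.
  apply: le_trans (_ : C1 * C2 * (1 + z) ^+ (N1 + N2) / s ^+ K <= _).
    rewrite ler_piMr ?divr_ge0 ?mulr_ge0 ?(ltW (sp _))//; first by rewrite exprn_ge0; lra.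
    by rewrite invf_le1// exprn_ege1//; lra.
  rewrite ler_wpM2r ?invr_ge0 ?(ltW (sp _))// ler_wpM2l ?mulr_ge0// pow_le//; first by lra.
  by clear; lia.
apply: le_trans (ler_normD _ _) _; apply: le_trans (lerD E1 (le_trans (ler_normB _ _) (lerD E2 E3))) _.
rewrite -!mulrDl ler_wpM2r ?invr_ge0 ?(ltW (sp _))// ler_wpM2r ?exprn_ge0//; first by lra.
by rewrite /C !addrA -!addrA lerDr mulr_ge0// mulr_ge0.
Qed.

(** Lets truncated series replace a function order by order. The truncation varies with [K], so the
    growth of [q] is asked for separately. *)
Lemma saddle_approx_lim q : saddle_growth q ->
  (forall K, exists q', saddle_approx q' /\ exists N, exists2 C, 0 <= C &
     forall s x, saddle_dom s x -> `|q s x - q' s x| <= C * (1 + saddle_z s x) ^+ N / s ^+ K) ->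
  saddle_approx q.
Proof.
move=> g h; split=> // K; have [q' [[_ h'] [M [B B0 e]]]] := h K.
have [N [H0 {}h']] := h' K; exists (M + N)%N, H0 => H HH.
have [D [P [C C0 [b e']]]] := h' H HH.
exists D, P, (C + B); first exact: addr_ge0.
split=> [s s2|s x /[dup] sd [s2 x0 _]].
  have [sz c] := b s s2; split=> // i; apply: le_trans (c i) _.
  by rewrite ler_wpM2r ?exprn_ge0 ?lerDl//; lra.
have [z0 _ _ _] := saddle_domE sd; have z1 : 1 <= 1 + saddle_z s x by lra.
have sK : 0 <= (s ^+ K)^-1 by rewrite invr_ge0 exprn_ge0//; lra.
rewrite -(subrKA (q' s x)) (le_trans (ler_normD _ _))// addrC !mulrDl lerD//.
  by apply: le_trans (e' _ _ sd) _; rewrite ler_wpM2r// ler_wpM2l// pow_le// leq_addl.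
by apply: le_trans (e _ _ sd) _; rewrite ler_wpM2r// ler_wpM2l// pow_le// leq_addr.
Qed.

(** x is replaced by s^H (1 - e^(-x/s^H)). The quadratic error is about z^2 s^(1-H), which explains
    [H > K]. *)
Lemma saddle_approx_z : saddle_approx saddle_z.
Proof.
have a1 := a_ge1; split.
  exists 1%N, 1 => // s x /[dup] sd [s2 x0 _]; have [z0 _ _ _] := saddle_domE sd.
  rewrite ger0_norm// expr1 mul1r; nra.
move=> K; exists 2%N, K.+1 => H HK.
exists H.+2, (fun s => (a * s ^+ H / s) *: (1 - 'X)), a; first by lra.
split=> [s s2|s x /[dup] sd [s2 x0 _]].
  split; first by rewrite (leq_trans (size_scale_leq _ _))// -opprB size_polyN size_XsubC.
  have s0 : 0 < s by lra.
  move=> i; rewrite coefZ normrM ger0_norm; last first.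
    by rewrite divr_ge0 ?mulr_ge0 ?exprn_ge0//; lra.
  apply: le_trans (_ : a * s ^+ H / s * 1 <= _).
    rewrite ler_wpM2l ?divr_ge0 ?mulr_ge0 ?exprn_ge0//; try lra.
    rewrite coefB coef1 coefX; case: i => [|[|i]] /=; rewrite ?subr0 ?sub0r ?normr1 ?normrN1 ?normr0//.
  rewrite mulr1 ler_pdivrMr// -mulrA ler_wpM2l//; first by lra.
  by rewrite -exprSr; apply: pow_le; [lra|clear; lia].
have s0 : 0 < s by lra.
have [z0 _ _ _] := saddle_domE sd; set z := saddle_z s x in z0 *.
have sH : 0 < s ^+ H by rewrite exprn_gt0.
have y0 : 0 <= x / s ^+ H by rewrite divr_ge0// ltW.
have /andP[h1 h2] := expN_le_quad y0.
have -> : ((a * s ^+ H / s) *: (1 - 'X)).[saddle_node H s x] =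
  a * s ^+ H / s * (1 - expR (- (x / s ^+ H))) by rewrite !hornerE.
have -> : z - a * s ^+ H / s * (1 - expR (- (x / s ^+ H))) =
  a * s ^+ H / s * (x / s ^+ H - (1 - expR (- (x / s ^+ H)))).
  by rewrite /z /saddle_z; field; rewrite !gt_eqF.
have c0 : 0 <= a * s ^+ H / s by rewrite divr_ge0 ?mulr_ge0 ?exprn_ge0//; lra.
rewrite (ger0_norm (mulr_ge0 c0 h1)); apply: le_trans (ler_wpM2l c0 h2) _.
have -> : a * s ^+ H / s * (x / s ^+ H) ^+ 2 = z ^+ 2 / a * (s / s ^+ H).
  by rewrite /z /saddle_z; field; rewrite !gt_eqF//; lra.
apply: le_trans (_ : z ^+ 2 / a * (1 / s ^+ K) <= _).
  rewrite ler_wpM2l ?divr_ge0 ?sqr_ge0//; first by lra.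
  rewrite ler_pdivrMr// mulrAC ler_pdivlMr ?exprn_gt0// mul1r -exprS pow_le//; lra.
rewrite mul1r ler_wpM2r ?invr_ge0 ?exprn_ge0//; first by lra.
rewrite ler_pdivrMr; last by lra.
have aa : 1 <= a * a by nra.
have -> : a * (1 + z) ^+ 2 * a = (a * a) * (1 + z) ^+ 2 by ring.
have hz : z ^+ 2 <= (1 + z) ^+ 2 by rewrite ler_sqr ?nnegrE; lra.
by apply: le_trans hz _; rewrite ler_peMl ?sqr_ge0.
Qed.

Lemma saddle_approx_cst (c : R) : saddle_approx (fun _ _ => c).
Proof. by apply: (@saddle_approxC (fun=> c) 0 `|c|) => // s _; rewrite expr0 mulr1. Qed.

Lemma saddle_approxX q n : saddle_approx q -> saddle_approx (fun s x => q s x ^+ n).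
Proof.
move=> hq; elim: n => [|n IHn]; first exact: saddle_approx_cst.
under eq_fun => s do under eq_fun => x do rewrite exprS.
exact: saddle_approxM.
Qed.

Lemma saddle_approx_sum (F : nat -> R -> R -> R) n : (forall i, saddle_approx (F i)) ->
  saddle_approx (fun s x => \sum_(i < n) F i s x).
Proof.
move=> hF; elim: n => [|n IHn].
  under eq_fun => s do under eq_fun => x do rewrite big_ord0.
  exact: saddle_approx_cst.
under eq_fun => s do under eq_fun => x do rewrite big_ord_recr.
exact: saddle_approxD.
Qed.

Lemma saddle_approx_w : saddle_approx (fun s x => saddle_z s x / s).
Proof.
apply: saddle_approxM; first exact: saddle_approx_z.
apply: (@saddle_approxC (fun s => s^-1) 0 1) => // s s2.
have s0 : 0 < s by lra.
by rewrite mul1r expr0 ger0_norm ?invr_ge0 ?(ltW s0)// invf_le1//; lra.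
Qed.

(** Divided by 2 s^2, the relation y^2 = s^2 - 2 a x becomes a fixed-point equation for u, with z/s
    as small parameter. *)
Lemma saddle_u_spec s x : saddle_dom s x ->
  [/\ 0 <= saddle_u s x, saddle_u s x <= 1 - s^-1, saddle_u s x <= 2 * (saddle_z s x / s) &
      saddle_u s x = saddle_z s x / s + saddle_u s x ^+ 2 / 2].
Proof.
move=> /[dup] sd [s2 x0 _]; have [z0 y1 ys y2] := saddle_domE sd.
have s0 : 0 < s by lra.
have u0 : 0 <= saddle_u s x by rewrite subr_ge0 ler_pdivrMr// mul1r.
have u1 : saddle_u s x <= 1 - s^-1.
  by rewrite /saddle_u lerD2l lerN2 -[leLHS]mul1r ler_wpM2r// invr_ge0 ltW.
have eu : saddle_u s x = saddle_z s x / s + saddle_u s x ^+ 2 / 2.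
  rewrite /saddle_u /saddle_z.
  have -> : a * x = (s ^+ 2 - saddle_y s x ^+ 2) / 2 by rewrite y2; field.
  by field; rewrite gt_eqF.
split=> //; have si : 0 <= s^-1 by rewrite invr_ge0 ltW.
have : saddle_u s x ^+ 2 <= saddle_u s x by rewrite expr2; nra.
set w := saddle_z s x / s in eu *; lra.
Qed.

(** Iterates of the fixed-point equation from 0. The map contracts by (u + v)/2 <= u <= 2 z/s, so
    each iteration gains one power of z/s. *)
Fixpoint saddle_ua J s x : R :=
  if J is J'.+1 then saddle_z s x / s + saddle_ua J' s x ^+ 2 / 2 else 0.

Lemma saddle_approx_ua J : saddle_approx (saddle_ua J).
Proof.
elim: J => [|J IHJ]; first exact: saddle_approx_cst.
apply: saddle_approxD; first exact: saddle_approx_w.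
by apply: saddle_approxM; [exact: saddle_approxX|exact: saddle_approx_cst].
Qed.

Lemma saddle_uaP J s x : saddle_dom s x ->
  [/\ 0 <= saddle_ua J s x, saddle_ua J s x <= saddle_u s x &
      saddle_u s x - saddle_ua J s x <= (2 * (saddle_z s x / s)) ^+ J].
Proof.
move=> sd; have [u0 u1 uw eu] := saddle_u_spec sd.
have [s2 x0 _] := sd; have s0 : 0 < s by lra.
have si : 0 <= s^-1 by rewrite invr_ge0 ltW.
have [z0 _ _ _] := saddle_domE sd.
have w0 : 0 <= saddle_z s x / s by rewrite divr_ge0// ltW.
elim: J => [|J [h1 h2 h3]] /=; first by rewrite expr0; split=> //; lra.
set w := saddle_z s x / s in uw eu w0 h3 *; set u := saddle_u s x in u0 u1 uw eu h2 h3 *.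
set v := saddle_ua J s x in h1 h2 h3 *.
have v2 : 0 <= v ^+ 2 by rewrite sqr_ge0.
have vu : v ^+ 2 <= u ^+ 2 by rewrite lerXn2r.
split; [lra|lra|].
rewrite {1}eu opprD addrACA subrr add0r -mulrBl subr_sqr exprSr.
apply: le_trans (_ : (u - v) * (2 * w) <= _); last by rewrite ler_wpM2r//; lra.
rewrite -mulrA ler_wpM2l//; lra.
Qed.

Lemma saddle_growth_bounded q C : 0 <= C -> (forall s x, saddle_dom s x -> `|q s x| <= C) ->
  saddle_growth q.
Proof. by move=> C0 h; exists 0%N, C => // s x sd; rewrite expr0 mulr1 h. Qed.

Lemma saddle_w_pow J s x : saddle_dom s x ->
  (2 * (saddle_z s x / s)) ^+ J <= 2 ^+ J * (1 + saddle_z s x) ^+ J / s ^+ J.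
Proof.
move=> /[dup] sd [s2 x0 _]; have [z0 _ _ _] := saddle_domE sd.
move: (saddle_z s x) z0 => z z0; rewrite !exprMn exprVn mulrA ler_wpM2r ?invr_ge0 ?exprn_ge0//; first by lra.
by rewrite ler_wpM2l ?exprn_ge0// lerXn2r ?nnegrE ?addr_ge0// lerDr.
Qed.

Lemma saddle_approx_u : saddle_approx saddle_u.
Proof.
apply: saddle_approx_lim.
  apply: (@saddle_growth_bounded _ 1) => // s x sd; have [u0 u1 _ _] := saddle_u_spec sd.
  have [s2 _ _] := sd; rewrite ger0_norm// (le_trans u1)// lerBlDr lerDl invr_ge0; lra.
move=> K; exists (saddle_ua K); split; first exact: saddle_approx_ua.
exists K, (2 ^+ K); first exact: exprn_ge0.
move=> s x sd; have [h1 h2 h3] := saddle_uaP K sd.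
by rewrite ger0_norm ?subr_ge0//; apply: le_trans h3 _; exact: saddle_w_pow.
Qed.

Lemma saddle_approx_1Bu : saddle_approx (fun s x => 1 - saddle_u s x).
Proof.
apply: saddle_approxD; first exact: saddle_approx_cst.
under eq_fun => s do under eq_fun => x do rewrite -mulN1r.
by apply: saddle_approxM; [exact: saddle_approx_cst|exact: saddle_approx_u].
Qed.

Lemma saddle_approx_inv : saddle_approx (fun s x => (1 - saddle_u s x)^-1).
Proof.
have bnd s x : saddle_dom s x -> 0 < (1 - saddle_u s x)^-1 <= s.
  move=> /[dup] sd [s2 _ _]; have [u0 u1 _ _] := saddle_u_spec sd.
  have si : 0 < s^-1 by rewrite invr_gt0; lra.
  have h : s^-1 <= 1 - saddle_u s x by lra.
  rewrite invr_gt0 (lt_le_trans si h)/= -[leRHS]invrK lef_pV2 ?posrE//; lra.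
apply: saddle_approx_lim.
  exists 1%N, 1 => // s x sd; have /andP[i0 i1] := bnd s x sd.
  have [s2 _ _] := sd; have [z0 _ _ _] := saddle_domE sd.
  by rewrite mul1r expr1 ger0_norm ?(ltW i0)//; nra.
(* One term more than [K]: the remainder carries 1/(1 - u), which can be as large as [s]. *)
move=> K; exists (fun s x => \sum_(i < K.+1) saddle_u s x ^+ i); split.
  apply: (@saddle_approx_sum (fun i s x => saddle_u s x ^+ i)) => i.
  exact: saddle_approxX saddle_approx_u.
exists K.+1, (2 ^+ K.+1); first exact: exprn_ge0.
move=> s x sd; have /andP[i0 i1] := bnd s x sd; have [s2 _ _] := sd.
have [u0 _ uw _] := saddle_u_spec sd; have [z0 _ _ _] := saddle_domE sd.
have s0 : 0 < s by lra.
have n0 : 1 - saddle_u s x != 0 by rewrite -invr_eq0 gt_eqF.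
have -> : (1 - saddle_u s x)^-1 - \sum_(i < K.+1) saddle_u s x ^+ i =
    saddle_u s x ^+ K.+1 * (1 - saddle_u s x)^-1.
  have := subrX1 (saddle_u s x) K.+1; set T := \sum_(i < _) _ => e.
  have -> : saddle_u s x ^+ K.+1 = 1 + (saddle_u s x - 1) * T by rewrite -e; ring.
  by field.
rewrite ger0_norm; last by rewrite mulr_ge0 ?exprn_ge0 ?(ltW i0).
apply: le_trans (_ : 2 ^+ K.+1 * (1 + saddle_z s x) ^+ K.+1 / s ^+ K.+1 * s <= _).
  rewrite ler_pM ?exprn_ge0 ?(ltW i0)//; apply: le_trans (saddle_w_pow _ sd).
  by rewrite lerXn2r// nnegrE mulr_ge0// divr_ge0// ltW.
by rewrite [s ^+ K.+1]exprS invfM -!mulrA (mulrCA s^-1) mulVf ?gt_eqF// mulr1.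
Qed.

(** The exponent is at most 2 z^2/s, hence a small quantity up to powers of 1 + z, and [K] Taylor
    terms suffice. *)
Lemma saddle_approx_gauss : saddle_approx (fun s x => expR (- (s * saddle_u s x ^+ 2 / 2))).
Proof.
have t0 s x : saddle_dom s x -> 0 <= s * saddle_u s x ^+ 2 / 2.
  by move=> [s2 _ _]; apply: divr_ge0 => //; apply: mulr_ge0; [lra|exact: sqr_ge0].
apply: saddle_approx_lim.
  apply: (@saddle_growth_bounded _ 1) => // s x sd.
  by rewrite ger0_norm ?expR_ge0// -[leRHS]expR0 ler_expR oppr_le0; exact: t0.
move=> K; exists (fun s x => \sum_(l < K) (- (s * saddle_u s x ^+ 2 / 2)) ^+ l / l`!%:R); split.
  apply: (@saddle_approx_sum (fun l s x => (- (s * saddle_u s x ^+ 2 / 2)) ^+ l / l`!%:R)) => l.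
  apply: saddle_approxM; last exact: saddle_approx_cst.
  apply: saddle_approxX; under eq_fun => s do under eq_fun => x do rewrite -mulN1r.
  apply: saddle_approxM; first exact: saddle_approx_cst.
  apply: saddle_approxM; last exact: saddle_approx_cst.
  apply: saddle_approxM; last exact: saddle_approxX saddle_approx_u.
  apply: (@saddle_approxC id 1 1) => // s s2; rewrite expr1 mul1r ger0_norm//; lra.
exists (K + K)%N, (2 ^+ K); first exact: exprn_ge0.
move=> s x sd; apply: le_trans (expN_taylor K (t0 s x sd)) _.
have [u0 _ uw _] := saddle_u_spec sd; have [z0 _ _ _] := saddle_domE sd.
have [s2 _ _] := sd; have s0 : 0 < s by lra.
have -> : 2 ^+ K * (1 + saddle_z s x) ^+ (K + K) / s ^+ K = (2 * (1 + saddle_z s x) ^+ 2 / s) ^+ K.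
  by rewrite addnn -mul2n exprM !exprMn exprVn.
apply: lerXn2r; rewrite ?nnegrE; [exact: t0| |].
  by apply: divr_ge0 (ltW s0); rewrite mulr_ge0 ?sqr_ge0.
apply: le_trans (_ : s * (2 * (saddle_z s x / s)) ^+ 2 / 2 <= _).
  rewrite ler_wpM2r// ler_wpM2l ?(ltW s0)// ler_sqr// nnegrE.
  by rewrite mulr_ge0// divr_ge0// ltW.
have -> : s * (2 * (saddle_z s x / s)) ^+ 2 / 2 = 2 * saddle_z s x ^+ 2 / s.
  by field; rewrite gt_eqF.
rewrite ler_wpM2r ?invr_ge0 ?(ltW s0)// ler_wpM2l// ler_sqr ?nnegrE ?addr_ge0//; lra.
Qed.

(** Up to a constant, the growing part of y^(-3/2) I_(3/2)(y) for the modified Bessel function. It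
    is also 1/y times the derivative of e^y/y, which makes it integrable twice in closed form along
    y dy = -a dx. *)
Definition saddle_phi (y : R) := expR y * (y - 1) / y ^+ 3.

Lemma saddle_phi_gt0 y : 1 < y -> 0 < saddle_phi y.
Proof. by move=> y1; rewrite divr_gt0 ?mulr_gt0 ?expR_gt0 ?exprn_gt0//; lra. Qed.

(** By the fixed-point equation s - y = s u = z + s u^2/2, so e^(y - s) splits off the exact
    exponential e^(-z). *)
Lemma saddle_phi_ratio s x : saddle_dom s x ->
  saddle_phi (saddle_y s x) / saddle_phi s = expR (- saddle_z s x) *
   (expR (- (s * saddle_u s x ^+ 2 / 2)) * (((1 - saddle_u s x) - s^-1) * (1 - s^-1)^-1) *
    ((1 - saddle_u s x)^-1) ^+ 3).
Proof.
move=> /[dup] sd [s2 _ _]; have [z0 y1 ys _] := saddle_domE sd.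
have [_ _ _ eu] := saddle_u_spec sd; have s0 : 0 < s by lra.
have eS : expR (saddle_y s x) = expR s * (expR (- saddle_z s x) *
    expR (- (s * saddle_u s x ^+ 2 / 2))).
  rewrite -!expRD; congr expR.
  have e1 : s * saddle_u s x = s - saddle_y s x by rewrite /saddle_u; field; rewrite gt_eqF.
  have e2 : s * saddle_u s x = saddle_z s x + s * saddle_u s x ^+ 2 / 2.
    by rewrite {1}eu; field; rewrite gt_eqF.
  by rewrite e1 in e2; lra.
rewrite /saddle_phi eS.
have -> : 1 - saddle_u s x = saddle_y s x / s by rewrite /saddle_u; ring.
have e0 : expR s != 0 by rewrite gt_eqF// expR_gt0.
move: (expR s) e0 (expR (- saddle_z s x)) (expR (- (s * saddle_u s x ^+ 2 / 2))) => E E0 E1 E2.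
field; rewrite E0 !gt_eqF//; lra.
Qed.

(* The saddle-point expansion of the comparison function, as a sum of exponentials
   [expR (- (a / s + i / s ^+ H) * x)] with an error that is uniform in [x]. *)
Lemma saddle_phi_exp_approx K : exists H D (P : R -> {poly R}), exists2 C, 0 <= C &
  [/\ (2 <= H)%N,
  (forall s, 2 <= s -> (size (P s) <= D)%N /\ forall i, `|(P s)`_i| <= C * s ^+ D) &
  (forall s x, saddle_dom s x ->
    `|saddle_phi (saddle_y s x) / saddle_phi s -
      expR (- saddle_z s x) * (P s).[saddle_node H s x]| <= C / s ^+ K)].
Proof.
have [_ /(_ K)] : saddle_approx (fun s x =>
    expR (- (s * saddle_u s x ^+ 2 / 2)) * (((1 - saddle_u s x) - s^-1) * (1 - s^-1)^-1) *
    ((1 - saddle_u s x)^-1) ^+ 3).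
  apply: saddle_approxM; last exact: saddle_approxX saddle_approx_inv.
  apply: saddle_approxM; first exact: saddle_approx_gauss.
  have si s : 2 <= s -> 0 < s^-1 <= 2^-1.
    by move=> s2; rewrite invr_gt0 lef_pV2 ?posrE//; lra.
  apply: saddle_approxM; last first.
    apply: (@saddle_approxC (fun s => (1 - s^-1)^-1) 0 2) => // s /si/andP[i0 i1].
    rewrite expr0 mulr1 ger0_norm ?invr_ge0; last by lra.
    by rewrite -[leRHS]invrK lef_pV2 ?posrE; lra.
  apply: saddle_approxD; first exact: saddle_approx_1Bu.
  apply: (@saddle_approxC (fun s => - s^-1) 0 1) => // s /si/andP[i0 i1].
  by rewrite expr0 mulr1 normrN ger0_norm; lra.
(* [H >= 2] keeps the rates a/s + i/s^H between a/s and 2a/s once s exceeds the degree bound. *)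
move=> [N [H0 /(_ (maxn H0 2) (leq_maxl _ _))]] [D [P [C C0 [b e]]]].
have [B B0 hB] := exp_poly_bound R N.
exists (maxn H0 2), D, P, (C * B + C); first by rewrite addr_ge0 ?mulr_ge0.
split; [exact: leq_maxr| |].
  move=> s s2; have [sz c] := b s s2; split=> // i; apply: le_trans (c i) _.
  by rewrite ler_wpM2r ?exprn_ge0 ?lerDr ?mulr_ge0//; lra.
move=> s x sd; have [z0 _ _ _] := saddle_domE sd; have [s2 _ _] := sd.
have sK : 0 <= (s ^+ K)^-1 by rewrite invr_ge0 exprn_ge0//; lra.
rewrite saddle_phi_ratio// -mulrBr normrM ger0_norm ?expR_ge0//.
apply: le_trans (ler_wpM2l (expR_ge0 _) (e _ _ sd)) _.
rewrite mulrA ler_wpM2r// mulrCA mulrC; apply: le_trans (_ : C * B <= _); last by rewrite lerDl.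
by rewrite mulrC ler_wpM2l// mulrC hB.
Qed.

End SaddleExpansion.

(** * The comparison function nearly solves the recursion *)

Section NearSolution.
Variable R : realType.
Implicit Types (s x X : R) (K n : nat).

Lemma exp_decay M : exists2 C : R, 0 <= C &
  forall s, 0 < s -> expR (- (s / 4)) <= C / s ^+ M.
Proof.
have [B B0 hB] := exp_poly_bound R M; exists (4 ^+ M * B); first by rewrite mulr_ge0 ?exprn_ge0.
move=> s s0; rewrite ler_pdivlMr ?exprn_gt0//.
have s40 : 0 <= s / 4 by lra.
have := hB _ s40; have : s ^+ M <= 4 ^+ M * (1 + s / 4) ^+ M.
  by rewrite -exprMn lerXn2r ?nnegrE//; lra.
move=> h1 h2; apply: le_trans (ler_wpM2l (expR_ge0 _) h1) _.
by rewrite mulrCA ler_wpM2l ?exprn_ge0// mulrC.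
Qed.

(** The antiderivatives to be estimated are small at the far end [X], while their values at 0 are
    wanted; hence the backward direction. *)
Lemma derive_backward (f f' : R -> R) X B : 0 <= X ->
  (forall x, 0 <= x <= X -> is_derive x 1 f (f' x)) ->
  (forall x, 0 <= x <= X -> `|f' x| <= B) ->
  forall x, 0 <= x <= X -> `|f x| <= `|f X| + B * X.
Proof.
move=> X0 df hB x /andP[x0 xX].
have [|c /andP[cx cX] e] := @mean_value R f f' x X xX.
  by move=> y /andP[y0 yX]; apply: df; rewrite yX (le_trans x0).
have -> : f x = f X - f' c * (X - x) by rewrite -e; ring.
apply: le_trans (ler_normB _ _) _; rewrite lerD2l normrM.
apply: ler_pM => //; first by apply: hB; rewrite cX (le_trans x0).
by rewrite ger0_norm ?subr_ge0// lerBlDr lerDl.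
Qed.

Lemma is_derive_sum_fun D (f f' : nat -> R -> R) x :
  (forall i, is_derive x 1 (f i) (f' i x)) ->
  is_derive x 1 (fun y => \sum_(i < D) f i y) (\sum_(i < D) f' i x).
Proof.
move=> df; elim: D => [|D IHD].
  under eq_fun => y do rewrite big_ord0.
  by rewrite big_ord0; exact: is_derive_cst.
under eq_fun => y do rewrite big_ord_recr/=.
by rewrite big_ord_recr/=; exact: is_deriveD.
Qed.

Lemma is_derive_scaled_exp (c b x : R) :
  is_derive x 1 (fun y => c * expR (- (b * y))) (- (c * b * expR (- (b * x)))).
Proof.
have d1 : is_derive x 1 (fun y : R => - (b * y)) (- b).
  by apply: is_derive_eq; rewrite /GRing.scale/=; ring.
have d2 := @is_derive1_comp R expR (fun y => - (b * y)) x _ _ (is_derive_expR _) d1.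
apply: is_derive_eq; rewrite /GRing.scale/=; ring.
Qed.

Let a : R := pi ^+ 2 / 3.

Local Ltac goal_lra := clear - a; lra.

Lemma pi2_3_bounds : 4 / 3 <= a <= 16 / 3.
Proof.
have p2 := pi_ge2 R; have p4 := pihalf_lt2 R; rewrite /a; move: pi p2 p4 => p p2 p4.
apply/andP; split; nra.
Qed.

Lemma a_ge1 : 1 <= a.
Proof. by have /andP[h _] := pi2_3_bounds; lra. Qed.

Lemma is_derive_saddle_y s x : 0 < s ^+ 2 - 2 * a * x ->
  is_derive x 1 (saddle_y a s) (- a / saddle_y a s x).
Proof.
move=> h; have d1 : is_derive x 1 (fun y : R => s ^+ 2 - 2 * a * y) (- (2 * a)).
  by apply: is_derive_eq; rewrite /GRing.scale/=; ring.
have := @is_derive1_comp R Num.sqrt (fun y => s ^+ 2 - 2 * a * y) x _ _ (is_derive1_sqrt h) d1; congr is_derive.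
have y0 : 0 < saddle_y a s x by rewrite sqrtr_gt0.
by rewrite -/(saddle_y a s x); field; rewrite gt_eqF.
Qed.

Lemma is_derive_saddle_G s x : 0 < s ^+ 2 - 2 * a * x ->
  is_derive x 1 (fun x => expR (saddle_y a s x)) (- a * (expR (saddle_y a s x) / saddle_y a s x)).
Proof.
move=> h; have := is_derive1_comp (is_derive_expR _) (is_derive_saddle_y h).
by congr is_derive; ring.
Qed.

Lemma is_derive_saddle_G1 s x : 0 < s ^+ 2 - 2 * a * x ->
  is_derive x 1 (fun x => expR (saddle_y a s x) / saddle_y a s x)
    (- a * saddle_phi (saddle_y a s x)).
Proof.
move=> h; have y0 : 0 < saddle_y a s x by rewrite sqrtr_gt0.
have y0' : saddle_y a s x != 0 by rewrite gt_eqF.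
have dV := @is_deriveV R _ x _ 1 y0' (is_derive_saddle_y h).
have dG := is_derive_saddle_G h.
have := @is_deriveM R R _ _ x 1 _ _ dG dV.
congr is_derive; rewrite /GRing.scale/= /saddle_phi.
by move: (expR _) => E; field; rewrite gt_eqF.
Qed.

Lemma S_sq n : (0 < n)%N -> S_ R n ^+ 2 = 2 * a * (n%:R - 24^-1).
Proof.
move=> n0; have n1 : 1 <= n%:R :> R by rewrite ler1n.
rewrite /S_ !exprMn !sqr_sqrtr; [|lra|lra].
by rewrite /a; move: pi => p; field.
Qed.

Lemma S_ge0 n : 0 <= S_ R n.
Proof. by rewrite /S_ !mulr_ge0// ?pi_ge0// sqrtr_ge0. Qed.

Lemma S_le n m : (n <= m)%N -> S_ R n <= S_ R m.
Proof.
move=> nm; rewrite /S_ ler_wpM2l ?mulr_ge0 ?pi_ge0 ?sqrtr_ge0// ler_wsqrtr// lerD2r ler_nat//.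
Qed.

Lemma S_sq_ge n : (0 < n)%N -> n%:R <= S_ R n ^+ 2.
Proof.
move=> n0; have n1 : 1 <= n%:R :> R by rewrite ler1n.
have /andP[a1 _] := pi2_3_bounds; rewrite S_sq//; nra.
Qed.

Lemma S_gt1 n : (0 < n)%N -> 1 < S_ R n.
Proof.
move=> n0; have n1 : 1 <= n%:R :> R by rewrite ler1n.
have /andP[a1 _] := pi2_3_bounds; have := S_sq n0; have := S_ge0 n => s0 s2.
have : 1 < S_ R n ^+ 2 by rewrite s2; nra.
by rewrite expr_gt1.
Qed.

Lemma S_large (L : R) : exists n0, forall n, (n0 <= n)%N -> L <= S_ R n.
Proof.
exists (Num.trunc (L ^+ 2)).+1 => n nL.
have n0 : (0 < n)%N by exact: leq_ltn_trans nL.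
have := @truncnS_gt R (L ^+ 2) => h; have nR : L ^+ 2 < n%:R.
  by apply: lt_le_trans h _; rewrite ler_nat.
have := S_sq_ge n0; have := S_ge0 n => s0 s2.
have [L0|/ltW L0] := leP L 0; first exact: le_trans s0.
by rewrite -(ler_pXn2r (isT : (0 < 2)%N)) ?nnegrE//; lra.
Qed.

Lemma saddle_y_S n k : (k < n)%N -> saddle_y a (S_ R n) k%:R = S_ R (n - k).
Proof.
move=> kn; have n0 : (0 < n)%N by exact: leq_ltn_trans kn.
have nk : (0 < n - k)%N by rewrite subn_gt0.
rewrite /saddle_y -[RHS](ger0_norm (S_ge0 _)) -sqrtr_sqr; congr Num.sqrt.
by rewrite !S_sq// natrB ?(ltnW kn)//; ring.
Qed.

Lemma saddle_dom_S n x : (0 < n)%N -> 2 <= S_ R n -> 0 <= x <= n.-1%:R ->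
  saddle_dom a (S_ R n) x.
Proof.
case: n => // n _ s2 /andP[x0 xn]; split=> //.
have /andP[a1 _] := pi2_3_bounds; rewrite S_sq// -natr1; rewrite /= in xn; nra.
Qed.

Lemma is_derive_lin (f g : R -> R) (f' g' k x : R) :
  is_derive x 1 f f' -> is_derive x 1 g g' ->
  is_derive x 1 (fun y => k * f y + g y) (k * f' + g').
Proof. by move=> df dg; exact: is_deriveD (is_deriveZ k df) dg. Qed.

Lemma antiderivative_bounds N D (al be : nat -> R) (A eta : R) :
  let s := S_ R N.+1 in
  let T := (expR 4 * s ^+ 3 + D%:R * A * s ^+ 2 * expR 6) * expR (- (s / 4)) in
  12 <= s -> 0 <= A -> 0 <= eta -> (forall i, `|al i| <= A) ->
  (forall i, (i < D)%N -> a / s <= be i <= 2 * a / s) ->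
  (forall x, 0 <= x <= N%:R -> `|saddle_phi (saddle_y a s x) / saddle_phi s -
     \sum_(i < D) al i * expR (- (be i * x))| <= eta) ->
  `|\sum_(i < D) al i * bose_main (be i) - N.+1%:R| <=
    3 * (T + (T + eta * s ^+ 2) * s ^+ 2) + (T + eta * s ^+ 2) + eta.
Proof.
move=> s T s12 A0 eta0 hal hbe heta.
have [/andP[a43 a163] a0] : 4 / 3 <= a <= 16 / 3 /\ 0 < a.
  have h := pi2_3_bounds; split=> //; have /andP[h1 _] := h; lra.
have s0 : 0 < s by lra.
have be0 i : (i < D)%N -> 0 < be i.
  by move=> /hbe/andP[h _]; apply: lt_le_trans h; rewrite divr_gt0.
have N0 : 0 <= N%:R :> R by [].
have sN : N%:R + 1 <= s ^+ 2 by rewrite natr1 S_sq_ge.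
have ph0 : 0 < saddle_phi s by apply: saddle_phi_gt0; lra.
have phn : saddle_phi s != 0 by rewrite gt_eqF.
pose Y := saddle_y a s.
(* [F2] is the error of the exponential approximation; [F1] and [F0] are its successive
   antiderivatives, with e^Y/Y and e^Y serving for the profile. Both are tiny at x = N, where Y =
   S(1) is bounded while phi(s) is huge. *)
pose F2 x := saddle_phi (Y x) / saddle_phi s - \sum_(i < D) al i * expR (- (be i * x)).
pose F1 x := - (expR (Y x) / Y x / (a * saddle_phi s)) +
  \sum_(i < D) al i / be i * expR (- (be i * x)).
pose F0 x := expR (Y x) / (a ^+ 2 * saddle_phi s) -
  \sum_(i < D) al i / be i ^+ 2 * expR (- (be i * x)).
have arg0 x : 0 <= x <= N%:R -> 0 < s ^+ 2 - 2 * a * x.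
  by move=> /andP[x0 xN]; rewrite S_sq// -natr1; nra.
have dF1 x : 0 <= x <= N%:R -> is_derive x 1 F1 (F2 x).
  move=> xN; have d1 := is_derive_saddle_G1 (arg0 x xN).
  have d2 := @is_derive_sum_fun D (fun i y => al i / be i * expR (- (be i * y)))
    (fun i y => - (al i / be i * be i * expR (- (be i * y)))) x
    (fun i => is_derive_scaled_exp _ _ _).
  have := is_derive_lin (- (a * saddle_phi s)^-1) d1 d2; congr is_derive.
    by apply/funext => y; rewrite /F1 -/(Y y); ring.
  rewrite /F2 -/(Y x); congr (_ + _); first by field; rewrite phn gt_eqF.
  rewrite -sumrN; apply: eq_bigr => i _; rewrite divfK// gt_eqF// be0//.
have dF0 x : 0 <= x <= N%:R -> is_derive x 1 F0 (F1 x).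
  move=> xN; have d1 := is_derive_saddle_G (arg0 x xN).
  have d2 := @is_derive_sum_fun D (fun i y => - (al i / be i ^+ 2) * expR (- (be i * y)))
    (fun i y => - (- (al i / be i ^+ 2) * be i * expR (- (be i * y)))) x
    (fun i => is_derive_scaled_exp _ _ _).
  have := is_derive_lin ((a ^+ 2 * saddle_phi s)^-1) d1 d2; congr is_derive.
    apply/funext => y; rewrite /F0 -/(Y y) mulrC -sumrN; congr (_ + _).
    by apply: eq_bigr => i _; rewrite mulNr.
  rewrite /F1 -/(Y x); congr (_ + _).
    by move: (expR (Y x) / Y x) => E; field; rewrite phn gt_eqF.
  apply: eq_bigr => i _.
  rewrite (_ : - (- (al i / be i ^+ 2) * be i * expR (- (be i * x))) =
     al i / be i ^+ 2 * be i * expR (- (be i * x))); last by ring.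
  congr (_ * _).
  by field; rewrite gt_eqF// be0.
have E1 : 0 < expR (- (s / 4)) by exact: expR_gt0.
(* a N/s equals s/2 up to a bounded amount; the rate s/4 and the constant e^6 are generous. *)
have expX i : (i < D)%N -> expR (- (be i * N%:R)) <= expR 6 * expR (- (s / 4)).
  move=> iD; rewrite -expRD ler_expR.
  have /andP[b1 _] := hbe i iD.
  have : a / s * N%:R <= be i * N%:R by rewrite ler_wpM2r.
  have e : s ^+ 2 = 2 * a * (N%:R + 1 - 24^-1) by rewrite S_sq// -[N.+1%:R]natr1.
  have -> : a / s * N%:R = s / 2 - (1 - 24^-1) * (a / s).
    have -> : N%:R = s ^+ 2 / (2 * a) - (1 - 24^-1) by rewrite e; field; rewrite gt_eqF.
    by field; rewrite !gt_eqF.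
  have : a / s <= 1 by rewrite ler_pdivrMr//; lra.
  lra.
have YN : 1 <= Y N%:R <= 4.
  rewrite /Y saddle_y_S// subSnn; have h1 := S_gt1 (isT : (0 < 1)%N).
  have h2 := S_sq (isT : (0 < 1)%N); apply/andP; split; first exact: ltW.
  rewrite -(ler_pXn2r (isT : (0 < 2)%N)) ?nnegrE ?S_ge0// h2; lra.
have phb : expR (Y N%:R) / saddle_phi s <= expR 4 * s ^+ 3 * expR (- (s / 4)).
  have /andP[_ Y4] := YN; rewrite -ler_expR in Y4.
  have -> : expR (Y N%:R) / saddle_phi s = expR (Y N%:R) * (s ^+ 3 / (s - 1) * expR (- s)).
    rewrite /saddle_phi expRN; move: (expR s) (expR_gt0 s) (expR (Y _)) => E E0 E2.
    by field; rewrite !gt_eqF//; move: s12; goal_lra.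
  rewrite -[leRHS]mulrA; apply: ler_pM; rewrite ?expR_ge0//.
    by rewrite mulr_ge0 ?expR_ge0// divr_ge0 ?exprn_ge0//; move: s12; goal_lra.
  have s1 : 1 <= s - 1 by move: s12; goal_lra.
  apply: ler_pM; rewrite ?expR_ge0// ?ler_expR.
  - by rewrite divr_ge0 ?exprn_ge0 ?(ltW s0) ?(le_trans ler01 s1).
  - rewrite ler_pdivrMr ?(lt_le_trans ltr01 s1)//.
    by rewrite ler_peMr ?exprn_ge0 ?(ltW s0).
  by move: s0; goal_lra.
have sumb (c : nat -> R) : (forall i, (i < D)%N -> `|c i| <= A * s ^+ 2) ->
  `|\sum_(i < D) c i * expR (- (be i * N%:R))| <=
    D%:R * A * s ^+ 2 * expR 6 * expR (- (s / 4)).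
  move=> hc; apply: le_trans (ler_norm_sum _ _ _) _.
  apply: le_trans (_ : \sum_(i < D) A * s ^+ 2 * (expR 6 * expR (- (s / 4))) <= _).
    apply: ler_sum => i _; rewrite normrM (ger0_norm (expR_ge0 _)).
    by rewrite ler_pM ?expR_ge0// ?hc ?expX.
  rewrite sumr_const card_ord -[leLHS]mulr_natl le_eqVlt; apply/orP; left; apply/eqP.
  by ring.
have ibe i : (i < D)%N -> 0 <= (be i)^-1 <= s.
  move=> iD; have /andP[b1 _] := hbe i iD.
  rewrite invr_ge0 (ltW (be0 i iD))/= -[leRHS]invrK lef_pV2 ?posrE ?invr_gt0 ?be0//.
  by apply: le_trans b1; rewrite ler_peMl ?invr_ge0 ?(ltW s0)//; move: a43; goal_lra.
have ph4 : 0 <= expR (Y N%:R) / saddle_phi s by rewrite divr_ge0 ?expR_ge0// ltW.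
have Texp : expR 4 * s ^+ 3 * expR (- (s / 4)) +
  D%:R * A * s ^+ 2 * expR 6 * expR (- (s / 4)) = T by rewrite /T; ring.
have F1N : `|F1 N%:R| <= T.
  apply: le_trans (ler_normD _ _) _; rewrite -Texp; apply: lerD.
    have -> : expR (Y N%:R) / Y N%:R / (a * saddle_phi s) =
       expR (Y N%:R) / saddle_phi s * (Y N%:R * a)^-1.
      by move: YN => /andP[y1 _]; field; rewrite phn !gt_eqF//; move: y1; goal_lra.
    have y1 : 1 <= Y N%:R * a by nra.
    rewrite normrN ger0_norm; last by rewrite mulr_ge0// invr_ge0 (le_trans ler01 y1).
    by apply: le_trans phb; rewrite ler_piMr// invf_le1// (lt_le_trans ltr01 y1).
  apply: (sumb (fun i => al i / be i)) => i iD; have /andP[b1 b2] := ibe i iD.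
  rewrite normrM (@ger0_norm _ (be i)^-1)// ler_pM//.
  by apply: le_trans b2 _; nra.
have F0N : `|F0 N%:R| <= T.
  apply: le_trans (ler_normB _ _) _; rewrite -Texp; apply: lerD.
    have -> : expR (Y N%:R) / (a ^+ 2 * saddle_phi s) =
       expR (Y N%:R) / saddle_phi s * (a ^+ 2)^-1.
      by field; rewrite phn !gt_eqF.
    have y1 : 1 <= a ^+ 2 by nra.
    rewrite ger0_norm; last by rewrite mulr_ge0// invr_ge0 (le_trans ler01 y1).
    by apply: le_trans phb; rewrite ler_piMr// invf_le1// (lt_le_trans ltr01 y1).
  apply: (sumb (fun i => al i / be i ^+ 2)) => i iD; have /andP[b1 b2] := ibe i iD.
  rewrite -exprVn normrM (@ger0_norm _ ((be i)^-1 ^+ 2)) ?sqr_ge0// ler_pM ?sqr_ge0//.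
  by rewrite ler_sqr ?nnegrE ?(ltW s0).
have T0 : 0 <= T := le_trans (normr_ge0 _) F1N.
have F1b x : 0 <= x <= N%:R -> `|F1 x| <= T + eta * s ^+ 2.
  move=> xN; apply: le_trans (derive_backward N0 dF1 heta xN) _.
  by rewrite lerD// ler_wpM2l//; move: sN; goal_lra.
have z0 : 0 <= (0 : R) <= N%:R by rewrite lexx.
have F00 : `|F0 0| <= T + (T + eta * s ^+ 2) * s ^+ 2.
  apply: le_trans (derive_backward N0 dF0 F1b z0) _.
  apply: lerD => //; apply: ler_wpM2l; first by rewrite addr_ge0// mulr_ge0// sqr_ge0.
  by move: sN; goal_lra.
have Y0 : Y 0 = s.
  by rewrite /Y /saddle_y mulr0 subr0 sqrtr_sqr ger0_norm// ltW.
(* Up to sign, 1/b^2, 1/b and 1 are the values at 0 of the second antiderivative of e^(-bx), of the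
   first, and of the function. The same combination of boundary values of the profile is s^2/(2a) +
   1/24, which is exactly n; here a/2 = pi^2/6 and the two occurrences of 1/24 must match. *)
have main_eq : \sum_(i < D) al i * bose_main (be i) - N.+1%:R =
   - (a / 2) * F0 0 - F1 0 / 2 - F2 0 / 24.
  rewrite /F0 /F1 /F2 Y0.
  have ex1 i : expR (- (be i * 0)) = 1 by rewrite mulr0 oppr0 expR0.
  under [X in - (a / 2) * (_ - X)]eq_bigr => i _ do rewrite ex1 mulr1.
  under [X in - ((_ + X) / 2)]eq_bigr => i _ do rewrite ex1 mulr1.
  under [X in - ((_ - X) / 24)]eq_bigr => i _ do rewrite ex1 mulr1.
  have -> : \sum_(i < D) al i * bose_main (be i) =
     a / 2 * (\sum_(i < D) al i / be i ^+ 2) - (\sum_(i < D) al i / be i) / 2 +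
     (\sum_(i < D) al i) / 24.
    rewrite mulr_sumr !mulr_suml -sumrB -big_split /=; apply: eq_bigr => i _.
    rewrite /bose_main /a; move: pi => p; field; rewrite gt_eqF// be0//.
  move: (\sum_(i < D) _) (\sum_(i < D) _) (\sum_(i < D) _) => S2 S1 S0.
  have e : N.+1%:R = s ^+ 2 / (2 * a) + 24^-1.
    by rewrite S_sq//; field; rewrite gt_eqF.
  rewrite e divff// /saddle_phi; move: (expR s) (expR_gt0 s) => E E0.
  by field; rewrite !gt_eqF//; move: s12; goal_lra.
rewrite main_eq; apply: le_trans (ler_normB _ _) _; rewrite lerD//; last first.
  rewrite normrM (@ger0_norm _ 24^-1)//; have := heta 0 z0; have := normr_ge0 (F2 0).
  by rewrite -/(F2 0); goal_lra.
apply: le_trans (ler_normB _ _) _; rewrite lerD//; last first.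
  rewrite normrM (@ger0_norm _ 2^-1)//; have := F1b 0 z0; have := normr_ge0 (F1 0); goal_lra.
rewrite normrM normrN (@ger0_norm _ (a / 2)); last by move: a43; goal_lra.
by rewrite ler_pM//; move: a43 a163; goal_lra.
Qed.

Definition sdecay K (f : nat -> R) := exists2 C, 0 <= C &
  exists n0, forall n, (n0 <= n)%N -> `|f n| <= C / S_ R n ^+ K.

Lemma decay_weaken (C s : R) m n : 0 <= C -> 1 <= s -> (m <= n)%N -> C / s ^+ n <= C / s ^+ m.
Proof.
move=> C0 s1 mn; rewrite ler_wpM2l// lef_pV2 ?posrE ?exprn_gt0//; try lra.
by rewrite ler_weXn2l.
Qed.

Lemma decay_mul_le (C s : R) K m i : 0 <= C -> 1 <= s -> (i + K <= m)%N ->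
  C / s ^+ m * s ^+ i <= C / s ^+ K.
Proof.
move=> C0 s1 ikm; have s0 : 0 < s by lra.
have := decay_weaken C0 s1 (_ : K <= m - i)%N; rewrite leq_subRL; last by lia.
move=> /(_ ikm); apply: le_trans.
by rewrite -{1}(@subnK i m) ?exprD ?invfM ?mulrA ?mulfVK ?expf_neq0 ?gt_eqF//; lia.
Qed.

Lemma sum_sigma_le N : \sum_(1 <= k < N.+1) (sigma k)%:R <= N%:R ^+ 3 :> R.
Proof.
apply: le_trans (_ : \sum_(1 <= k < N.+1) N%:R ^+ 2 <= _).
  rewrite !big_nat; apply: ler_sum => k /andP[_ kN]; rewrite -natrX ler_nat.
  by apply: leq_trans (sigma_leq k) _; rewrite mulnn leq_exp2r.
by rewrite sumr_const_nat subn1 /= -[leLHS]mulr_natl -exprS.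
Qed.

(** The profile becomes a sum of exponentials with rates of order 1/s, and each sum of sigma(k)
    against an exponential becomes its main term. The coefficients may be as large as s^D, so the
    expansion of [bose_sum] is used to order K + D. *)
Lemma near_solution K :
  sdecay K (fun n => \sum_(1 <= k < n) (sigma k)%:R *
    (saddle_phi (S_ R (n - k)) / saddle_phi (S_ R n)) - n%:R).
Proof.
(* The eight spare powers pay for the total weight of [sigma], at most N^3 <= s^6, and for two
   integrations over a length N <= s^2. *)
have [H [D [P [C C0 [H2 hP hphi]]]]] := saddle_phi_exp_approx a_ge1 (K + 8).
have [C2 C20 hbose] := bose_sum_asymp R (K + D).
have [C3 C30 hexp] := exp_decay (K + D + 12).
pose B := expR 4 + D%:R * C * expR 6.
have B0 : 0 <= B by rewrite addr_ge0 ?mulr_ge0 ?expR_ge0.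
pose Cm := C + D%:R * (C * 18 * expR 6 * C3) + D%:R * (C * C2 * 11 ^+ (K + D)) +
   (3 * (2 * (B * C3) + C) + (B * C3 + C) + C).
exists Cm.
  by rewrite /Cm !addr_ge0 ?mulr_ge0 ?addr_ge0 ?mulr_ge0 ?expR_ge0 ?exprn_ge0.
have [n0 hn0] := S_large (12 + D%:R); exists (maxn n0 1) => n; rewrite geq_max => /andP[nn0 n1].
case: n nn0 n1 => // N nn0 _; have := hn0 _ nn0.
set s := S_ R N.+1 => sD; have D0 : 0 <= D%:R :> R by [].
have s12 : 12 <= s by lra.
have {}sD : D%:R <= s by lra.
have s0 : 0 < s by lra.
have s1 : 1 <= s by lra.
have s2 : 2 <= s by lra.
have [/andP[a43 a163] a0] : 4 / 3 <= a <= 16 / 3 /\ 0 < a.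
  have h := pi2_3_bounds; split=> //; have /andP[h1 _] := h; lra.
have sp m : 0 < s ^+ m by rewrite exprn_gt0.
have sN : N%:R + 1 <= s ^+ 2 by rewrite natr1 S_sq_ge.
have N0 : 0 <= N%:R :> R by [].
pose al i := (P s)`_i; pose be (i : nat) : R := a / s + i%:R / s ^+ H.
have [szP cP] := hP s s2.
have be0 i : a / s <= be i by rewrite lerDl divr_ge0// ltW.
have be0' i : 0 < be i by apply: lt_le_trans (be0 i); rewrite divr_gt0.
have be2 i : (i < D)%N -> be i <= 2 * a / s.
  move=> iD; rewrite /be.
  have -> : 2 * a / s = a / s + a / s by field; rewrite gt_eqF.
  rewrite lerD2l; apply: le_trans (_ : s / s ^+ 2 <= _).
    apply: ler_pM; rewrite ?invr_ge0 ?(ltW (sp _))//.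
      by apply: le_trans sD; rewrite ler_nat ltnW.
    by rewrite lef_pV2 ?posrE// ler_weXn2l.
  by rewrite expr2 invfM mulrA mulfV ?gt_eqF// ler_wpM2r ?invr_ge0 ?(ltW s0)//; lra.
have hat x : \sum_(i < D) al i * expR (- (be i * x)) =
    expR (- saddle_z a s x) * (P s).[saddle_node H s x].
  rewrite (horner_coef_wide _ szP) mulr_sumr; apply: eq_bigr => i _.
  rewrite mulrCA; congr (_ * _); rewrite /saddle_node -expRM_natl -expRD; congr expR.
  by rewrite /saddle_z /be; field; rewrite !gt_eqF.
have ig x : 0 <= x <= N%:R -> `|saddle_phi (saddle_y a s x) / saddle_phi s -
     \sum_(i < D) al i * expR (- (be i * x))| <= C / s ^+ (K + 8).
  by move=> xN; rewrite hat; apply: hphi; apply: saddle_dom_S.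
have E := hexp s s0; set e1 := expR (- (s / 4)) in E.
have e10 : 0 <= e1 by exact: expR_ge0.
have eT i : (i <= D + 12)%N -> e1 * s ^+ i <= C3 / s ^+ K.
  move=> iD; apply: le_trans (ler_wpM2r (ltW (sp _)) E) _.
  by apply: decay_mul_le => //; move: iD; clear; lia.
have bnd1 : `|\sum_(1 <= k < N.+1) (sigma k)%:R * (saddle_phi (S_ R (N.+1 - k)) / saddle_phi s -
    \sum_(i < D) al i * expR (- (be i * k%:R)))| <= C / s ^+ K.
  apply: le_trans (ler_norm_sum _ _ _) _.
  apply: le_trans (_ : \sum_(1 <= k < N.+1) (sigma k)%:R * (C / s ^+ (K + 8)) <= _).
    rewrite !big_nat; apply: ler_sum => k /andP[k1 kN].
    rewrite normrM ger0_norm// ler_wpM2l// -saddle_y_S//; apply: ig.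
    by rewrite ler0n ler_nat.
  rewrite -mulr_suml; apply: le_trans (_ : s ^+ 6 * (C / s ^+ (K + 8)) <= _).
    rewrite ler_wpM2r ?divr_ge0 ?(ltW (sp _))//; apply: le_trans (sum_sigma_le N) _.
    by rewrite -[6%N]/(2 * 3)%N exprM lerXn2r ?nnegrE ?(ltW (sp _))//; move: sN; goal_lra.
  have -> : s ^+ 6 * (C / s ^+ (K + 8)) = C / s ^+ (K + 2).
    by rewrite !exprD; field; rewrite !gt_eqF.
  by apply: decay_weaken => //; clear; lia.
have bnd2 i : (i < D)%N -> `|al i * (bose_sum (be i) -
    \sum_(1 <= k < N.+1) (sigma k)%:R * expR (- (k%:R * be i)))| <= C * 18 * expR 6 * C3 / s ^+ K.
  move=> iD; rewrite normrM; have h1 : 15 + 3 * N%:R <= 18 * s ^+ 2.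
    have : 12 * 12 <= s ^+ 2 by rewrite expr2 ler_pM.
    by move: sN; goal_lra.
  have h2 : expR (- (N%:R * be i / 2)) <= expR 6 * e1.
    rewrite -expRD ler_expR.
    have : N%:R * (a / s) <= N%:R * be i by rewrite ler_wpM2l.
    have e : s ^+ 2 = 2 * a * (N%:R + 1 - 24^-1) by rewrite S_sq// -[N.+1%:R]natr1.
    have -> : N%:R * (a / s) = s / 2 - (1 - 24^-1) * (a / s).
      have -> : N%:R = s ^+ 2 / (2 * a) - (1 - 24^-1) by rewrite e; field; rewrite gt_eqF.
      by field; rewrite !gt_eqF.
    have : a / s <= 1 by rewrite ler_pdivrMr//; move: a163 s12; goal_lra.
    lra.
  have h3 : (be i ^+ 2)^-1 <= s ^+ 2.
    rewrite -exprVn ler_sqr ?nnegrE ?invr_ge0 ?(ltW (be0' i)) ?(ltW s0)//.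
    rewrite -[leRHS]invrK lef_pV2 ?posrE ?invr_gt0//.
    by apply: le_trans (be0 i); rewrite ler_peMl ?invr_ge0 ?(ltW s0)//; move: a43; goal_lra.
  apply: le_trans (_ : C * s ^+ D * (18 * s ^+ 2 * (expR 6 * e1) * s ^+ 2) <= _).
    apply: ler_pM; [exact: normr_ge0|exact: normr_ge0|exact: cP|].
    apply: le_trans (sigma_exp_sum N (be0' i)) _.
    apply: ler_pM; rewrite ?invr_ge0 ?sqr_ge0 ?mulr_ge0 ?addr_ge0 ?mulr_ge0 ?expR_ge0//.
    by apply: ler_pM => //; rewrite ?addr_ge0 ?mulr_ge0 ?expR_ge0.
  have -> : C * s ^+ D * (18 * s ^+ 2 * (expR 6 * e1) * s ^+ 2) =
    C * 18 * expR 6 * (e1 * s ^+ (D + 4)) by rewrite exprD; ring.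
  rewrite -[leRHS]mulrA ler_wpM2l ?mulr_ge0 ?expR_ge0//; apply: eT; clear; lia.
have bnd3 i : (i < D)%N -> `|al i * (bose_sum (be i) - bose_main (be i))| <=
    C * C2 * 11 ^+ (K + D) / s ^+ K.
  move=> iD; rewrite normrM.
  have b11 : be i <= 11 / s.
    by apply: le_trans (be2 i iD) _; rewrite ler_wpM2r ?invr_ge0 ?(ltW s0)//; move: a163; goal_lra.
  have bi1 : 0 < be i <= 1.
    by rewrite be0'/= (le_trans b11)// ler_pdivrMr//; move: s12; goal_lra.
  apply: le_trans (_ : C * s ^+ D * (C2 * (11 / s) ^+ (K + D)) <= _).
    apply: ler_pM; [exact: normr_ge0|exact: normr_ge0|exact: cP|].
    apply: le_trans (hbose _ bi1) _; rewrite ler_wpM2l// lerXn2r ?nnegrE ?(ltW (be0' i))//.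
    by rewrite divr_ge0// ltW.
  rewrite expr_div_n (exprD s) le_eqVlt; apply/orP; left; apply/eqP.
  by move: (11 ^+ (K + D)) => u; field; rewrite !gt_eqF.
have bnd4 : `|\sum_(i < D) al i * bose_main (be i) - N.+1%:R| <=
   (3 * (2 * (B * C3) + C) + (B * C3 + C) + C) / s ^+ K.
  have A0 : 0 <= C * s ^+ D by rewrite mulr_ge0// ltW.
  have eta0 : 0 <= C / s ^+ (K + 8) by rewrite divr_ge0// ltW.
  have hbe i : (i < D)%N -> a / s <= be i <= 2 * a / s by move=> iD; rewrite be0 be2.
  have := antiderivative_bounds s12 A0 eta0 cP hbe ig; rewrite -/s -/e1.
  set T := (_ + _) * e1; set eta := C / s ^+ (K + 8) in eta0 * => /le_trans; apply.
  have hT i : (i <= 9)%N -> T * s ^+ i <= B * C3 / s ^+ K.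
    move=> i9; apply: le_trans (_ : B * (e1 * s ^+ (D + 3 + i)) <= _); last first.
      by rewrite -[leRHS]mulrA ler_wpM2l//; apply: eT; move: i9; clear; lia.
    have -> : B * (e1 * s ^+ (D + 3 + i)) = B * s ^+ (D + 3) * (e1 * s ^+ i).
      by rewrite (exprD _ (D + 3)); ring.
    rewrite /T -mulrA ler_wpM2r ?mulr_ge0 ?(ltW (sp _))// /B mulrDl lerD//.
      by rewrite ler_wpM2l ?expR_ge0// ler_weXn2l// leq_addl.
    have -> : D%:R * (C * s ^+ D) * s ^+ 2 * expR 6 = D%:R * C * expR 6 * s ^+ (D + 2).
      by rewrite exprD; ring.
    by rewrite ler_wpM2l ?mulr_ge0 ?expR_ge0// ler_weXn2l// leq_add2l.
  have heta i : (i <= 8)%N -> eta * s ^+ i <= C / s ^+ K.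
    by move=> i8; apply: decay_mul_le => //; move: i8; clear; lia.
  have := hT 0%N isT; have := hT 2%N isT; have := heta 0%N isT; have := heta 2%N isT.
  have := heta 4%N isT; rewrite !expr0 !mulr1 -[4%N]/(2 + 2)%N (exprD s 2 2).
  rewrite !mulrDl; move: (s ^+ 2) => s_2; move: (s ^+ K)^-1 => W; goal_lra.
have -> : \sum_(1 <= k < N.+1) (sigma k)%:R * (saddle_phi (S_ R (N.+1 - k)) / saddle_phi s) -
    N.+1%:R = \sum_(1 <= k < N.+1) (sigma k)%:R * (saddle_phi (S_ R (N.+1 - k)) / saddle_phi s -
    \sum_(i < D) al i * expR (- (be i * k%:R))) -
   \sum_(i < D) al i * (bose_sum (be i) -
    \sum_(1 <= k < N.+1) (sigma k)%:R * expR (- (k%:R * be i))) +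
   \sum_(i < D) al i * (bose_sum (be i) - bose_main (be i)) +
   (\sum_(i < D) al i * bose_main (be i) - N.+1%:R).
  under [X in _ = X - _ + _ + _]eq_bigr => k _ do rewrite mulrBr.
  under [X in _ = _ - X + _ + _]eq_bigr => i _ do rewrite mulrBr.
  under [X in _ = _ - _ + X + _]eq_bigr => i _ do rewrite mulrBr.
  rewrite !sumrB; set X1 := \sum_(1 <= k < N.+1) (sigma k)%:R * (_ / _).
  have -> : \sum_(i < D) al i * (\sum_(1 <= k < N.+1) (sigma k)%:R * expR (- (k%:R * be i))) =
    \sum_(1 <= k < N.+1) (sigma k)%:R * (\sum_(i < D) al i * expR (- (be i * k%:R))).
    under eq_bigr => i _ do rewrite mulr_sumr.
    rewrite exchange_big /=; apply: eq_bigr => k _; rewrite mulr_sumr; apply: eq_bigr => i _.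
    by rewrite mulrCA (mulrC k%:R).
  ring.
have sumD (f : nat -> R) b : (forall i, (i < D)%N -> `|f i| <= b / s ^+ K) ->
    `|\sum_(i < D) f i| <= D%:R * b / s ^+ K.
  move=> hf; apply: le_trans (ler_norm_sum _ _ _) _.
  apply: le_trans (_ : \sum_(i < D) b / s ^+ K <= _); first by apply: ler_sum => i _; exact: hf.
  by rewrite sumr_const card_ord -[leLHS]mulr_natl mulrA.
have s3 := sumD (fun i => al i * (bose_sum (be i) - bose_main (be i))) _ bnd3.
have s2' := sumD (fun i => al i * (bose_sum (be i) -
  \sum_(1 <= k < N.+1) (sigma k)%:R * expR (- (k%:R * be i)))) _ bnd2.
rewrite /Cm 3!mulrDl; apply: le_trans (ler_normD _ _) _; apply: lerD => //.
apply: le_trans (ler_normD _ _) _; apply: lerD => //.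
by apply: le_trans (ler_normB _ _) _; apply: lerD.
Qed.

End NearSolution.

(** * Stability of averaging recursions *)

Section Stability.
Variable R : realType.

Lemma expR_sub1_le (x : R) : expR x - 1 <= x * expR x.
Proof.
have h := expR_ge1Dx (- x); have e0 := expR_gt0 x.
have : expR x * (1 - x) <= expR x * expR (- x) by rewrite ler_pM2l.
rewrite expRxMexpNx_1; lra.
Qed.

Lemma expR_linear_bound (t : R) : 0 <= t -> t <= 4 * expR (t / 4).
Proof. by move=> t0; have := expR_ge1Dx (t / 4); lra. Qed.

Lemma expR_quad_bound (t : R) : 0 <= t -> t * (1 + t) <= 64 * expR (t / 4).
Proof.
move=> t0; have h := expR_ge1Dx (t / 8).
have -> : t / 4 = t / 8 + t / 8 by lra.
rewrite expRD; nra.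
Qed.

Lemma expR_small_rate (nu t : R) : 0 <= nu <= 4^-1 -> 0 <= t ->
  expR (nu * t) <= 1 + 4 * nu * expR (t / 2).
Proof.
move=> /andP[nu0 nu1] t0; have h := expR_sub1_le (nu * t).
have e1 : expR (nu * t) <= expR (t / 4) by rewrite ler_expR; nra.
have e2 := expR_linear_bound t0.
have -> : t / 2 = t / 4 + t / 4 by lra.
rewrite expRD; have e0 := expR_gt0 (t / 4); have e3 := expR_gt0 (nu * t).
suff : nu * t * expR (nu * t) <= nu * (4 * expR (t / 4) * expR (t / 4)) by lra.
by rewrite -mulrA ler_wpM2l// ler_pM// ltW.
Qed.

(** [J] is the jump of the larger index and [y] the gap to the smaller one. A jump beyond the gap
    reverses the sign of the linear term; the correction is charged to the exponential moment, with
    a gain e^(-y0/4) because the gap is already at least [y0]. *)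
Lemma overshoot_bound (eps mu y y0 J : R) : 0 <= eps <= 4^-1 -> 0 <= mu <= 1 ->
  y0 <= y -> 0 <= y -> y <= J ->
  expR (eps * (J - y)) * (1 + mu * (J - y)) <=
  1 + mu * (y - J) + (8 * mu * expR (- (y0 / 4)) + 64 * eps) * expR (J / 2).
Proof.
move=> /andP[e0 e1] /andP[m0 m1] y0y yp yJ.
set t := J - y; have t0 : 0 <= t by rewrite subr_ge0.
have h1 : t <= 4 * (expR (- (y0 / 4)) * expR (J / 2)).
  apply: le_trans (expR_linear_bound t0) _; rewrite ler_pM2l// -expRD ler_expR /t; lra.
have h2 : (expR (eps * t) - 1) * (1 + mu * t) <= 64 * eps * expR (J / 2).
  apply: le_trans (_ : eps * t * expR (eps * t) * (1 + t) <= _).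
    apply: ler_pM; rewrite ?expR_sub1_le//; [|nra|nra].
    by rewrite subr_ge0 -[leLHS]expR0 ler_expR mulr_ge0.
  have -> : eps * t * expR (eps * t) * (1 + t) = eps * (t * (1 + t) * expR (eps * t)) by ring.
  rewrite (_ : 64 * eps * _ = eps * (64 * expR (J / 2))); last by ring.
  rewrite ler_wpM2l//.
  apply: le_trans (_ : 64 * expR (t / 4) * expR (t / 4) <= _).
    apply: ler_pM; rewrite ?expR_ge0 ?expR_quad_bound// ?mulr_ge0//; first by lra.
    by rewrite ler_expR; nra.
  rewrite -mulrA -expRD ler_pM2l// ler_expR /t; lra.
have -> : expR (eps * t) * (1 + mu * t) =
  1 + mu * (y - J) + 2 * (mu * t) + (expR (eps * t) - 1) * (1 + mu * t) by rewrite /t; ring.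
rewrite (mulrDl _ _ (expR (J / 2))) -[X in X <= _]addrA; rewrite lerD2l lerD//.
have : mu * t <= mu * (4 * (expR (- (y0 / 4)) * expR (J / 2))) by rewrite ler_wpM2l.
lra.
Qed.

(** Order of choice: [mu] small against the overlap [c], then [eps] small against the drift
    [mu * m1]. The constants 320 and 256 only have to be large enough. *)
Lemma step_constants (C1 m1 c E0 : R) : 0 <= C1 -> 0 < m1 -> 0 < c -> c <= 2^-1 -> 1 <= E0 ->
  exists mu eps, [/\ 0 < mu <= 8^-1, 0 < eps <= mu, 8 * mu * C1 * E0 <= c / 40 &
    64 * eps * C1 <= mu * m1 / 4].
Proof.
move=> C10 m10 c0 c1 E01.
have CE1 : 1 <= (1 + C1) * E0 by rewrite mulr_ege1//; lra.
pose mu := c / (320 * ((1 + C1) * E0)).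
have d0 : 0 < 320 * ((1 + C1) * E0) by rewrite mulr_gt0 ?ltr0n ?(lt_le_trans ltr01 CE1).
have emu : mu * (320 * ((1 + C1) * E0)) = c by rewrite /mu divfK ?(gt_eqF d0).
have mu0 : 0 < mu by rewrite divr_gt0.
move: mu emu mu0 => mu emu mu0.
have mu1 : mu <= 8^-1.
  have : mu * 1 <= mu * ((1 + C1) * E0) by rewrite ler_pM2l.
  lra.
have hmu : 8 * mu * C1 * E0 <= c / 40.
  have : 0 <= mu * E0 by rewrite mulr_ge0 ?(ltW mu0)//; lra.
  have -> : c = 320 * (mu * E0) + 320 * (mu * C1 * E0) by rewrite -emu; ring.
  lra.
have CM1 : 1 + m1 <= (1 + C1) * (1 + m1) by rewrite ler_peMl//; lra.
pose eps := mu * m1 / (256 * ((1 + C1) * (1 + m1))).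
have dm0 : 0 < 256 * ((1 + C1) * (1 + m1)).
  by rewrite mulr_gt0 ?ltr0n ?(lt_le_trans _ CM1)// ltr_wpDr// ltW.
have eeps : eps * (256 * ((1 + C1) * (1 + m1))) = mu * m1 by rewrite /eps divfK ?(gt_eqF dm0).
have eps0 : 0 < eps by exact: divr_gt0 (mulr_gt0 mu0 m10) dm0.
move: eps eeps eps0 => eps eeps eps0.
exists mu, eps; split=> //; first by rewrite mu0.
  rewrite eps0/= -(ler_pM2r (_ : 0 < 1 + m1)); last by lra.
  have : eps * (1 + m1) <= eps * ((1 + C1) * (1 + m1)) by rewrite ler_pM2l.
  have : 0 <= eps * (1 + m1) by rewrite mulr_ge0 ?(ltW eps0)//; lra.
  lra.
rewrite -eeps; have : 0 <= eps * (1 + m1 + C1 * m1).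
  by rewrite mulr_ge0 ?addr_ge0 ?mulr_ge0 ?(ltW eps0)//; lra.
lra.
Qed.

(** [Ma] and [Mb] are the masses left after removing the common part. The factor [Mb] stays on the
    right because the difference to be bounded is also multiplied by it. *)
Lemma overlap_gain (c kap Ma Mb : R) : 0 < c -> c <= 2^-1 -> 0 <= kap -> kap <= c / 40 ->
  0 <= Ma -> Ma <= 1 + c / 40 - c -> 4^-1 <= Mb ->
  (Ma + kap) * (Mb + kap) <= Mb * (1 - c / 2).
Proof.
move=> c0 c1 k0 k1 M0 M1 Mb1.
apply: le_trans (_ : (1 - c + c / 20) * (Mb + c / 40) <= _); last by nra.
by apply: ler_pM; lra.
Qed.

Variables (W : nat -> nat -> R) (S r : nat -> R) (C1 m1 B : R) (n0 : nat).
Hypothesis W_ge0 : forall n l, 0 <= W n l.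
Hypothesis S_mono : forall n m, (n <= m)%N -> S n <= S m.
Hypothesis S_ge0 : forall n, 0 <= S n.
Hypothesis S_unbounded : forall L : R, exists n1, forall n, (n1 <= n)%N -> L <= S n.
Hypothesis C1_ge0 : 0 <= C1.
Hypothesis m1_gt0 : 0 < m1.
Hypothesis B_ge0 : 0 <= B.
Hypothesis W_mass : forall K, exists2 C, 0 <= C & forall n, (n0 <= n)%N ->
  `|\sum_(0 <= l < n) W n l - 1| <= C / (1 + S n) ^+ K.
Hypothesis W_exp_moment : forall n, (n0 <= n)%N ->
  \sum_(0 <= l < n) W n l * expR ((S n - S l) / 2) <= C1.
Hypothesis W_mean : forall n, (n0 <= n)%N -> m1 <= \sum_(0 <= l < n) W n l * (S n - S l).
(** A Doeblin condition: two kernels at bounded distance dominate a common measure. Its mass is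
    exactly [c], so the leftover masses are known. *)
Hypothesis W_overlap : forall y0 : R, exists c n1, 0 < c <= 2^-1 /\
  forall i j, (n1 <= j <= i)%N -> S i - S j <= y0 -> exists q : nat -> R,
    [/\ forall l, 0 <= q l, forall l, (l < j)%N -> q l <= W i l /\ q l <= W j l,
        forall l, (j <= l)%N -> q l = 0 & \sum_(0 <= l < j) q l = c].
Hypothesis r_bound : forall n, `|r n| <= B.
Hypothesis r_rec : forall n, (n0 <= n)%N -> r n = \sum_(0 <= l < n) W n l * r l.

Let mass_err n := `|\sum_(0 <= l < n) W n l - 1|.

(* [jump_weight T K j] is the target rate [(T + S j)^-K]; for large [T] it varies so slowly
   that a jump of length [d] costs at most [expR (eps * d)]. *)
Definition jump_weight (T : R) K j : R := ((T + S j) ^+ K)^-1.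

Lemma jump_weight_gt0 T K j : 0 < T -> 0 < jump_weight T K j.
Proof. by move=> T0; rewrite invr_gt0 exprn_gt0// ltr_wpDr ?S_ge0. Qed.

Lemma jump_weight_le T K l j : 0 < T -> (l <= j)%N -> jump_weight T K j <= jump_weight T K l.
Proof.
move=> T0 lj; have h m : 0 < T + S m by rewrite ltr_wpDr ?S_ge0.
rewrite lef_pV2 ?posrE ?exprn_gt0// lerXn2r ?nnegrE ?(ltW (h _))// lerD2l.
exact: S_mono.
Qed.

Lemma jump_weight_ratio T K eps l j : 0 < T -> K%:R / T <= eps -> (l <= j)%N ->
  jump_weight T K l <= jump_weight T K j * expR (eps * (S j - S l)).
Proof.
move=> T0 KT lj; have h m : 0 < T + S m by rewrite ltr_wpDr ?S_ge0.
have d0 : 0 <= S j - S l by rewrite subr_ge0 S_mono.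
rewrite /jump_weight mulrC ler_pdivlMr ?exprn_gt0// mulrC -exprVn -exprMn.
apply: le_trans (_ : expR ((S j - S l) / T) ^+ K <= _).
  rewrite lerXn2r ?nnegrE ?expR_ge0 ?divr_ge0 ?(ltW (h _))//.
  apply: le_trans (_ : 1 + (S j - S l) / T <= _); last exact: expR_ge1Dx.
  have -> : (T + S j) / (T + S l) = 1 + (S j - S l) / (T + S l) by field; rewrite gt_eqF.
  rewrite lerD2l ler_wpM2l// lef_pV2 ?posrE//.
  by rewrite lerDl S_ge0.
rewrite -expRM_natl ler_expR mulrCA mulrC ler_wpM2r//.
Qed.

Local Ltac goal_lra :=
  clear - W_ge0 S_mono S_ge0 S_unbounded C1_ge0 m1_gt0 B_ge0 W_mass W_exp_moment W_mean
    W_overlap r_bound r_rec; lra.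

(* Far apart: only the larger index makes a step of the kernel, whose mean length [m1]
   beats the cost of overshooting the smaller index. *)
Lemma far_step (A mu eps y0 T : R) K i j :
  0 <= A -> 0 <= mu <= 1 -> 0 <= eps <= 4^-1 -> 0 < T -> K%:R / T <= eps ->
  (j < i)%N -> (n0 <= i)%N -> 0 <= y0 <= S i - S j ->
  (forall l l', (l' <= l < i)%N -> `|r l - r l'| <= A * jump_weight T K l' * (1 + mu * (S l - S l'))) ->
  (8 * mu * expR (- (y0 / 4)) + 64 * eps) * C1 <= mu * m1 / 2 ->
  mass_err i * (1 + S i) <= mu * m1 / 4 ->
  mass_err i * B <= A * jump_weight T K j * (mu * m1 / 4) ->
  `|r i - r j| <= A * jump_weight T K j * (1 + mu * (S i - S j)).
Proof.
move=> A0 /andP[mu0 mu1] /andP[eps0 eps1] T0 KT ji n0i /andP[y00 y0y] IH hC he heB.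
set y := S i - S j in y0y *; set kap := 8 * mu * _ + _ in hC.
have e : r i - r j = \sum_(0 <= l < i) W i l * (r l - r j) +
    (\sum_(0 <= l < i) W i l - 1) * r j.
  rewrite r_rec//; under [in RHS]eq_bigr => l _ do rewrite mulrBr.
  by rewrite sumrB -mulr_suml; ring.
set X := A * jump_weight T K j in heB *.
have Dj := jump_weight_gt0 K j T0.
have X0 : 0 <= X by rewrite mulr_ge0// ltW.
have kap0 : 0 <= kap by rewrite addr_ge0 ?mulr_ge0 ?expR_ge0.
(* Landing at or above [j] uses the induction hypothesis directly; landing below [j] exchanges the
   two indices and pays for the overshoot. *)
have pt l : (l < i)%N ->
   `|r l - r j| <= X * (1 + mu * (y - (S i - S l)) + kap * expR ((S i - S l) / 2)).
  move=> li; have [jl|lj] := leqP j l.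
    apply: le_trans (IH l j _) _; first by rewrite jl.
    rewrite ler_wpM2l//; have : 0 <= kap * expR ((S i - S l) / 2) by rewrite mulr_ge0 ?expR_ge0.
    rewrite /y; lra.
  rewrite distrC; apply: le_trans (IH j l _) _; first by rewrite (ltnW lj).
  have SJ : 0 <= S j - S l by rewrite subr_ge0 S_mono// ltnW.
  have muS : 0 <= 1 + mu * (S j - S l) by rewrite addr_ge0 ?mulr_ge0.
  apply: le_trans (_ : X * (expR (eps * (S j - S l)) * (1 + mu * (S j - S l))) <= _).
    rewrite mulrA ler_wpM2r// /X -mulrA ler_wpM2l//.
    exact: jump_weight_ratio T0 KT (ltnW lj).
  rewrite ler_wpM2l//; have yp : 0 <= y by rewrite (le_trans y00).
  have yJ : y <= S i - S l by rewrite /y; lra.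
  have := @overshoot_bound eps mu y y0 (S i - S l); rewrite eps0 eps1 mu0 mu1.
  move=> /(_ isT isT y0y yp yJ).
  have -> : S i - S l - y = S j - S l by rewrite /y; ring.
  by [].
have bound : `|r i - r j| <= X * ((1 + mu * y) * \sum_(0 <= l < i) W i l -
     mu * \sum_(0 <= l < i) W i l * (S i - S l) +
     kap * \sum_(0 <= l < i) W i l * expR ((S i - S l) / 2)) + mass_err i * B.
  rewrite e; apply: le_trans (ler_normD _ _) _; apply: lerD; last first.
    by rewrite normrM ler_wpM2l.
  apply: le_trans (ler_norm_sum _ _ _) _.
  rewrite !mulr_sumr -sumrB -big_split /= mulr_sumr !big_nat; apply: ler_sum => l /andP[_ li].
  rewrite normrM ger0_norm//; apply: le_trans (ler_wpM2l (W_ge0 i l) (pt l li)) _.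
  by rewrite le_eqVlt; apply/orP; left; apply/eqP; ring.
apply: le_trans bound _.
have hm := W_mean n0i; have hx := W_exp_moment n0i.
have w1 : \sum_(0 <= l < i) W i l <= 1 + mass_err i.
  by have := ler_norm (\sum_(0 <= l < i) W i l - 1); rewrite /mass_err; lra.
set w := \sum_(0 <= l < i) W i l in w1 *; set M := \sum_(0 <= l < i) _ * (_ - _) in hm *.
set Z := \sum_(0 <= l < i) _ in hx *.
have err0 : 0 <= mass_err i by exact: normr_ge0.
have yS : y <= S i by rewrite /y; have := S_ge0 j; lra.
have yp : 0 <= y by rewrite (le_trans y00).
have b1 : (1 + mu * y) * w <= 1 + mu * y + mu * m1 / 4.
  have : (1 + mu * y) * w <= (1 + mu * y) * (1 + mass_err i).
    by rewrite ler_wpM2l// addr_ge0 ?mulr_ge0.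
  have : mass_err i * (1 + mu * y) <= mass_err i * (1 + S i).
    rewrite ler_wpM2l// lerD2l; nra.
  lra.
have b2 : mu * m1 <= mu * M by rewrite ler_wpM2l.
have b3 : kap * Z <= mu * m1 / 2 by apply: le_trans hC; rewrite ler_wpM2l.
have : X * ((1 + mu * y) * w - mu * M + kap * Z) <= X * (1 + mu * y - mu * m1 / 4).
  rewrite ler_wpM2l//; lra.
lra.
Qed.

(* Close together: both indices make a step, and the common part [q] of their two kernels
   makes them meet with probability [c]. *)
Lemma near_step (A mu eps y0 T c : R) K i j (q : nat -> R) :
  0 <= A -> 0 <= mu -> 0 <= eps -> mu + eps <= 4^-1 -> 0 < T -> K%:R / T <= eps ->
  (j < i)%N -> (n0 <= j)%N -> S i - S j <= y0 -> 0 < c <= 2^-1 ->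
  (forall l, 0 <= q l) -> (forall l, (l < j)%N -> q l <= W i l /\ q l <= W j l) ->
  (forall l, (j <= l)%N -> q l = 0) -> \sum_(0 <= l < j) q l = c ->
  (forall l l', (l' <= l < i)%N -> `|r l - r l'| <= A * jump_weight T K l' * (1 + mu * (S l - S l'))) ->
  4 * (mu + eps) * C1 * expR (y0 / 2) <= c / 40 ->
  mass_err i <= c / 40 -> mass_err j <= c / 40 ->
  (mass_err i + mass_err j) * B <= A * jump_weight T K j * (c / 2) ->
  `|r i - r j| <= A * jump_weight T K j.
Proof.
move=> A0 mu0 eps0 nu4 T0 KT ji n0j yy0 /andP[c0 c1] q0 qW q_out qc IH hkap ei ej heB.
have n0i : (n0 <= i)%N by rewrite (leq_trans n0j)// ltnW.
set nu := mu + eps in nu4 hkap; have nu0 : 0 <= nu by rewrite addr_ge0.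
set kap := 4 * nu * C1 * _ in hkap.
have Dj := jump_weight_gt0 K j T0; set X := A * jump_weight T K j in heB *.
have X0 : 0 <= X by rewrite mulr_ge0// ltW.
pose a l := W i l - q l; pose b l := W j l - q l.
have a0 l : 0 <= a l.
  by rewrite subr_ge0; have [lj|jl] := ltnP l j; [have [] := qW l lj|rewrite q_out].
have b0 l : (l < j)%N -> 0 <= b l by move=> lj; rewrite subr_ge0; have [] := qW l lj.
have qi (f : nat -> R) : \sum_(0 <= l < i) q l * f l = \sum_(0 <= l < j) q l * f l.
  rewrite (big_cat_nat (n := j)) ?(ltnW ji)//= [X in _ + X]big1_seq ?addr0//.
  by move=> l /andP[_]; rewrite mem_index_iota => /andP[jl _]; rewrite q_out// mul0r.
have qi1 : \sum_(0 <= l < i) q l = c.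
  rewrite -qc (eq_bigr (fun l => q l * 1)) => [|l _]; last by rewrite mulr1.
  by rewrite (qi (fun=> 1)); apply: eq_bigr => l _; rewrite mulr1.
set wi := \sum_(0 <= l < i) W i l; set wj := \sum_(0 <= l < j) W j l.
pose Ma := wi - c; pose Mb := wj - c.
have eMa : \sum_(0 <= l < i) a l = Ma by rewrite sumrB qi1.
have eMb : \sum_(0 <= l < j) b l = Mb by rewrite sumrB qc.
have wi_b : `|wi - 1| <= c / 40 := ei.
have wj_b : `|wj - 1| <= c / 40 := ej.
have [wi1 wi2] : wi <= 1 + c / 40 /\ 1 - c / 40 <= wi.
  by move: wi_b; rewrite ler_norml => /andP[]; lra.
have [wj1 wj2] : wj <= 1 + c / 40 /\ 1 - c / 40 <= wj.
  by move: wj_b; rewrite ler_norml => /andP[]; lra.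
have Mb4 : 4^-1 <= Mb by rewrite /Mb; lra.
have Ma0 : 0 <= Ma by rewrite -eMa sumr_ge0.
pose ra := \sum_(0 <= l < i) a l * r l; pose rb := \sum_(0 <= l < j) b l * r l.
have eri : r i - r j = ra - rb.
  rewrite (r_rec n0i) (r_rec n0j) /ra /rb.
  under [in RHS]eq_bigr => l _ do rewrite mulrBl.
  under [X in _ = _ - X]eq_bigr => l _ do rewrite mulrBl.
  by rewrite !sumrB qi; ring.
(* Independent coupling of the leftovers [a] and [b]: multiplication by the mass of [b] turns the
   difference of averages into a double sum of differences of [r], up to the mismatch of the
   masses. *)
have edbl : Mb * (ra - rb) = \sum_(0 <= l < i) \sum_(0 <= l' < j) a l * b l' * (r l - r l') +
    (Ma - Mb) * rb.
  have -> : \sum_(0 <= l < i) \sum_(0 <= l' < j) a l * b l' * (r l - r l') = Mb * ra - Ma * rb.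
    rewrite -eMa -eMb /ra /rb mulr_sumr mulr_suml -sumrB; apply: eq_bigr => l _.
    rewrite mulr_suml mulr_sumr -sumrB; apply: eq_bigr => l' _; ring.
  ring.
have pt l l' : (l < i)%N -> (l' < j)%N ->
   `|r l - r l'| <= X * (expR (nu * (S i - S l)) * expR (nu * (S i - S l'))).
  move=> li l'j; have l'i := ltn_trans l'j ji.
  have Sl : 0 <= S i - S l by rewrite subr_ge0 S_mono// ltnW.
  have Sl' : 0 <= S i - S l' by rewrite subr_ge0 S_mono// ltnW.
  have Sij : 0 <= S i - S j by rewrite subr_ge0 S_mono// ltnW.
  have gen k k' : (k' <= k < i)%N -> 0 <= S i - S k -> 0 <= S i - S k' ->
      `|r k - r k'| <= X * (expR (nu * (S i - S k)) * expR (nu * (S i - S k'))).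
    move=> kk ik ik'; apply: le_trans (IH k k' kk) _.
    have /andP[kk' _] := kk.
    have Skk : 0 <= S k - S k' by rewrite subr_ge0 S_mono.
    have m0 : 0 <= 1 + mu * (S k - S k') by rewrite addr_ge0 ?mulr_ge0.
    apply: le_trans (_ : X * expR (eps * (S i - S k')) * (1 + mu * (S k - S k')) <= _).
      rewrite ler_wpM2r// /X -mulrA ler_wpM2l//.
      have [k'j|jk'] := leqP k' j.
        apply: le_trans (jump_weight_ratio T0 KT k'j) _.
        by rewrite ler_wpM2l ?(ltW Dj)// ler_expR ler_wpM2l// lerD2r S_mono// ltnW.
      apply: le_trans (jump_weight_le K T0 (ltnW jk')) _.
      by rewrite ler_peMr ?(ltW Dj)// -[leLHS]expR0 ler_expR mulr_ge0.
    rewrite -mulrA ler_wpM2l// -expRD.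
    apply: le_trans (_ : expR (eps * (S i - S k')) * expR (mu * (S k - S k')) <= _).
      by rewrite ler_wpM2l ?expR_ge0// expR_ge1Dx.
    rewrite -expRD ler_expR /nu.
    have : mu * (S k - S k') <= mu * (S i - S k').
      by rewrite ler_wpM2l//; move: ik; goal_lra.
    have : 0 <= (mu + eps) * (S i - S k) by rewrite mulr_ge0.
    by goal_lra.
  have [ll|ll] := leqP l' l; first by apply: gen => //; rewrite ll.
  by rewrite distrC mulrC [X in X * _]mulrC mulrC; apply: gen => //; rewrite (ltnW ll).
have kap0 : 0 <= kap by rewrite !mulr_ge0 ?expR_ge0.
have E01 : 1 <= expR (y0 / 2).
  have : 0 <= S i - S j by rewrite subr_ge0 S_mono// ltnW.
  by move=> h; rewrite -[leLHS]expR0 ler_expR; move: yy0 h; goal_lra.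
pose Xa := \sum_(0 <= l < i) a l * expR (nu * (S i - S l)).
pose Xb := \sum_(0 <= l < j) b l * expR (nu * (S i - S l)).
have nu04 : 0 <= nu <= 4^-1 by rewrite nu0.
have Xab : Xa <= Ma + kap.
  apply: le_trans (_ : \sum_(0 <= l < i) (a l + 4 * nu * (W i l * expR ((S i - S l) / 2))) <= _).
    rewrite /Xa !big_nat; apply: ler_sum => l /andP[_ li].
    have Sl : 0 <= S i - S l by rewrite subr_ge0 S_mono// ltnW.
    apply: le_trans (ler_wpM2l (a0 l) (expR_small_rate nu04 Sl)) _.
    rewrite mulrDr mulr1 lerD2l mulrCA ler_wpM2l ?mulr_ge0// ler_wpM2r ?expR_ge0//.
    by rewrite /a lerBlDr lerDl.
  rewrite big_split /= eMa lerD2l -mulr_sumr; apply: le_trans (_ : 4 * nu * C1 <= _).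
    by rewrite ler_wpM2l ?mulr_ge0// W_exp_moment.
  by rewrite /kap ler_peMr ?mulr_ge0.
have Xbb : Xb <= Mb + kap.
  apply: le_trans (_ : \sum_(0 <= l < j) (b l + 4 * nu * expR (y0 / 2) *
      (W j l * expR ((S j - S l) / 2))) <= _).
    rewrite /Xb !big_nat; apply: ler_sum => l /andP[_ lj].
    have Sl : 0 <= S i - S l by rewrite subr_ge0 S_mono// (leq_trans (ltnW lj))// ltnW.
    apply: le_trans (ler_wpM2l (b0 l lj) (expR_small_rate nu04 Sl)) _.
    rewrite mulrDr mulr1 lerD2l.
    apply: le_trans (_ : W j l * (4 * nu * (expR (y0 / 2) * expR ((S j - S l) / 2))) <= _).
      apply: ler_pM; rewrite ?b0 ?mulr_ge0 ?expR_ge0//; first by rewrite /b lerBlDr lerDl.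
      by rewrite ler_wpM2l ?mulr_ge0// -expRD ler_expR; move: yy0; goal_lra.
    by rewrite le_eqVlt; apply/orP; left; apply/eqP; ring.
  have -> : kap = 4 * nu * expR (y0 / 2) * C1 by rewrite /kap; ring.
  rewrite big_split /= eMb lerD2l -mulr_sumr ler_wpM2l ?mulr_ge0 ?expR_ge0//.
  exact: W_exp_moment.
have Xa0 : 0 <= Xa by rewrite sumr_ge0// => l _; rewrite mulr_ge0 ?expR_ge0.
have rbB : `|rb| <= Mb * B.
  apply: le_trans (ler_norm_sum _ _ _) _; rewrite -eMb mulr_suml !big_nat.
  by apply: ler_sum => l /andP[_ lj]; rewrite normrM (ger0_norm (b0 l lj)) ler_wpM2l ?b0.
have dblB : `|\sum_(0 <= l < i) \sum_(0 <= l' < j) a l * b l' * (r l - r l')| <= X * (Xa * Xb).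
  apply: le_trans (ler_norm_sum _ _ _) _.
  rewrite /Xa mulr_suml mulr_sumr !big_nat; apply: ler_sum => l /andP[_ li].
  apply: le_trans (ler_norm_sum _ _ _) _.
  rewrite /Xb !mulr_sumr !big_nat; apply: ler_sum => l' /andP[_ l'j].
  rewrite !normrM (ger0_norm (a0 l)) (ger0_norm (b0 l' l'j)).
  apply: le_trans (ler_wpM2l (mulr_ge0 (a0 l) (b0 l' l'j)) (pt l l' li l'j)) _.
  by rewrite le_eqVlt; apply/orP; left; apply/eqP; ring.
have MM : `|Ma - Mb| <= mass_err i + mass_err j.
  have -> : Ma - Mb = (wi - 1) - (wj - 1) by rewrite /Ma /Mb; ring.
  exact: ler_normB.
have Xab2 : Xa * Xb <= Mb * (1 - c / 2).
  apply: le_trans (_ : (Ma + kap) * (Mb + kap) <= _).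
    apply: ler_pM => //; rewrite /Xb big_nat; apply: sumr_ge0 => l /andP[_ lj].
    by rewrite mulr_ge0 ?b0 ?expR_ge0.
  by apply: overlap_gain => //; rewrite /Ma; move: wi1; goal_lra.
have Mbp : 0 < Mb by apply: lt_le_trans Mb4; rewrite invr_gt0.
rewrite -(ler_pM2l Mbp) -[X in X * `|_|](ger0_norm (ltW Mbp)) -normrM eri edbl.
apply: le_trans (ler_normD _ _) _.
have h1 : X * (Xa * Xb) <= X * (Mb * (1 - c / 2)) by rewrite ler_wpM2l.
have h2 : `|(Ma - Mb) * rb| <= (mass_err i + mass_err j) * (Mb * B).
  by rewrite normrM ler_pM.
have h3 : Mb * ((mass_err i + mass_err j) * B) <= Mb * (X * (c / 2)) by rewrite ler_pM2l.
by move: h1 h2 h3 dblB; goal_lra.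
Qed.

(** The factor 1 + mu (S i - S j) in the claim makes a step from afar profitable: the mean jump
    lowers it by about mu m1, which pays for overshoot and mass defect. The near step gives a bound
    without that factor. *)
Theorem kernel_stability K : exists2 C, 0 <= C & forall i j, (j <= i)%N ->
  `|r i - r j| <= C / (1 + S j) ^+ K * (1 + (S i - S j)).
Proof.
have [Ce Ce0 hCe] := W_mass K; have [Ce2 Ce20 hCe2] := W_mass 2.
have m1p := m1_gt0; have C1p := C1_ge0; have Bp := B_ge0.
(* Large enough for e^(y0/4) >= 1 + y0/4 to beat the exponential moment by the mean jump. *)
pose y0 := 128 * C1 / m1; have y00 : 0 <= y0 by rewrite divr_ge0 ?mulr_ge0// ltW.
have hy0 : 8 * expR (- (y0 / 4)) * C1 <= m1 / 4.
  have h := expR_ge1Dx (y0 / 4); have e := expRxMexpNx_1 (y0 / 4).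
  have e0 := expR_ge0 (- (y0 / 4)).
  have e1 : m1 * (1 + y0 / 4) = m1 + 32 * C1 by rewrite /y0; field; rewrite gt_eqF.
  have h2 : m1 * (1 + y0 / 4) <= m1 * expR (y0 / 4) by rewrite ler_pM2l.
  rewrite e1 in h2.
  have : (m1 + 32 * C1) * expR (- (y0 / 4)) <= m1 * expR (y0 / 4) * expR (- (y0 / 4)).
    by rewrite ler_wpM2r.
  have : 0 <= m1 * expR (- (y0 / 4)) by rewrite mulr_ge0// ltW.
  rewrite -(mulrA m1) e; lra.
have [c [n1 [/andP[c0 c1] hov]]] := W_overlap y0.
have E01 : 1 <= expR (y0 / 2) by rewrite -[leLHS]expR0 ler_expR; lra.
have [mu [eps [/andP[mu0 mu1] /andP[eps0 epsmu] hmu heps]]] := step_constants C1p m1p c0 c1 E01.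
pose T := 1 + K%:R / eps; have Ke : 0 <= K%:R / eps by rewrite divr_ge0// ltW.
have T1 : 1 <= T by rewrite lerDl.
have T0 : 0 < T by lra.
have KT : K%:R / T <= eps.
  rewrite ler_pdivrMr// /T mulrDr mulr1 [eps * _]mulrCA mulfV ?gt_eqF// mulr1 lerDr ltW//.
have [n3 hn3] := S_unbounded (4 * Ce2 / (mu * m1) + 40 * Ce2 / c).
pose n2 := maxn n0 (maxn n1 n3).
have mm0 : 0 < mu * m1 by rewrite mulr_gt0.
have L1 : 0 <= 4 * Ce2 / (mu * m1) by rewrite divr_ge0 ?mulr_ge0// ltW.
have L2 : 0 <= 40 * Ce2 / c by rewrite divr_ge0 ?mulr_ge0// ltW.
have S1 n : 0 < 1 + S n by have := S_ge0 n; lra.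
have big n : (n2 <= n)%N -> [/\ (n0 <= n)%N, (n1 <= n)%N,
    mass_err n * (1 + S n) <= mu * m1 / 4 & mass_err n <= c / 40].
  rewrite !geq_max => /and3P[nn0 nn1 nn3]; have hS := hn3 n nn3.
  have h := hCe2 n nn0; rewrite -/(mass_err n) in h.
  have {}h : mass_err n * (1 + S n) <= Ce2 / (1 + S n).
    apply: le_trans (ler_wpM2r (ltW (S1 n)) h) _.
    by rewrite expr2 invfM mulrA mulfVK ?gt_eqF.
  have h1 : Ce2 / (1 + S n) <= mu * m1 / 4.
    rewrite ler_pdivrMr//; have : 4 * Ce2 / (mu * m1) <= 1 + S n by lra.
    rewrite ler_pdivrMr//; lra.
  have h2 : Ce2 / (1 + S n) <= c / 40.
    rewrite ler_pdivrMr//; have : 40 * Ce2 / c <= 1 + S n by lra.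
    rewrite ler_pdivrMr//; lra.
  have h3 : mass_err n <= mass_err n * (1 + S n).
    by rewrite ler_peMr ?normr_ge0// lerDl S_ge0.
  by split=> //; move: h h1 h2 h3; goal_lra.
pose D := jump_weight T K; have D0 j : 0 < D j by exact: jump_weight_gt0.
pose Cd := Ce * T ^+ K.
have Cd0 : 0 <= Cd by rewrite mulr_ge0 ?exprn_ge0 ?(ltW T0).
have errD n : (n0 <= n)%N -> mass_err n <= Cd * D n.
  move=> nn0; apply: le_trans (hCe n nn0) _; rewrite /Cd /D /jump_weight -mulrA ler_wpM2l//.
  have TS : 0 < T + S n by rewrite ltr_wpDr ?S_ge0.
  rewrite -exprVn -[(_ ^+ K)^-1]exprVn -exprMn lerXn2r ?nnegrE ?invr_ge0 ?mulr_ge0 ?(ltW (S1 n))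
    ?(ltW T0) ?invr_ge0 ?(ltW TS)//.
  rewrite ler_pdivlMr// mulrC ler_pdivrMr//.
  have := S_ge0 n; nra.
(* The three terms serve in turn the indices below [n2], the mass defect of the far step, and that
   of the near step. *)
pose A := 2 * B / D n2 + 4 * Cd * B / (mu * m1) + 16 * Cd * B / c.
have A1 : 0 <= 2 * B / D n2 by rewrite divr_ge0 ?mulr_ge0// ltW.
have A2 : 0 <= 4 * Cd * B / (mu * m1) by rewrite divr_ge0 ?(ltW mm0)// mulr_ge0// mulr_ge0.
have A3 : 0 <= 16 * Cd * B / c by rewrite divr_ge0 ?(ltW c0)// mulr_ge0// mulr_ge0.
have A0 : 0 <= A by rewrite !addr_ge0.
have hA1 : 2 * B / D n2 <= A by rewrite /A; move: A1 A2 A3; goal_lra.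
have hA2 : 4 * (Cd * B) <= A * (mu * m1).
  have : 4 * Cd * B / (mu * m1) <= A by rewrite /A; move: A1 A2 A3; goal_lra.
  by rewrite ler_pdivrMr//; goal_lra.
have hA3 : 16 * (Cd * B) <= A * c.
  have : 16 * Cd * B / c <= A by rewrite /A; move: A1 A2 A3; goal_lra.
  by rewrite ler_pdivrMr//; goal_lra.
move: A A1 A2 A3 A0 hA1 hA2 hA3 => A _ _ _ A0 hA1 hA2 hA3.
suff claim i j : (j <= i)%N -> `|r i - r j| <= A * D j * (1 + mu * (S i - S j)).
  exists A => // i j ji; apply: le_trans (claim i j ji) _.
  have Sij : 0 <= S i - S j by rewrite subr_ge0 S_mono.
  apply: ler_pM; rewrite ?mulr_ge0 ?(ltW (D0 j)) ?addr_ge0 ?mulr_ge0 ?(ltW mu0)//.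
    rewrite ler_wpM2l// /D /jump_weight lef_pV2 ?posrE ?exprn_gt0//; last first.
      by rewrite ltr_wpDr ?S_ge0.
    by rewrite lerXn2r ?nnegrE ?(ltW (S1 j)) ?addr_ge0 ?S_ge0 ?(ltW T0)// lerD2r.
  by rewrite lerD2l ler_piMl//; move: mu1; goal_lra.
(* Induction on the larger index with the smaller one free, since a jump may land below it and
   exchange their roles. *)
elim/ltn_ind: i j => i IH j ji.
have Sij : 0 <= S i - S j by rewrite subr_ge0 S_mono.
have one : 1 <= 1 + mu * (S i - S j) by rewrite lerDl mulr_ge0// ltW.
have ADj : 0 <= A * D j by rewrite mulr_ge0// ltW.
have [jn2|n2j] := ltnP j n2.
  apply: le_trans (_ : A * D j <= _); last by rewrite ler_peMr.
  apply: le_trans (_ : 2 * B / D n2 * D j <= _); last first.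
    by rewrite ler_wpM2r ?(ltW (D0 j)).
  apply: le_trans (_ : 2 * B <= _).
    by apply: le_trans (ler_normB _ _) _; have := r_bound i; have := r_bound j; goal_lra.
  rewrite mulrAC ler_pdivlMr// ler_wpM2l ?mulr_ge0//.
  exact: jump_weight_le T0 (ltnW jn2).
move: ji; rewrite leq_eqVlt => /orP[/eqP ->|ji].
  by rewrite !subrr normr0 mulr0 addr0 mulr1 mulr_ge0// ltW.
have IH' l l' : (l' <= l < i)%N ->
   `|r l - r l'| <= A * jump_weight T K l' * (1 + mu * (S l - S l')).
  by move=> /andP[l'l li]; exact: IH.
have [nj0 nj1 ej1 ej2] := big j n2j.
have [ni0 ni1 ei1 ei2] := big i (leq_trans n2j (ltnW ji)).
have errj := errD j nj0.
have erri : mass_err i <= Cd * D j.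
  apply: le_trans (errD i ni0) _; rewrite ler_wpM2l//.
  exact: jump_weight_le T0 (ltnW ji).
have errBi : mass_err i * B <= Cd * B * D j by rewrite mulrAC ler_wpM2r.
have errBj : mass_err j * B <= Cd * B * D j by rewrite mulrAC ler_wpM2r.
have [y0y|yy0] := lerP y0 (S i - S j).
  apply: (@far_step A mu eps y0 T K i j) => //.
  - by rewrite (ltW mu0)/=; move: mu1; goal_lra.
  - by rewrite (ltW eps0)/=; move: mu1 epsmu; goal_lra.
  - by rewrite y00.
  - rewrite mulrDl; have : mu * (8 * expR (- (y0 / 4)) * C1) <= mu * (m1 / 4) by rewrite ler_pM2l.
    by move: heps; goal_lra.
  - have : 4 * (Cd * B) * D j <= A * (mu * m1) * D j by rewrite ler_wpM2r ?(ltW (D0 j)).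
    by rewrite -/(D j); move: errBi; goal_lra.
apply: le_trans (_ : A * D j <= _); last by rewrite ler_peMr.
have [q [q0 qW q_out qc]] := hov i j (introT andP (conj nj1 (ltnW ji))) (ltW yy0).
apply: (@near_step A mu eps y0 T c K i j q) => //; rewrite ?(ltW mu0) ?(ltW eps0) ?(ltW yy0)//.
- by move: mu1 epsmu; goal_lra.
- by rewrite c0.
- have : 4 * (mu + eps) * C1 * expR (y0 / 2) <= 4 * (mu + mu) * C1 * expR (y0 / 2).
    by rewrite !ler_wpM2r ?expR_ge0// ler_pM2l// lerD2l.
  by move: hmu; goal_lra.
- have : 16 * (Cd * B) * D j <= A * c * D j by rewrite ler_wpM2r ?(ltW (D0 j)).
  rewrite mulrDl -/(D j); have := mulr_ge0 (mulr_ge0 Cd0 Bp) (ltW (D0 j)).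
  by move: errBi errBj; goal_lra.
Qed.

End Stability.

(** * Partition ratios *)

Section Barriers.
Variables (R : realType) (W : nat -> nat -> R) (r : nat -> R) (n2 : nat).

Lemma finite_bounds (u : nat -> R) N : (forall n, 0 < u n) ->
  exists2 m, 0 < m & exists2 M, 0 < M & forall n, (n < N)%N -> m <= u n <= M.
Proof.
move=> u0; elim: N => [|N [m m0 [M M0 IH]]]; first by exists 1 => //; exists 1.
exists (Num.min m (u N)); first by rewrite lt_min m0 u0.
exists (Num.max M (u N)); first by rewrite lt_max M0.
move=> n; rewrite ltnS leq_eqVlt => /orP[/eqP ->|nN].
  by rewrite ge_min le_max lexx !orbT.
by have /andP[h1 h2] := IH n nN; rewrite ge_min le_max h1 h2.
Qed.

(** The masses are not exactly 1, so constants are not barriers. The slightly varying 1 + 1/(l+1)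
    and 1 - 1/(l+2) are: their slack from one index to the next absorbs a defect (n + 2)^-2. *)
Lemma kernel_barriers : (forall n l, 0 <= W n l) -> (forall n, 0 < r n) -> (0 < n2)%N ->
  (forall n, (n2 <= n)%N -> r n = \sum_(0 <= l < n) W n l * r l) ->
  (forall n, (n2 <= n)%N -> `|\sum_(0 <= l < n) W n l - 1| <= ((n%:R + 2) ^+ 2)^-1) ->
  exists2 rho, 0 < rho & exists2 B, 0 < B & forall n, rho <= r n <= B.
Proof.
move=> W0 r0 n20 rec mass.
have [m m0 [M M0 fin]] := finite_bounds n2 r0.
pose lo (l : nat) : R := 1 + (l%:R + 1)^-1; pose up (l : nat) : R := 1 - (l%:R + 2)^-1.
have nat0 (l : nat) : 0 <= l%:R :> R by [].
suff claim n : m / 2 * lo n <= r n <= 2 * M * up n.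
  exists (m / 2); first by rewrite divr_gt0.
  exists (2 * M); first by rewrite mulr_gt0.
  move=> n; have /andP[h1 h2] := claim n; apply/andP; split.
    by apply: le_trans h1; rewrite ler_peMr ?divr_ge0 ?(ltW m0)// lerDl invr_ge0 addr_ge0.
  by apply: le_trans h2 _; rewrite ler_piMr ?mulr_ge0 ?(ltW M0)// gerBl invr_ge0 addr_ge0.
elim/ltn_ind: n => n IH; have [nn2|n2n] := ltnP n n2.
  have /andP[h1 h2] := fin n nn2.
  have n1 : 0 < (n%:R + 1 : R) by rewrite ltr_wpDl.
  have n3 : 0 < (n%:R + 2 : R) by rewrite ltr_wpDl.
  have l1 : lo n <= 2 by rewrite /lo -[leRHS]/(1 + 1) lerD2l invf_le1// lerDr.
  have l2 : 2^-1 <= up n.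
    have : (n%:R + 2 : R)^-1 <= 2^-1 by rewrite lef_pV2 ?posrE// lerDr.
    by rewrite /up; lra.
  apply/andP; split.
    by apply: le_trans h1; rewrite -mulrA ler_piMr ?(ltW m0)//; lra.
  by apply: le_trans h2 _; rewrite mulrAC ler_peMl ?(ltW M0)//; lra.
have n0 : (0 < n)%N by exact: leq_trans n2n.
have x1 : 1 <= n%:R :> R by rewrite ler1n.
rewrite rec//; have := mass n n2n.
set w := \sum_(0 <= l < n) W n l; set x : R := n%:R in x1 *.
have w0 : 0 <= w by rewrite sumr_ge0.
rewrite ler_norml => /andP[w1 w2].
have D : 0 < (x + 2) ^+ 2 by rewrite exprn_gt0//; lra.
have D2 : (x + 2)^-1 ^+ 2 = ((x + 2) ^+ 2)^-1 by rewrite exprVn.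
apply/andP; split.
  apply: le_trans (_ : m / 2 * ((1 + x^-1) * w) <= _); last first.
    rewrite /w mulrA mulr_sumr !big_nat; apply: ler_sum => l /andP[_ ln].
    rewrite mulrC ler_wpM2l//; have /andP[h _] := IH l ln; apply: le_trans h.
    rewrite ler_wpM2l ?divr_ge0 ?(ltW m0)// lerD2l lef_pV2 ?posrE ?ltr_wpDl//; last by lra.
    by rewrite natr1 ler_nat.
  rewrite ler_wpM2l ?divr_ge0 ?(ltW m0)//.
  apply: le_trans (_ : (1 + x^-1) * (1 - ((x + 2) ^+ 2)^-1) <= _); last first.
    by rewrite ler_wpM2l ?addr_ge0 ?invr_ge0//; lra.
  rewrite -subr_ge0 /lo -/x.
  have -> : (1 + x^-1) * (1 - ((x + 2) ^+ 2)^-1) - (1 + (x + 1)^-1) =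
    ((x + 2) ^+ 2 - (x + 1) ^+ 2) / (x * (x + 1) * (x + 2) ^+ 2).
    by field; rewrite !gt_eqF//; lra.
  by rewrite divr_ge0 ?mulr_ge0 ?(ltW D)//; nra.
apply: le_trans (_ : 2 * M * ((1 - (x + 1)^-1) * w) <= _).
  rewrite /w mulrA mulr_sumr !big_nat; apply: ler_sum => l /andP[_ ln].
  rewrite mulrC ler_wpM2r//; have /andP[_ h] := IH l ln; apply: le_trans h _.
  have [l2 x2] : 0 < (l%:R + 2 : R) /\ 0 < x + 1 by have := nat0 l; split; lra.
  rewrite ler_wpM2l ?mulr_ge0 ?(ltW M0)// lerD2l lerN2 lef_pV2 ?posrE//.
  by rewrite -[2]/(1 + 1) addrA lerD2r natr1 ler_nat.
rewrite ler_wpM2l ?mulr_ge0 ?(ltW M0)//.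
apply: le_trans (_ : (1 - (x + 1)^-1) * (1 + ((x + 2) ^+ 2)^-1) <= _).
  rewrite ler_wpM2l//; last by lra.
  by rewrite subr_ge0 invf_le1//; lra.
rewrite -subr_ge0 /up -/x.
have -> : (1 - (x + 2)^-1) - (1 - (x + 1)^-1) * (1 + ((x + 2) ^+ 2)^-1) =
    2 / ((x + 1) * (x + 2) ^+ 2).
  by field; rewrite !gt_eqF//; lra.
by rewrite divr_ge0 ?mulr_ge0 ?(ltW D)//; lra.
Qed.

End Barriers.

(** * The kernel of the partition recursion *)

Section PartitionKernel.
Variable R : realType.
Let a : R := pi ^+ 2 / 3.
Let S := S_ R.

(* [f 0] is arbitrary: the term of index [0] is exponentially small in the recursion. *)
Definition part_approx n : R := if n is 0 then 1 else saddle_phi (S_ R n).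
Definition part_ratio n : R := (npart n)%:R / part_approx n.
Definition part_kernel n l : R :=
  (sigma (n - l))%:R * (part_approx l / (n%:R * part_approx n)).

Lemma part_approx_gt0 n : 0 < part_approx n.
Proof. by case: n => [|n] //=; apply: saddle_phi_gt0; exact: S_gt1. Qed.

Lemma npart_gt0 n : (0 < npart n)%N.
Proof.
rewrite /npart -has_predT; apply/hasP; case: n => [|n].
  by exists [::]; rewrite // mem_partitions.
by exists [:: n.+1]; rewrite // mem_partitions /is_partition /= addn0 eqxx.
Qed.

Lemma part_ratio_gt0 n : 0 < part_ratio n.
Proof. by rewrite divr_gt0 ?part_approx_gt0// ltr0n npart_gt0. Qed.

Lemma part_kernel_ge0 n l : 0 <= part_kernel n l.
Proof. by rewrite mulr_ge0// divr_ge0 ?mulr_ge0 ?(ltW (part_approx_gt0 _)). Qed.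

Lemma sum_complement (F : nat -> nat -> R) n :
  \sum_(0 <= l < n) F (n - l)%N l = \sum_(1 <= k < n.+1) F k (n - k)%N.
Proof.
rewrite big_nat_rev /= big_add1 /= !big_nat; apply: eq_bigr => k /andP[_ kn].
by rewrite add0n subKn.
Qed.

Lemma part_ratio_rec n : (0 < n)%N ->
  part_ratio n = \sum_(0 <= l < n) part_kernel n l * part_ratio l.
Proof.
move=> n0; have f0 m := part_approx_gt0 m; have n0' : (n%:R : R) != 0 by rewrite pnatr_eq0 -lt0n.
rewrite (eq_bigr (fun l => (n%:R * part_approx n)^-1 * ((sigma (n - l) * npart l)%N)%:R)).
  rewrite -mulr_sumr -natr_sum.
  have -> : (\sum_(0 <= l < n) sigma (n - l) * npart l = n * npart n)%N.
    rewrite npart_rec big_nat_rev /= big_add1 /= !big_nat; apply: eq_bigr => k /andP[_ kn].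
    by rewrite add0n subKn.
  by rewrite natrM /part_ratio; field; rewrite n0' gt_eqF.
move=> l _; rewrite natrM /part_kernel /part_ratio; field.
by rewrite n0' !gt_eqF.
Qed.

Lemma inv_saddle_phi_decay M : exists2 C : R, 0 <= C &
  forall s, 2 <= s -> (saddle_phi s)^-1 <= C / s ^+ M.
Proof.
have [C C0 h] := exp_decay R (M + 3); exists C => // s s2.
have s0 : 0 < s by lra.
have h4 := h (4 * s) (mulr_gt0 (ltr0n _ 4) s0); rewrite mulrAC divff// mul1r in h4.
have {}h4 : expR (- s) <= C / s ^+ (M + 3).
  apply: le_trans h4 _; rewrite ler_wpM2l// lef_pV2 ?posrE ?exprn_gt0 ?mulr_gt0//.
  by rewrite lerXn2r ?nnegrE ?(ltW s0) ?mulr_ge0 ?(ltW s0)//; lra.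
have -> : (saddle_phi s)^-1 = expR (- s) * s ^+ 3 / (s - 1).
  by rewrite /saddle_phi expRN; field; rewrite !gt_eqF ?expR_gt0//; lra.
apply: le_trans (_ : expR (- s) * s ^+ 3 <= _).
  by rewrite ler_piMr ?mulr_ge0 ?expR_ge0 ?exprn_ge0 ?(ltW s0)// invf_le1//; lra.
apply: le_trans (ler_wpM2r (exprn_ge0 3 (ltW s0)) h4) _.
by apply: decay_mul_le => //; [lra|rewrite addnC].
Qed.

Lemma S_sq_le n : S n ^+ 2 <= 2 * a * n%:R.
Proof.
case: n => [|n]; last first.
  have /andP[h1 h2] := pi2_3_bounds R.
  by rewrite /S S_sq// ler_wpM2l//; [rewrite mulr_ge0//; rewrite /a; lra|lra].
by rewrite mulr0 /S /S_ (@ler0_sqrtr _ (_ - _)) ?mulr0 ?expr0n// sub0r oppr_le0 invr_ge0.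
Qed.

(** The argument of the square root is -1/24, where the square root takes the default value 0; hence
    index 0 is often treated apart. *)
Lemma S0 : S 0 = 0.
Proof. by apply/eqP; have := S_sq_le 0; rewrite mulr0 le_eqVlt ltNge sqr_ge0 orbF sqrf_eq0. Qed.

Lemma S_sqB n l : (l < n)%N -> a * (n - l)%:R <= S n ^+ 2 - S l ^+ 2 <= 2 * a * (n - l)%:R.
Proof.
have /andP[a1 _] := pi2_3_bounds R; rewrite -/a in a1 => ln.
have n0 : (0 < n)%N by exact: leq_trans ln.
case: l ln => [|l] ln.
  rewrite S0 subn0 expr0n subr0 S_sq_le andbT /S S_sq// -/a.
  have : 1 <= n%:R :> R by rewrite ler1n.
  nra.
rewrite /S !S_sq// natrB; last exact: ltnW.
rewrite -/a; have : l.+1%:R + 1 <= n%:R :> R by rewrite natr1 ler_nat.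
nra.
Qed.

Lemma part_kernel_mass K : sdecay K (fun n => \sum_(0 <= l < n) part_kernel n l - 1).
Proof.
have [C C0 [n0 h]] := near_solution R K; have [C' C'0 h'] := inv_saddle_phi_decay (K + 2).
have [n1 h1] := S_large (2 : R).
exists (C + C'); first exact: addr_ge0.
exists (maxn n0 (maxn n1 1)) => n; rewrite !geq_max => /and3P[nn0 nn1 n_gt0].
have s2 := h1 n nn1; have {}h := h n nn0; have {}h' := h' _ s2.
have sp : 0 < S_ R n by lra.
have nR : 1 <= n%:R :> R by rewrite ler1n.
have fn : part_approx n = saddle_phi (S_ R n) by case: n n_gt0 {nn0 nn1 s2 h h' sp nR}.
(* The term l = 0, which [near_solution] leaves out, is split off; 1/phi beats the growth of
   [sigma]. *)
have -> : \sum_(0 <= l < n) part_kernel n l - 1 = n%:R^-1 * (\sum_(1 <= k < n)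
    (sigma k)%:R * (saddle_phi (S_ R (n - k)) / saddle_phi (S_ R n)) - n%:R) +
    n%:R^-1 * (sigma n)%:R * (saddle_phi (S_ R n))^-1.
  rewrite (sum_complement (fun k l => (sigma k)%:R * (part_approx l / (n%:R * part_approx n)))).
  rewrite big_nat_recr//= subnn fn mulrBr mulVf ?gt_eqF//; last by lra.
  rewrite invfM mulr_sumr.
  have -> : \sum_(1 <= k < n) (sigma k)%:R * (part_approx (n - k) *
      (n%:R^-1 * (saddle_phi (S_ R n))^-1)) = \sum_(1 <= k < n) n%:R^-1 *
      ((sigma k)%:R * (saddle_phi (S_ R (n - k)) / saddle_phi (S_ R n))).
    rewrite !big_nat; apply: eq_bigr => k /andP[k1 kn].
    have -> : part_approx (n - k) = saddle_phi (S_ R (n - k)).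
      by rewrite /part_approx; case: (n - k)%N (subn_gt0 k n) => //; rewrite kn.
    by ring.
  by move: (\sum_(1 <= k < n) _) => X; rewrite mul1r; ring.
rewrite mulrDl; apply: le_trans (ler_normD _ _) _; apply: lerD.
  rewrite normrM ger0_norm ?invr_ge0//; apply: le_trans h.
  by rewrite ler_piMl ?normr_ge0// invf_le1//; lra.
have ph : 0 < saddle_phi (S_ R n) by apply: saddle_phi_gt0; lra.
rewrite ger0_norm; last by rewrite !mulr_ge0 ?invr_ge0// ltW.
apply: le_trans (_ : n%:R * (C' / S_ R n ^+ (K + 2)) <= _).
  apply: ler_pM; rewrite ?mulr_ge0 ?invr_ge0 ?(ltW ph)//.
  rewrite ler_pdivrMl; last by lra.
  by rewrite -natrM ler_nat sigma_leq.
apply: le_trans (_ : S_ R n ^+ 2 * (C' / S_ R n ^+ (K + 2)) <= _).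
  by rewrite ler_wpM2r ?S_sq_ge// divr_ge0 ?exprn_ge0// ltW.
rewrite le_eqVlt; apply/orP; left; apply/eqP; rewrite exprD.
have z : S_ R n != 0 by rewrite gt_eqF.
by field; rewrite expf_neq0.
Qed.

Lemma sdecay_uniform K (f : nat -> R) : sdecay K f -> exists2 C, 0 <= C &
  forall n, `|f n| <= C / (1 + S n) ^+ K.
Proof.
move=> [C C0 [n0 h]].
have p n : 0 < (1 + S n) ^+ K by rewrite exprn_gt0// ltr_wpDr// S_ge0.
pose D := \sum_(0 <= n < n0.+1) `|f n| * (1 + S n) ^+ K.
have D0 : 0 <= D by rewrite sumr_ge0// => n _; rewrite mulr_ge0// ltW.
exists (C * 2 ^+ K + D); first by rewrite addr_ge0 ?mulr_ge0 ?exprn_ge0.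
move=> n; rewrite ler_pdivlMr//; have [nn0|n0n] := ltnP n n0.+1.
  apply: ler_wpDl; first by rewrite mulr_ge0 ?exprn_ge0.
  rewrite /D (bigD1_seq n) ?mem_index_iota ?iota_uniq//= lerDl sumr_ge0// => m _.
  by rewrite mulr_ge0// ltW.
apply: ler_wpDr => //; have s1 := S_gt1 R (leq_trans (ltn0Sn _) n0n); rewrite -/S in s1.
have s0 : 0 < S n by lra.
apply: le_trans (ler_wpM2r (ltW (p n)) (h n (ltnW n0n))) _.
rewrite mulrAC -mulrA ler_wpM2l// mulrC -exprVn -exprMn lerXn2r ?nnegrE//.
  by rewrite mulr_ge0 ?invr_ge0 ?(ltW s0)//; lra.
by rewrite -/S ler_pdivrMl//; lra.
Qed.

(** For s >= t >= 1 one has s/t <= 1 + (s - t), so the ratio is controlled by the jump s - t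
    alone. *)
Lemma part_approx_ratio_le n l : (l < n)%N -> 2 <= S n ->
  part_approx l / part_approx n <= (1 + (S n - S l)) ^+ 3 * expR (- (S n - S l)).
Proof.
move=> ln s2; have n0 : (0 < n)%N by exact: leq_trans ln.
have -> : part_approx n = saddle_phi (S n) by case: n n0 {ln s2}.
have s0 : 0 < S n by lra.
have phE : (saddle_phi (S n))^-1 = expR (- S n) * S n ^+ 3 / (S n - 1).
  by rewrite /saddle_phi expRN; field; rewrite !gt_eqF ?expR_gt0//; lra.
have inv1 : (S n - 1)^-1 <= 1 by rewrite invf_le1; lra.
case: l ln => [|l] ln.
  rewrite S0 subr0 /= mul1r phE.
  apply: le_trans (_ : expR (- S n) * S n ^+ 3 <= _).
    by rewrite ler_piMr// mulr_ge0 ?expR_ge0// exprn_ge0// ltW.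
  by rewrite mulrC ler_wpM2r ?expR_ge0// lerXn2r ?nnegrE//; lra.
have := S_gt1 R (ltn0Sn l); rewrite -/S => l1; have := S_le R (ltnW ln); rewrite -/S => lS.
rewrite /= phE -/S; move: (S n) (S l.+1) s0 s2 inv1 l1 lS {phE} => s t s0 s2 inv1 l1 lS.
have -> : saddle_phi t * (expR (- s) * s ^+ 3 / (s - 1)) =
   (s / t) ^+ 3 * expR (- (s - t)) * ((t - 1) / (s - 1)).
  rewrite /saddle_phi opprB expRD; field.
  by rewrite !gt_eqF ?exprn_gt0//; lra.
have q0 : 0 <= s / t by rewrite divr_ge0; lra.
apply: le_trans (_ : (s / t) ^+ 3 * expR (- (s - t)) <= _).
  apply: ler_piMr; first by rewrite mulr_ge0 ?expR_ge0// exprn_ge0.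
  by rewrite ler_pdivrMr; lra.
rewrite ler_wpM2r ?expR_ge0// lerXn2r ?nnegrE//; first by lra.
by rewrite ler_pdivrMr; [nra | lra].
Qed.

(** S(n) + S(l) lies between S(n) and 2 S(n), so a jump in [S] is comparable to (n - l)/S(n). *)
Lemma S_jump_bounds n l : (l < n)%N ->
  a * (n - l)%:R <= (S n - S l) * S n <= 2 * a * (n - l)%:R.
Proof.
move=> ln; have /andP[_ h2] := S_sqB ln.
have := S_le R (ltnW ln); have := S_ge0 R l; have := S_ge0 R n; rewrite -/S => n0 l0 lS.
apply/andP; split; last by apply: le_trans h2; nra.
case: l ln h2 l0 lS => [|l] ln _ l0 lS.
  by have /andP[h _] := S_sqB ln; apply: le_trans h _; rewrite S0 subr0 expr0n subr0 expr2.
have e : S n ^+ 2 - S l.+1 ^+ 2 = 2 * a * (n - l.+1)%:R.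
  rewrite /S !S_sq ?(leq_trans _ ln)// natrB; last exact: ltnW.
  by rewrite -/a; ring.
nra.
Qed.

(** Of the decay e^(-J), half cancels against the moment, a quarter absorbs the cubic factor, and a
    quarter leaves an exponential sum of [sigma] of order S^2, hence of order n. *)
Lemma part_kernel_exp_moment : exists2 C, 0 <= C & exists n0, forall n, (n0 <= n)%N ->
  \sum_(0 <= l < n) part_kernel n l * expR ((S n - S l) / 2) <= C.
Proof.
have [C C0 hC] := exp_poly_bound R 3; have /andP[a1 _] := pi2_3_bounds R; rewrite -/a in a1.
exists (64 * C * 96); first by rewrite !mulr_ge0.
have [n1 h1] := S_large (2 : R); exists (maxn n1 1) => n; rewrite geq_max => /andP[nn1 n_gt0].
have s2 := h1 n nn1; rewrite -/S in s2; have s0 : 0 < S n by lra.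
have nR : 1 <= n%:R :> R by rewrite ler1n.
have n0 : 0 < n%:R :> R by lra.
have fn := part_approx_gt0.
(* The rate for which e^(-J/4) <= e^(-(n-l) b) at a jump J of length n - l. *)
pose b := a / S n / 4.
have b0 : 0 < b by apply: divr_gt0 => //; apply: divr_gt0 => //; lra.
apply: le_trans (_ : \sum_(0 <= l < n) n%:R^-1 * (64 * C) *
   ((sigma (n - l))%:R * expR (- ((n - l)%:R * b))) <= _).
  rewrite !big_nat; apply: ler_sum => l /andP[_ ln].
  have /andP[J1 _] := S_jump_bounds ln; have J0 : 0 <= S n - S l by rewrite subr_ge0 S_le// ltnW.
  have r := part_approx_ratio_le ln s2; set J := S n - S l in J0 J1 r *.
  have -> : part_kernel n l * expR (J / 2) = n%:R^-1 * (sigma (n - l))%:R *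
      (part_approx l / part_approx n * expR (J / 2)).
    by rewrite /part_kernel; field; rewrite !gt_eqF.
  have -> : n%:R^-1 * (64 * C) * ((sigma (n - l))%:R * expR (- ((n - l)%:R * b))) =
     n%:R^-1 * (sigma (n - l))%:R * (64 * C * expR (- ((n - l)%:R * b))) by ring.
  rewrite ler_wpM2l ?mulr_ge0 ?invr_ge0//.
  apply: le_trans (ler_wpM2r (expR_ge0 _) r) _.
  have -> : (1 + J) ^+ 3 * expR (- J) * expR (J / 2) =
     (1 + J) ^+ 3 * expR (- (J / 4)) * expR (- (J / 4)).
    have eJ : expR (- J) * expR (J / 2) = expR (- (J / 4)) * expR (- (J / 4)).
      by rewrite -!expRD; congr expR; field.
    by rewrite -mulrA eJ mulrA.
  have J3 : 0 <= 1 + J by lra.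
  apply: ler_pM; rewrite ?mulr_ge0 ?exprn_ge0 ?expR_ge0//.
    have h := hC (J / 4) (divr_ge0 J0 (ler0n _ 4)).
    apply: le_trans (_ : 64 * ((1 + J / 4) ^+ 3 * expR (- (J / 4))) <= _); last by rewrite ler_pM2l.
    rewrite mulrA ler_wpM2r ?expR_ge0//.
    rewrite (_ : 64 = 4 ^+ 3 :> R); last by ring.
    by rewrite -exprMn lerXn2r ?nnegrE//; lra.
  rewrite ler_expR lerN2 /b -(ler_pM2r s0).
  by rewrite (_ : _ * _ * S n = a * (n - l)%:R / 4); [lra | field; rewrite gt_eqF].
rewrite -mulr_sumr (sum_complement (fun k _ => (sigma k)%:R * expR (- (k%:R * b)))).
have := sigma_exp_psum_le n b0; move: (\sum_(1 <= k < _) _) => X hX.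
apply: le_trans (_ : n%:R^-1 * (64 * C) * (3 / b ^+ 2) <= _).
  by rewrite ler_wpM2l// !mulr_ge0// invr_ge0 ltW.
have -> : n%:R^-1 * (64 * C) * (3 / b ^+ 2) = 64 * C * (48 * S n ^+ 2 / (n%:R * a ^+ 2)).
  by rewrite /b; field; rewrite !gt_eqF//; lra.
rewrite ler_wpM2l ?mulr_ge0// ler_pdivrMr; last by apply: mulr_gt0 n0 (exprn_gt0 2 _); lra.
have := S_sq_le n; nra.
Qed.

Lemma part_kernel_ge n l : (l < n)%N -> 3 <= S n -> S n / 2 <= S l ->
  (n - l)%:R / (4 * n%:R) * expR (- (S n - S l)) <= part_kernel n l.
Proof.
move=> ln s3 sl; have n0 : (0 < n)%N by exact: leq_trans ln.
have nR : 0 < n%:R :> R by rewrite ltr0n.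
case: l ln sl => [|l] ln sl; first by rewrite S0 in sl; lra.
have lS := S_le R (ltnW ln); rewrite -/S in lS.
have phn : 0 < saddle_phi (S n) by apply: saddle_phi_gt0; lra.
rewrite /part_kernel (_ : part_approx n = saddle_phi (S n)); last by case: n n0 {ln s3 sl nR lS phn}.
change (part_approx l.+1) with (saddle_phi (S l.+1)).
rewrite [leLHS](_ : _ = (n - l.+1)%:R * n%:R^-1 * (expR (- (S n - S l.+1)) / 4)); last first.
  by field; rewrite gt_eqF.
rewrite [leRHS](_ : _ = (sigma (n - l.+1))%:R * n%:R^-1 *
  (saddle_phi (S l.+1) / saddle_phi (S n))); last by field; rewrite !gt_eqF.
have e4 : expR (- (S n - S l.+1)) / 4 <= saddle_phi (S l.+1) / saddle_phi (S n).
  rewrite ler_pdivlMr// /saddle_phi; move: (S n) (S l.+1) s3 sl lS {ln phn} => s t s3 sl lS.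
  have -> : expR (- (s - t)) / 4 * (expR s * (s - 1) / s ^+ 3) = expR t * ((s - 1) / s ^+ 3 / 4).
    have -> : expR t = expR (- (s - t)) * expR s by rewrite -expRD; congr expR; ring.
    by ring.
  rewrite -[leRHS]mulrA ler_wpM2l ?expR_ge0//.
  have t0 : 0 < t by lra.
  have s0 : 0 < s by lra.
  rewrite mulrAC; apply: ler_pM; rewrite ?divr_ge0 ?invr_ge0 ?exprn_ge0//; try lra.
  by rewrite lef_pV2 ?posrE ?exprn_gt0// lerXn2r ?nnegrE//; lra.
apply: ler_pM => //; rewrite ?mulr_ge0 ?invr_ge0 ?divr_ge0 ?expR_ge0 ?(ltW nR)//.
by rewrite ler_wpM2r ?invr_ge0 ?(ltW nR)// ler_nat sigma_geq.
Qed.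

Lemma sqrt_nat_bounds n : exists m, (m * m <= n < m.+1 * m.+1)%N.
Proof.
have ex : exists i, (i * i <= n)%N by exists 0%N.
have ub i : (i * i <= n)%N -> (i <= n)%N by nia.
case: (ex_maxnP ex ub) => m h1 h2; exists m; rewrite h1 ltnNge; apply/negP => h3.
by have := h2 _ h3; rewrite ltnn.
Qed.

(* Lengths [n - l] of order [sqrt n] carry a fixed proportion of the kernel. *)
Lemma S_window n m : (0 < m)%N -> (m * m <= n < m.+1 * m.+1)%N ->
  [/\ n%:R <= 4 * m%:R ^+ 2 :> R, S n <= 4 * a * m%:R & m%:R <= S n].
Proof.
have /andP[a1 _] := pi2_3_bounds R; rewrite -/a in a1.
move=> m0 /andP[h1 h2]; have n0 : (0 < n)%N by nia.
have m1 : 1 <= m%:R :> R by rewrite ler1n.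
have e1 : n%:R <= 4 * m%:R ^+ 2 :> R.
  by rewrite -natrX -natrM ler_nat; nia.
split=> //.
  rewrite -ler_sqr ?nnegrE ?S_ge0//; last by rewrite mulr_ge0//; lra.
  apply: le_trans (S_sq_le n) _; apply: le_trans (_ : 2 * a * (4 * m%:R ^+ 2) <= _).
    by rewrite ler_wpM2l//; lra.
  have -> : (4 * a * m%:R) ^+ 2 = 16 * (a * (a * m%:R ^+ 2)) by ring.
  have m2 : 0 <= a * m%:R ^+ 2 by rewrite mulr_ge0 ?sqr_ge0//; lra.
  have : 1 * (a * m%:R ^+ 2) <= a * (a * m%:R ^+ 2) by rewrite ler_wpM2r//; lra.
  lra.
rewrite -ler_sqr ?nnegrE ?S_ge0//; apply: le_trans (_ : n%:R <= _); last exact: S_sq_ge.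
by rewrite -natrX ler_nat -mulnn.
Qed.

(** The m indices of the window, with m about sqrt n, each have weight at least a constant over m
    and a jump of at least 1/4. *)
Lemma part_kernel_mean : exists2 m1, 0 < m1 & exists n0, forall n, (n0 <= n)%N ->
  m1 <= \sum_(0 <= l < n) part_kernel n l * (S n - S l).
Proof.
have /andP[a1 _] := pi2_3_bounds R; rewrite -/a in a1.
exists (expR (- (4 * a)) / 64); first by rewrite divr_gt0 ?expR_gt0.
have [n1 h1] := S_large (8 * a); exists (maxn n1 16) => n; rewrite geq_max => /andP[nn1 n16].
have s8 := h1 n nn1; rewrite -/S in s8.
have [m mn] := sqrt_nat_bounds n; have /andP[mn1 mn2] := mn.
have m4 : (4 <= m)%N by move: n16 mn2; clear; nia.
have m0 : (0 < m)%N by exact: leq_trans m4.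
have [e1 e2 e3] := S_window m0 mn.
have mR : 4 <= m%:R :> R by rewrite (ler_nat _ 4).
have mm : (m + m <= n)%N by move: mn1 m4; clear; nia.
have nR : 0 < n%:R :> R by rewrite ltr0n; lia.
have pos l : (l < n)%N -> 0 <= part_kernel n l * (S n - S l).
  by move=> ln; rewrite mulr_ge0 ?part_kernel_ge0// subr_ge0 S_le// ltnW.
apply: le_trans (_ : \sum_(n - (m + m) <= l < n - m) part_kernel n l * (S n - S l) <= _); last first.
  rewrite (@big_cat_nat _ _ _ (n - (m + m)) 0 n)//=; last exact: leq_subr.
  rewrite (@big_cat_nat _ _ _ (n - m) (n - (m + m)) n)//=; [|by rewrite leq_sub2l// leq_addr|exact: leq_subr].
  apply: ler_wpDl; last apply: ler_wpDr => //; rewrite big_nat sumr_ge0// => l /andP[l1 l2];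
    by apply: pos; move: l1 l2 mm; clear; lia.
apply: le_trans (_ : \sum_(n - (m + m) <= l < n - m)
   (m%:R / (4 * n%:R) * expR (- (4 * a)) * 4^-1) <= _).
  rewrite sumr_const_nat (_ : n - m - (n - (m + m)) = m)%N; last by move: mm; clear; lia.
  rewrite -[leRHS]mulr_natl.
  have -> : m%:R * (m%:R / (4 * n%:R) * expR (- (4 * a)) / 4) =
     expR (- (4 * a)) * (m%:R ^+ 2 / (16 * n%:R)) by field; rewrite gt_eqF.
  rewrite ler_wpM2l ?expR_ge0// ler_pdivlMr ?mulr_gt0//; lra.
rewrite !big_nat; apply: ler_sum => l /andP[l1 l2].
have ln : (l < n)%N by exact: leq_trans l2 (leq_subr _ _).
have /andP[J1 J2] := S_jump_bounds ln.
have s0 : 0 < S n by lra.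
have kl : m%:R <= (n - l)%:R :> R by rewrite ler_nat; move: l1 l2 mm; clear; lia.
have ku : (n - l)%:R <= 2 * m%:R :> R by rewrite -[2 * m%:R]natrM ler_nat; move: l1 l2 mm; clear; lia.
have Ju : S n - S l <= 4 * a.
  rewrite -(ler_pM2r s0); apply: le_trans J2 _.
  have : a * (n - l)%:R <= a * (2 * m%:R) by rewrite ler_pM2l//; lra.
  have : a * m%:R <= a * S n by rewrite ler_pM2l//; lra.
  lra.
have Jl : 4^-1 <= S n - S l.
  rewrite -(ler_pM2r s0); apply: le_trans J1.
  have : a * m%:R <= a * (n - l)%:R by rewrite ler_pM2l//; lra.
  lra.
apply: ler_pM; rewrite ?mulr_ge0 ?expR_ge0 ?divr_ge0 ?mulr_ge0//.
apply: le_trans (part_kernel_ge ln _ _); [|lra|lra].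
by rewrite ler_pM ?expR_ge0 ?divr_ge0 ?mulr_ge0// ?ler_expR ?lerN2// ler_wpM2r ?invr_ge0 ?mulr_ge0.
Qed.

Local Ltac goal_lra := clear - a S; lra.

(** The common part is uniform on lengths between m and 2m below [j], with m about sqrt j. As [S i]
    is within [y0] of [S j], both kernels exceed a constant over m there. *)
Lemma part_kernel_overlap (y0 : R) : exists c n1, 0 < c <= 2^-1 /\
  forall i j, (n1 <= j <= i)%N -> S i - S j <= y0 -> exists q : nat -> R,
    [/\ forall l, 0 <= q l,
        forall l, (l < j)%N -> q l <= part_kernel i l /\ q l <= part_kernel j l,
        forall l, (j <= l)%N -> q l = 0 & \sum_(0 <= l < j) q l = c].
Proof.
have /andP[a1 _] := pi2_3_bounds R; rewrite -/a in a1; have a0 : 0 < a by lra.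
pose z := `|y0|; have z0 : 0 <= z by exact: normr_ge0.
pose E := expR (- (z + 4 * a)); have E0 : 0 < E by exact: expR_gt0.
have E1 : E <= 1 by rewrite -[leRHS]expR0 ler_expR; lra.
(* From the lower bound (h - l)/(4h) for a kernel at h, with h - l >= m and h <= 32 a m^2; [E]
   bounds the exponential factor. *)
pose c := E / (128 * a).
have a128 : 0 < 128 * a := mulr_gt0 (ltr0n _ 128) a0.
have c0 : 0 < c := divr_gt0 E0 a128.
have cE : c * (128 * a) = E by rewrite /c divfK// gt_eqF.
have [n1 h1] := S_large (16 * a + 2 * z); exists c, (maxn n1 16); split.
  rewrite c0/=; have : c * 128 <= c * (128 * a) by rewrite ler_pM2l//; lra.
  lra.
move=> i j /andP[]; rewrite geq_max => /andP[nn1 j16] ji yij.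
have s8 := h1 j nn1; rewrite -/S in s8.
have [m mn] := sqrt_nat_bounds j; have /andP[mn1 mn2] := mn.
have m4 : (4 <= m)%N by move: j16 mn2; clear; nia.
have m0 : (0 < m)%N by exact: leq_trans m4.
have [e1 e2 e3] := S_window m0 mn.
have mR : 4 <= m%:R :> R by rewrite (ler_nat _ 4).
have mm : (m + m <= j)%N by move: mn1 m4; clear; nia.
have j0 : (0 < j)%N by exact: leq_trans j16.
have jR : 0 < j%:R :> R by rewrite ltr0n.
have iR : 0 < i%:R :> R by rewrite ltr0n (leq_trans j0).
have Sji := S_le R ji; rewrite -/S in Sji.
have yz : S i - S j <= z by apply: le_trans yij _; exact: ler_norm.
have iub : i%:R <= 32 * a * m%:R ^+ 2 :> R.
  have i0 : (0 < i)%N by rewrite -(ltr0n R).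
  apply: le_trans (S_sq_ge R i0) _; rewrite -/S.
  apply: le_trans (_ : (2 * S j) ^+ 2 <= _).
    have i1 := S_ge0 R i; have j1 := S_ge0 R j; rewrite -/S in i1 j1.
    by rewrite ler_sqr ?nnegrE; move: i1 j1 yz s8 z0 a0; goal_lra.
  rewrite exprMn; have := S_sq_le j; have := ler_wpM2l (ltW a0) e1; lra.
pose q (l : nat) : R := if (j - (m + m) <= l < j - m)%N then c / m%:R else 0.
have cm0 : 0 <= c / m%:R by rewrite divr_ge0// ltW.
exists q; split=> [l|l lj|l jl|].
- by rewrite /q; case: ifP.
- rewrite /q; case: ifP => [/andP[l1 l2]|_]; last by rewrite !part_kernel_ge0.
  have /andP[J1 J2] := S_jump_bounds lj; have s0 : 0 < S j by lra.
  have kl : m%:R <= (j - l)%:R :> R by rewrite ler_nat; move: l1 l2 mm; clear; lia.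
  have ku : (j - l)%:R <= 2 * m%:R :> R by rewrite -[2 * m%:R]natrM ler_nat; move: l1 l2 mm; clear; lia.
  have Ju : S j - S l <= 4 * a.
    rewrite -(ler_pM2r s0); apply: le_trans J2 _.
    have : a * (j - l)%:R <= a * (2 * m%:R) by rewrite ler_pM2l.
    have : a * m%:R <= a * S j by rewrite ler_pM2l.
    by goal_lra.
  have gen h : (l < h)%N -> S j <= S h <= S j + z -> h%:R <= 32 * a * m%:R ^+ 2 :> R ->
      0 < h%:R :> R -> m%:R <= (h - l)%:R :> R -> c / m%:R <= part_kernel h l.
    move=> lh /andP[h0 hz] hb hR kh.
    apply: le_trans (part_kernel_ge lh _ _); [|by move: s8 h0 a1 z0; goal_lra|by move: s8 Ju hz a1 z0; goal_lra].
    have -> : c / m%:R = m%:R / (4 * (32 * a * m%:R ^+ 2)) * E.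
      by rewrite -cE; field; rewrite !gt_eqF//; move: mR; goal_lra.
    set D := 32 * a * m%:R ^+ 2 in hb *.
    have D0 : 0 < 4 * D := mulr_gt0 (ltr0n _ 4) (lt_le_trans hR hb).
    have h4 : 0 < 4 * h%:R :> R := mulr_gt0 (ltr0n _ 4) hR.
    have hD : (4 * D)^-1 <= (4 * h%:R)^-1 by rewrite lef_pV2// ler_pM2l.
    apply: ler_pM; rewrite ?(ltW E0)//; first exact: divr_ge0 (ltW D0).
      by apply: ler_pM; rewrite // invr_ge0 ltW.
    by rewrite ler_expR; move: hz Ju; goal_lra.
  split; apply: gen => //; rewrite ?lexx//.
  + exact: leq_trans ji.
  + by rewrite Sji/=; move: yz; goal_lra.
  + by apply: le_trans kl _; rewrite ler_nat leq_sub2r.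
  + by move: z0; goal_lra.
  + apply: le_trans e1 _; have : 0 <= m%:R ^+ 2 :> R by exact: sqr_ge0.
    nra.
- by rewrite /q; case: ifP => // /andP[_ h]; move: jl h; clear; lia.
rewrite (@big_cat_nat _ _ _ (j - (m + m)) 0 j)//=; last exact: leq_subr.
rewrite (@big_cat_nat _ _ _ (j - m) (j - (m + m)) j)//=; [|by rewrite leq_sub2l// leq_addr|exact: leq_subr].
rewrite big_nat big1 ?add0r => [|l /andP[l1 l2]]; last by rewrite /q ifF//; apply/negP; move: l2; clear; lia.
rewrite [X in _ + X]big_nat [X in _ + X]big1 ?addr0 => [|l /andP[l1 l2]]; last first.
  by rewrite /q ifF//; apply/negP; move: l1; clear; lia.
rewrite big_nat (eq_bigr (fun=> c / m%:R)) => [|l h]; last by rewrite /q h.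
rewrite -big_nat sumr_const_nat (_ : j - m - (j - (m + m)) = m)%N; last by move: mm; clear; lia.
by rewrite -[LHS]mulr_natl mulrCA mulfV ?mulr1// gt_eqF//; lra.
Qed.

Lemma S_step_le n j : S (n + j) - S n <= 2 * a * j%:R.
Proof.
have /andP[a1 _] := pi2_3_bounds R; rewrite -/a in a1; have a0 : 0 < a by lra.
case: j => [|j]; first by rewrite addn0 subrr mulr0.
have ln : (n < n + j.+1)%N by rewrite addnS ltnS leq_addr.
have /andP[_ h] := S_jump_bounds ln; rewrite addKn in h.
have := S_gt1 R (leq_ltn_trans (leq0n n) ln); rewrite -/S => s1.
have := S_le R (ltnW ln); rewrite -/S => s2.
apply: le_trans h; rewrite ler_peMr//; lra.
Qed.

Theorem part_ratio_asymp : exists2 rho, 0 < rho & (forall n, rho <= part_ratio n) /\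
  forall K j, exists2 C, 0 <= C &
    forall n, `|part_ratio (n + j) - part_ratio n| <= C / (1 + S n) ^+ K.
Proof.
have [n1 h1] := S_large (3 : R).
(* Order 6 suffices for the barriers: (n + 2)^2 is at most 9 (1 + S)^4, and the spare powers beat
   the constant. *)
have [C C0 hC] := sdecay_uniform (part_kernel_mass 6).
have [n2 h2] := S_large (9 * C + 3).
have [rho rho0 [B B0 rB]] : exists2 rho, 0 < rho & exists2 B, 0 < B &
    forall n, rho <= part_ratio n <= B.
  apply: (@kernel_barriers R part_kernel part_ratio (maxn n2 1)).
  - exact: part_kernel_ge0.
  - exact: part_ratio_gt0.
  - by rewrite leq_max orbT.
  - by move=> n; rewrite geq_max => /andP[_ n0]; exact: part_ratio_rec.
  move=> n; rewrite geq_max => /andP[nn2 n0]; apply: le_trans (hC n) _.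
  have := h2 n nn2; rewrite -/S => s; have s0 : 0 < S n by lra.
  have nS := S_sq_ge R n0; rewrite -/S in nS.
  have nR : 0 <= n%:R :> R by [].
  have p : 0 < n%:R + 2 :> R by lra.
  have x1 : n%:R + 2 <= 3 * (1 + S n) ^+ 2 by nra.
  have y1 : 1 <= 1 + S n by lra.
  rewrite ler_pdivrMr ?exprn_gt0//; last by lra.
  rewrite mulrC ler_pdivlMr ?exprn_gt0//.
  apply: le_trans (_ : C * (3 * (1 + S n) ^+ 2) ^+ 2 <= _).
    have h (u v : R) : 0 <= u -> u <= v -> C * u ^+ 2 <= C * v ^+ 2.
      by move=> u0 uv; rewrite ler_wpM2l// lerXn2r ?nnegrE// (le_trans u0).
    exact: h _ _ (ltW p) x1.
  set x := 1 + S n in y1 *.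
  have -> : C * (3 * x ^+ 2) ^+ 2 = (9 * C) * x ^+ 4 by ring.
  apply: le_trans (_ : x * x ^+ 4 <= _).
    by rewrite ler_wpM2r ?exprn_ge0//; rewrite /x; lra.
  by rewrite -exprS ler_weXn2l.
exists rho => //; split=> [n|K j]; first by have /andP[] := rB n.
have [C1 C10 [n3 h3]] := part_kernel_exp_moment.
have [m1 m10 [n4 h4]] := part_kernel_mean.
pose n0 := maxn 1 (maxn n3 n4).
have n0P n : (n0 <= n)%N -> [/\ (0 < n)%N, (n3 <= n)%N & (n4 <= n)%N].
  by rewrite !geq_max => /and3P[].
have [D D0 hD] := @kernel_stability R part_kernel S part_ratio C1 m1 B n0
  part_kernel_ge0 (@S_le R) (@S_ge0 R) (@S_large R) C10 m10 (ltW B0)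
  (fun K' => let: ex_intro2 c c0 h := sdecay_uniform (part_kernel_mass K') in
     ex_intro2 _ _ c c0 (fun n _ => h n))
  (fun n h => h3 n (let: And3 _ x _ := n0P n h in x))
  (fun n h => h4 n (let: And3 _ _ x := n0P n h in x))
  part_kernel_overlap
  (fun n => ltac:(rewrite (ger0_norm (ltW (part_ratio_gt0 n))); by have /andP[] := rB n))
  (fun n h => part_ratio_rec (let: And3 x _ _ := n0P n h in x)) K.
have /andP[a1 _] := pi2_3_bounds R; rewrite -/a in a1.
exists (D * (1 + 2 * a * j%:R)).
  by rewrite mulr_ge0// addr_ge0// mulr_ge0//; lra.
move=> n; apply: le_trans (hD _ _ (leq_addr j n)) _.
rewrite mulrAC; rewrite ler_wpM2r ?invr_ge0 ?exprn_ge0 ?addr_ge0 ?S_ge0//.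
by rewrite ler_wpM2l// lerD2l S_step_le.
Qed.

Lemma ln_norm_le (x y rho : R) : 0 < rho -> rho <= x -> rho <= y -> `|ln (x / y)| <= `|x - y| / rho.
Proof.
move=> rho0 rx ry; have x0 : 0 < x by exact: lt_le_trans rx.
have y0 : 0 < y by exact: lt_le_trans ry.
have gen u v : 0 < u -> rho <= v -> ln (u / v) <= `|u - v| / rho.
  move=> u0 rv; have v0 : 0 < v by exact: lt_le_trans rv.
  apply: le_trans (_ : u / v - 1 <= _).
    have -> : u / v = 1 + (u / v - 1) by ring.
    by rewrite [leRHS]addrAC subrr add0r; apply: le_ln1Dx; have := divr_gt0 u0 v0; lra.
  have -> : u / v - 1 = (u - v) / v by field; rewrite gt_eqF.
  apply: le_trans (_ : `|u - v| / v <= _); first by rewrite ler_wpM2r ?invr_ge0 ?(ltW v0)// ler_norm.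
  by rewrite ler_wpM2l// lef_pV2.
rewrite ler_norml; apply/andP; split; last exact: gen.
have := gen y x y0 rx; rewrite -(invf_div y x) lnV ?posrE ?divr_gt0// distrC; lra.
Qed.

Theorem npart_log_ratio j K : sdecay K (fun n => ln (pR R (n + j) / pR R n) -
  (ln (saddle_phi (S_ R (n + j))) - ln (saddle_phi (S_ R n)))).
Proof.
have [rho rho0 [h1 h2]] := part_ratio_asymp; have [C C0 hC] := h2 K j.
exists (C / rho); first by rewrite divr_ge0// ltW.
exists 1%N => n n0; have nj : (0 < n + j)%N by rewrite addn_gt0 n0.
have fE m : (0 < m)%N -> part_approx m = saddle_phi (S m) by case: m.
have p m : 0 < pR R m by rewrite ltr0n npart_gt0.
have f m : 0 < part_approx m := part_approx_gt0 m.
rewrite -[S_ R]/S -!fE//.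
have -> : ln (pR R (n + j) / pR R n) - (ln (part_approx (n + j)) - ln (part_approx n)) =
    ln (part_ratio (n + j) / part_ratio n).
  rewrite /part_ratio -/(pR R _) -/(pR R _) !ln_div ?posrE ?divr_gt0//.
  by rewrite /pR; ring.
apply: le_trans (ln_norm_le rho0 (h1 _) (h1 _)) _.
rewrite mulrAC ler_wpM2r ?invr_ge0 ?(ltW rho0)//; apply: le_trans (hC n) _.
rewrite ler_wpM2l// lef_pV2 ?posrE ?exprn_gt0//; try by have := S_gt1 R n0; rewrite -/S; lra.
by have := S_gt1 R n0; rewrite -/S => s1; rewrite lerXn2r ?nnegrE//; lra.
Qed.

End PartitionKernel.

(** * Taylor expansion of the logarithm *)

Section Taylor.
Variable R : realType.

Lemma is_derive_taylor_poly (c : nat -> R) N (y : R) :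
  is_derive y 1 (fun y => \sum_(k < N.+1) c k / k`!%:R * y ^+ k)
    (\sum_(k < N) c k.+1 / k`!%:R * y ^+ k).
Proof.
pose f k (y : R) := c k / k`!%:R * y ^+ k.
pose f' k (y : R) := c k / k`!%:R * (k%:R * y ^+ k.-1).
have df k : is_derive y 1 (f k) (f' k y).
  have d1 := @is_deriveX R R id k y 1 1 (is_derive_id y 1).
  have := @is_deriveZ R R R (id ^+ k) (c k / k`!%:R) y 1 _ d1.
  rewrite /f' /GRing.scale/= mulr1.
  by rewrite (_ : _ \*: _ = f k)//; apply/funext => z; rewrite /f/= fctE.
have := is_derive_sum_fun N.+1 df; congr is_derive.
rewrite big_ord_recl /f' mul0r mulr0 add0r; apply: eq_bigr => k _.
rewrite lift0 factS natrM /=; field.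
by rewrite nat1r !pnatr_eq0 -lt0n fact_gt0.
Qed.

Lemma taylor_bound N (f : nat -> R -> R) (h B : R) : 0 <= h ->
  (forall k x, (k < N)%N -> 0 <= x <= h -> is_derive x 1 (f k) (f k.+1 x)) ->
  (forall x, 0 <= x <= h -> `|f N x| <= B) ->
  `|f 0 h - \sum_(k < N) f k 0 / k`!%:R * h ^+ k| <= B * h ^+ N.
Proof.
elim: N f h => [|N IH] f h h0 df fB.
  by rewrite big_ord0 subr0 expr0 mulr1; apply: fB; rewrite h0 lexx.
have B0 : 0 <= B by apply: le_trans (normr_ge0 _) (fB 0 _); rewrite lexx h0.
pose g y := f 0 y - \sum_(k < N.+1) f k 0 / k`!%:R * y ^+ k.
pose g' y := f 1 y - \sum_(k < N) f k.+1 0 / k`!%:R * y ^+ k.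
have dg y : 0 <= y <= h -> is_derive y 1 g (g' y).
  move=> yh; apply: is_deriveB; first exact: df.
  exact: (is_derive_taylor_poly (fun k => f k 0)).
have [c /andP[c0 ch]] := mean_value h0 dg.
have g0 : g 0 = 0.
  rewrite /g big_ord_recl big1 ?addr0 => [|i _]; last by rewrite lift0 expr0n mulr0.
  by rewrite fact0 expr0 mulr1 divr1 subrr.
rewrite g0 !subr0 -/(g h) => ->; rewrite normrM (ger0_norm h0) exprSr mulrA ler_wpM2r//.
apply: le_trans (IH (fun k => f k.+1) c c0 _ _) _.
- by move=> k x kN /andP[x0 xc]; apply: df => //; rewrite x0 (le_trans xc).
- by move=> x /andP[x0 xc]; apply: fB; rewrite x0 (le_trans xc).
by rewrite ler_wpM2l// lerXn2r ?nnegrE.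
Qed.

(** Taylor expansion of y -> e^(yx) on [0, 1], which treats both signs of x at once. *)
Lemma expR_taylor N (x : R) :
  `|expR x - \sum_(k < N) x ^+ k / k`!%:R| <= expR `|x| * `|x| ^+ N.
Proof.
have := @taylor_bound N (fun k y => x ^+ k * expR (y * x)) 1 (`|x| ^+ N * expR `|x|) ler01.
rewrite expr0 !mul1r expr1n mulr1 [X in _ <= X]mulrC => h; apply: le_trans (h _ _).
- rewrite le_eqVlt; apply/orP; left; apply/eqP; congr (`| _ - _ |).
  by apply: eq_bigr => k _; rewrite mul0r expR0 expr1n !mulr1.
- move=> k y _ _; have d1 : is_derive y 1 (fun z : R => z * x) x.
    by apply: is_derive_eq; rewrite /GRing.scale/=; ring.
  have d2 := @is_derive1_comp R expR (fun z => z * x) y _ _ (is_derive_expR _) d1.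
  have := @is_deriveZ R R R _ (x ^+ k) y 1 _ d2; rewrite /GRing.scale/=.
  by congr is_derive; rewrite exprSr; ring.
move=> y /andP[y0 y1]; rewrite normrM normrX ler_wpM2l ?exprn_ge0//.
rewrite ger0_norm ?expR_ge0// ler_expR; apply: le_trans (ler_norm _) _.
by rewrite normrM (ger0_norm y0) ler_piMl.
Qed.

End Taylor.

(** * Derivatives of the logarithm of the comparison function *)

Section LogPolynomial.
Variable R : realType.
Let a : R := pi ^+ 2 / 3.
Let S := S_ R.

(* A list of triples [(c, i, l)] stands for the function
   [\sum_(c, i, l) c * s^-i * (s - 1)^-l] of [s]. *)
Definition inv_poly := seq (R * nat * nat).
Definition inv_poly_eval (p : inv_poly) (s : R) :=
  \sum_(m <- p) m.1.1 * s^-1 ^+ m.1.2 * (s - 1)^-1 ^+ m.2.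
(* The derivative along [s' = a / s]. *)
Definition inv_poly_deriv (p : inv_poly) : inv_poly :=
  flatten [seq [:: (- (a * m.1.1 * m.1.2%:R), m.1.2.+2, m.2);
                   (- (a * m.1.1 * m.2%:R), m.1.2.+1, m.2.+1)] | m <- p].
Definition inv_poly_order N (p : inv_poly) := all (fun m => N <= m.1.2 + m.2)%N p.

(** One order comes from differentiating the monomial and one from s' = a/s. *)
Lemma inv_poly_order_deriv N p : inv_poly_order N p -> inv_poly_order N.+2 (inv_poly_deriv p).
Proof.
elim: p => //= -[[c i] l] p IH /andP[/= h hp]; rewrite IH// andbT.
by rewrite !addnS !addSn !ltnS h.
Qed.

Lemma inv_poly_bound N p : inv_poly_order N p -> exists2 C, 0 <= C &
  forall s, 2 <= s -> `|inv_poly_eval p s| <= C / s ^+ N.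
Proof.
elim: p => [_|[[c i] l] p IH /= /andP[/= h hp]].
  by exists 0 => // s _; rewrite /inv_poly_eval big_nil normr0 mul0r.
have [C C0 hC] := IH hp; exists (`|c| * 2 ^+ l + C); first by rewrite addr_ge0 ?mulr_ge0 ?exprn_ge0.
move=> s s2; have s0 : 0 < s by lra.
rewrite /inv_poly_eval big_cons /=; apply: le_trans (ler_normD _ _) _.
rewrite mulrDl lerD ?hC// !normrM -[leRHS]mulrA -mulrA ler_wpM2l//.
rewrite !ger0_norm ?exprn_ge0 ?invr_ge0//; [|lra|lra].
have v : (s - 1)^-1 <= 2 * s^-1 by rewrite ler_pdivlMr// mulrC ler_pdivrMr; lra.
apply: le_trans (_ : s^-1 ^+ i * (2 * s^-1) ^+ l <= _).
  by rewrite ler_wpM2l ?exprn_ge0 ?invr_ge0 ?(ltW s0)// lerXn2r ?nnegrE ?invr_ge0 ?mulr_ge0//;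
    rewrite ?invr_ge0; lra.
rewrite exprMn mulrCA -exprD -exprVn ler_wpM2l ?exprn_ge0// ler_wiXn2l ?invr_ge0//; first by lra.
by rewrite invf_le1//; lra.
Qed.

(** Interpolates S(n + h) for real h; for n > 0 the square root stays away from its singularity. *)
Definition shift_S n (h : R) := Num.sqrt (S n ^+ 2 + 2 * a * h).

Lemma shift_S_nat n j : (0 < n)%N -> shift_S n j%:R = S (n + j).
Proof.
move=> n0; rewrite /shift_S.
have -> : S n ^+ 2 + 2 * a * j%:R = S (n + j) ^+ 2.
  by rewrite /S !S_sq ?addn_gt0 ?n0// natrD -/a; ring.
by rewrite sqrtr_sqr ger0_norm// S_ge0.
Qed.

Lemma shift_S_ge n h : 0 <= h -> S n <= shift_S n h.
Proof.
move=> h0; have /andP[a1 _] := pi2_3_bounds R; rewrite -/a in a1.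
rewrite -[leLHS](ger0_norm (S_ge0 R n)) -sqrtr_sqr ler_wsqrtr// lerDl.
by rewrite mulr_ge0//; lra.
Qed.

Lemma is_derive_shift_S n (h : R) : (0 < n)%N -> 0 <= h ->
  is_derive h 1 (shift_S n) (a / shift_S n h).
Proof.
move=> n0 h0; have s1 := S_gt1 R n0; rewrite -/S in s1.
have s2 := shift_S_ge n h0; have s0 : 0 < shift_S n h by lra.
have d1 : is_derive h 1 (fun y : R => S n ^+ 2 + 2 * a * y) (2 * a).
  by apply: is_derive_eq; rewrite /GRing.scale/=; ring.
have p : 0 < S n ^+ 2 + 2 * a * h by rewrite -sqrtr_gt0.
have := @is_derive1_comp R Num.sqrt (fun y => S n ^+ 2 + 2 * a * y) h _ _ (is_derive1_sqrt p) d1.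
by congr is_derive; rewrite -/(shift_S n h); field; rewrite gt_eqF.
Qed.

Lemma is_derive_inv_poly p n (h : R) : (0 < n)%N -> 0 <= h ->
  is_derive h 1 (fun y => inv_poly_eval p (shift_S n y))
    (inv_poly_eval (inv_poly_deriv p) (shift_S n h)).
Proof.
move=> n0 h0; have s1 := S_gt1 R n0; rewrite -/S in s1.
have s2 := shift_S_ge n h0; have s0 : 0 < shift_S n h by lra.
have ds := is_derive_shift_S n0 h0.
have ds1 : is_derive h 1 (fun y => shift_S n y - 1) (a / shift_S n h).
  have := is_deriveB ds (@is_derive_cst R R R 1 h 1); rewrite subr0; congr is_derive.
have z0 : shift_S n h != 0 by rewrite gt_eqF.
have z1 : shift_S n h - 1 != 0 by rewrite gt_eqF//; lra.
have dT := @is_deriveV R (shift_S n) h _ 1 z0 ds.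
have dV := @is_deriveV R (fun y => shift_S n y - 1) h _ 1 z1 ds1.
rewrite /= in dT dV.
elim: p => [|[[c i] l] p IH].
  rewrite /inv_poly_eval big_nil; under eq_fun => y do rewrite big_nil.
  exact: is_derive_cst.
have -> : (fun y => inv_poly_eval ((c, i, l) :: p) (shift_S n y)) =
    (fun y => c * ((shift_S n y)^-1 ^+ i * (shift_S n y - 1)^-1 ^+ l) +
              inv_poly_eval p (shift_S n y)).
  by apply/funext => y; rewrite /inv_poly_eval big_cons/= mulrA.
have -> : inv_poly_eval (inv_poly_deriv ((c, i, l) :: p)) (shift_S n h) =
   c * (i%:R * - a * (shift_S n h)^-1 ^+ i.+2 * (shift_S n h - 1)^-1 ^+ l +
        l%:R * - a * (shift_S n h)^-1 ^+ i.+1 * (shift_S n h - 1)^-1 ^+ l.+1) +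
   inv_poly_eval (inv_poly_deriv p) (shift_S n h).
  by rewrite /inv_poly_eval !big_cons/=; ring.
apply: is_deriveD.
have dTi := @is_deriveX R R _ i h 1 _ dT; have dVl := @is_deriveX R R _ l h 1 _ dV.
have dM := @is_deriveM R R _ _ h 1 _ _ dTi dVl.
have := @is_deriveZ R R R _ c h 1 _ dM; rewrite /GRing.scale/=.
rewrite (_ : _ \*: _ = (fun y => c * ((shift_S n y)^-1 ^+ i * (shift_S n y - 1)^-1 ^+ l))).
  congr is_derive; rewrite !fctE; move: (shift_S n h) z0 z1 => s z0 z1.
  rewrite -!exprVn; move: s^-1 (s - 1)^-1 => T V.
  by case: i {dTi dM} => [|i]; case: l {dVl} => [|l] /=; rewrite ?exprS; ring.
by apply/funext => y /=; rewrite !fctE.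
Qed.

Definition log_phi n (h : R) := ln (saddle_phi (shift_S n h)).
(** The logarithmic derivative (a/s)(1 + 1/(s-1) - 3/s) of phi along s' = a/s, simplified to a/(s-1)
    - 3a/s^2. *)
Definition dlog_phi : inv_poly := [:: (a, 0%N, 1%N); (- (3 * a), 2%N, 0%N)].

Lemma is_derive_log_phi n (h : R) : (0 < n)%N -> 0 <= h ->
  is_derive h 1 (log_phi n) (inv_poly_eval dlog_phi (shift_S n h)).
Proof.
move=> n0 h0; have s1 := S_gt1 R n0; rewrite -/S in s1.
have s2 := shift_S_ge n h0; have s0 : 0 < shift_S n h by lra.
have ds := is_derive_shift_S n0 h0.
have sm : 0 < shift_S n h - 1 by lra.
have ph : 0 < saddle_phi (shift_S n h) by apply: saddle_phi_gt0; lra.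
have z0 : shift_S n h != 0 by rewrite gt_eqF.
have z1 : shift_S n h - 1 != 0 by rewrite gt_eqF.
have dE := @is_derive1_comp R expR (shift_S n) h _ _ (is_derive_expR _) ds.
have ds1 : is_derive h 1 (fun y => shift_S n y - 1) (a / shift_S n h).
  have := is_deriveB ds (@is_derive_cst R R R 1 h 1); rewrite subr0; congr is_derive.
have dV := @is_deriveV R (shift_S n) h _ 1 z0 ds.
have dV3 := @is_deriveX R R _ 3 h 1 _ dV.
have dM := @is_deriveM R R _ _ h 1 _ _ (@is_deriveM R R _ _ h 1 _ _ dE ds1) dV3.
rewrite (_ : (_ * _ * _)%R = (fun y => saddle_phi (shift_S n y))) in dM; last first.
  by apply/funext => y; rewrite /saddle_phi !fctE exprVn.
have := @is_derive1_comp R (@ln R) (fun y => saddle_phi (shift_S n y)) h _ _ (is_derive1_ln ph) dM.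
congr is_derive; rewrite /inv_poly_eval /dlog_phi !big_cons big_nil /= !fctE /GRing.scale/=.
rewrite /saddle_phi; move: (shift_S n h) s0 z0 z1 => s s0 z0 z1.
move: (expR s) (expR_gt0 s) => E E0.
by field; rewrite z0 z1 gt_eqF.
Qed.

Definition log_phi_deriv k := iter k inv_poly_deriv dlog_phi.

Lemma log_phi_deriv_order k : inv_poly_order k.*2.+1 (log_phi_deriv k).
Proof. by elim: k => [//|k IH]; rewrite doubleS; exact: inv_poly_order_deriv. Qed.

(** The index is shifted because [log_phi_deriv 0] is already the first derivative. *)
Definition taylor_coef k n : R := inv_poly_eval (log_phi_deriv k.-1) (S n) / k`!%:R.

Lemma sdecayD K (f g : nat -> R) : sdecay K f -> sdecay K g -> sdecay K (fun n => f n + g n).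
Proof.
move=> [C C0 [n1 h1]] [D D0 [n2 h2]]; exists (C + D); first exact: addr_ge0.
exists (maxn n1 n2) => n; rewrite geq_max => /andP[nn1 nn2].
by rewrite mulrDl; apply: le_trans (ler_normD _ _) (lerD (h1 n nn1) (h2 n nn2)).
Qed.

Lemma sdecayZ K (c : R) (f : nat -> R) : sdecay K f -> sdecay K (fun n => c * f n).
Proof.
move=> [C C0 [n1 h1]]; exists (`|c| * C); first exact: mulr_ge0.
by exists n1 => n nn1; rewrite normrM -mulrA ler_wpM2l// h1.
Qed.

Lemma eq_sdecay K (f g : nat -> R) n0 : (forall n, (n0 <= n)%N -> f n = g n) -> sdecay K f -> sdecay K g.
Proof.
move=> fg [C C0 [n1 h1]]; exists C => //; exists (maxn n0 n1) => n.
by rewrite geq_max => /andP[nn0 nn1]; rewrite -fg// h1.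
Qed.

Lemma sdecay_inv_poly N p : inv_poly_order N p -> sdecay N (fun n => inv_poly_eval p (S n)).
Proof.
move=> /inv_poly_bound[C C0 hC]; have [n0 h0] := S_large (2 : R).
by exists C => //; exists n0 => n nn0; apply/hC/h0.
Qed.

Lemma taylor_coef_decay k : (0 < k)%N -> sdecay (k.*2.-1) (taylor_coef k).
Proof.
case: k => // k _; rewrite doubleS /=.
have := sdecayZ (k.+1`!%:R^-1) (sdecay_inv_poly (log_phi_deriv_order k)).
by apply: (@eq_sdecay _ _ _ 0) => n _; rewrite /taylor_coef mulrC.
Qed.

Lemma log_phi_taylor m j : sdecay m.*2.+1 (fun n =>
  ln (saddle_phi (S (n + j))) - ln (saddle_phi (S n)) -
  \sum_(1 <= k < m.+1) taylor_coef k n * j%:R ^+ k).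
Proof.
have [C C0 hC] := inv_poly_bound (log_phi_deriv_order m); have [n1 h1] := S_large (2 : R).
exists (C * j%:R ^+ m.+1); first by rewrite mulr_ge0 ?exprn_ge0.
exists (maxn 1 n1) => n; rewrite geq_max => /andP[n0 nn1].
have s2 := h1 n nn1; rewrite -/S in s2.
have S00 : shift_S n 0 = S n by have := shift_S_nat 0 n0; rewrite addn0.
pose f k (y : R) := if k is k'.+1 then inv_poly_eval (log_phi_deriv k') (shift_S n y)
  else log_phi n y.
have := @taylor_bound R m.+1 f j%:R (C / S n ^+ m.*2.+1) (ler0n _ j).
rewrite big_ord_recl fact0 divr1 expr0 mulr1 /= => h.
rewrite big_add1 /= big_mkord [leRHS]mulrAC.
apply: le_trans (h _ _).
- rewrite /log_phi shift_S_nat// S00 opprD addrA le_eqVlt; apply/orP; left; apply/eqP.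
  by congr (`| _ - _ |).
- move=> [|k] y _ /andP[y0 _]; first exact: is_derive_log_phi.
  by rewrite /f /=; exact: is_derive_inv_poly.
move=> y /andP[y0 _]; rewrite /f.
have sy := shift_S_ge n y0; apply: le_trans (hC _ (le_trans s2 sy)) _.
have s0 : 0 < S n by lra.
rewrite ler_wpM2l// lef_pV2 ?posrE ?exprn_gt0 ?(lt_le_trans s0)//.
by rewrite lerXn2r ?nnegrE ?(ltW s0) ?(le_trans (ltW s0)).
Qed.

Lemma taylor_coef1 n : taylor_coef 1 n = A_ R n.
Proof.
rewrite /taylor_coef /A_ /inv_poly_eval /= /dlog_phi !big_cons big_nil /= -/a -/(S n).
by rewrite -exprVn divr1; move: (S n)^-1 (S n - 1)^-1 => u v; ring.
Qed.

(** The bound 12 comes from 1/(2s^3) - 3/s^4 >= 1/(4s^3). It makes the argument of the square root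
    in [delta_] positive, of order s^-3. *)
Lemma delta_sq_ge n : 12 <= S n -> a ^+ 2 / (4 * S n ^+ 3) <=
  a ^+ 2 * ((2 * S n * (S n - 1) ^+ 2)^-1 - 3 / S n ^+ 4).
Proof.
move: (S n) => s s12; rewrite ler_wpM2l ?sqr_ge0//.
apply: le_trans (_ : (2 * s * s ^+ 2)^-1 - 3 / s ^+ 4 <= _).
  rewrite -subr_ge0 (_ : _ - _ = (s - 12) / (4 * s ^+ 4)).
    by rewrite divr_ge0 ?mulr_ge0 ?exprn_ge0//; lra.
  by field; rewrite gt_eqF//; lra.
rewrite lerD2r lef_pV2 ?posrE ?mulr_gt0 ?exprn_gt0//; try lra.
by rewrite ler_pM2l; [rewrite lerXn2r ?nnegrE; lra | lra].
Qed.

Lemma delta_sqE n : 12 <= S n ->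
  delta_ R n ^+ 2 = a ^+ 2 * ((2 * S n * (S n - 1) ^+ 2)^-1 - 3 / S n ^+ 4).
Proof.
move=> s12; have := delta_sq_ge s12; have a1 := a_ge1 R; rewrite -/a in a1.
rewrite /delta_ -/a -/(S n) => h; rewrite [LHS]exprMn sqr_sqrtr//.
rewrite -(@pmulr_rge0 _ (a ^+ 2)) ?exprn_gt0//; last by lra.
by apply: le_trans h; rewrite divr_ge0 ?sqr_ge0// mulr_ge0 ?exprn_ge0//; lra.
Qed.

Lemma taylor_coef2 n : 12 <= S n -> taylor_coef 2 n = - delta_ R n ^+ 2.
Proof.
move=> s12; rewrite delta_sqE// /taylor_coef /inv_poly_eval /= !big_cons big_nil /=.
rewrite (_ : 2`! = 2)%N//; move: (S n) a s12 => s b s12; field.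
by rewrite !gt_eqF//; lra.
Qed.

Lemma delta_gt0 n : 12 <= S n -> 0 < delta_ R n.
Proof.
move=> s12; have h := delta_sq_ge s12; rewrite -delta_sqE// in h.
have a1 := a_ge1 R; rewrite -/a in a1.
have : 0 < delta_ R n ^+ 2.
  have s0 : 0 < S n by lra.
  apply: lt_le_trans h; apply: divr_gt0; last exact: mulr_gt0 (ltr0n _ 4) (exprn_gt0 3 s0).
  by apply: exprn_gt0; lra.
have : 0 <= delta_ R n by rewrite /delta_ -/a mulr_ge0 ?sqrtr_ge0//; lra.
by rewrite le_eqVlt => /orP[/eqP <-|//]; rewrite expr0n ltxx.
Qed.

Lemma cvg_S_inv : (fun n => (S n)^-1) @ \oo --> (0 : R).
Proof.
apply/cvgrPdist_le => e e0; have [n0 h0] := S_large (e^-1).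
exists (maxn n0 1) => // n /=; rewrite geq_max => /andP[nn0 n1].
have s1 := S_gt1 R n1; rewrite -/S in s1; have s0 : 0 < S n by lra.
rewrite sub0r normrN gtr0_norm ?invr_gt0// -[leRHS]invrK lef_pV2 ?posrE ?invr_gt0//.
exact: h0.
Qed.

Lemma sdecay_cvg0 K (f : nat -> R) : (0 < K)%N -> sdecay K f -> f @ \oo --> (0 : R).
Proof.
move=> K0 [C C0 [n0 h]].
have hC : (fun n => C * (S n)^-1) @ \oo --> (0 : R).
  rewrite -[X in _ --> X](mulr0 C); apply: cvgM; [exact: cvg_cst|exact: cvg_S_inv].
apply: norm_cvg0; apply: (squeeze_cvgr _ (cvg_cst 0) hC).
exists (maxn n0 1) => // n /=; rewrite geq_max => /andP[nn0 n1].
have s1 := S_gt1 R n1; rewrite -/S in s1.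
rewrite normr_ge0; apply: le_trans (h n nn0) _.
by have := @decay_weaken R C (S n) 1 K; rewrite expr1; apply => //; lra.
Qed.

Lemma sqr_cvg0 (u : nat -> R) : (fun n => u n ^+ 2) @ \oo --> (0 : R) -> u @ \oo --> (0 : R).
Proof.
move=> /cvgrPdist_le h; apply/cvgrPdist_le => e e0.
apply: filterS (h (e ^+ 2) (exprn_gt0 2 e0)) => n /=.
by rewrite !sub0r !normrN normrX ler_sqr ?nnegrE// ltW.
Qed.

Lemma power_quotient (C s b : R) N k : 0 < s -> 0 < b ->
  (C / s ^+ N) ^+ 2 / (b ^+ 2 / (4 * s ^+ 3)) ^+ k =
  C ^+ 2 * (4 / b ^+ 2) ^+ k / s ^+ (2 * N) * s ^+ (3 * k).
Proof.
move=> s0 b0; rewrite !expr_div_n [(4 * _) ^+ k]exprMn -!exprM (mulnC N).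
have e1 : s ^+ (2 * N) != 0 by rewrite expf_neq0// gt_eqF.
have e2 : s ^+ (3 * k) != 0 by rewrite expf_neq0// gt_eqF.
have e3 : b ^+ (2 * k) != 0 by rewrite expf_neq0// gt_eqF.
have e4 : 4 ^+ k != 0 :> R by rewrite expf_neq0// pnatr_eq0.
move: (s ^+ _) (s ^+ _) (b ^+ _) (4 ^+ k) e1 e2 e3 e4 => u v w x e1 e2 e3 e4.
by field; rewrite e1 e2 e3 e4.
Qed.

(** [delta_] is at least of order S^(-3/2), so S^-N wins over delta^k when 2N > 3k; squaring keeps
    the exponents integral. *)
Lemma sdecay_div_delta N k (f : nat -> R) : (3 * k < 2 * N)%N -> sdecay N f ->
  (fun n => f n / delta_ R n ^+ k) @ \oo --> (0 : R).
Proof.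
move=> kN [C C0 [n0 h]]; have a1 := a_ge1 R; rewrite -/a in a1.
have a0 : 0 < a by lra.
pose c := (4 / a ^+ 2) ^+ k.
have hC : sdecay 1 (fun n => (f n / delta_ R n ^+ k) ^+ 2).
  have [n1 h1] := S_large (12 : R); exists (C ^+ 2 * c).
    by rewrite mulr_ge0 ?exprn_ge0// divr_ge0 ?sqr_ge0.
  exists (maxn n0 n1) => n; rewrite geq_max => /andP[nn0 nn1].
  have s12 := h1 n nn1; rewrite -/S in s12; have s0 : 0 < S n by lra.
  have d0 := delta_gt0 s12.
  have hd : a ^+ 2 / (4 * S n ^+ 3) <= delta_ R n ^+ 2 by rewrite delta_sqE//; exact: delta_sq_ge.
  have hf : f n ^+ 2 <= (C / S n ^+ N) ^+ 2.
    by rewrite -[leLHS]real_normK ?num_real// lerXn2r ?nnegrE ?h// divr_ge0// exprn_ge0// ltW.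
  have q0 : 0 < a ^+ 2 / (4 * S n ^+ 3).
    by apply: divr_gt0; [exact: exprn_gt0|exact: mulr_gt0 (ltr0n _ 4) (exprn_gt0 3 s0)].
  rewrite normrX (ger0_norm (sqr_ge0 _)) || rewrite ger0_norm ?sqr_ge0//.
  rewrite expr_div_n -exprM mulnC exprM.
  apply: le_trans (_ : (C / S n ^+ N) ^+ 2 / (a ^+ 2 / (4 * S n ^+ 3)) ^+ k <= _).
    apply: ler_pM; rewrite ?sqr_ge0 ?invr_ge0 ?exprn_ge0 ?(ltW d0)//.
    by rewrite lef_pV2 ?posrE ?exprn_gt0// lerXn2r ?nnegrE ?(ltW q0) ?sqr_ge0.
  have -> : (C / S n ^+ N) ^+ 2 / (a ^+ 2 / (4 * S n ^+ 3)) ^+ k =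
      C ^+ 2 * c / S n ^+ (2 * N) * S n ^+ (3 * k).
    exact: power_quotient.
  apply: decay_mul_le; [|lra|by rewrite addn1].
  by rewrite mulr_ge0 ?exprn_ge0// divr_ge0 ?sqr_ge0.
exact: sqr_cvg0 (sdecay_cvg0 (ltn0Sn 0) hC).
Qed.

Lemma delta_cvg0 : delta_ R @ \oo --> (0 : R).
Proof.
have h : sdecay 2 (fun n => delta_ R n ^+ 2).
  have hh := sdecayZ (-1) (taylor_coef_decay (isT : 0 < 2)%N).
  have [n1 h1] := S_large (12 : R).
  have [C C0 [n0 h]] : sdecay 3 (fun n => delta_ R n ^+ 2).
    by apply: (@eq_sdecay _ _ _ n1 _ hh) => n nn1; rewrite /= taylor_coef2; [ring|exact: h1].
  exists C => //; exists (maxn n0 1) => n; rewrite geq_max => /andP[nn0 n1'].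
  by apply: le_trans (h n nn0) _; apply: decay_weaken => //; exact: ltW (S_gt1 R n1').
exact: sqr_cvg0 (sdecay_cvg0 (ltn0Sn 1) h).
Qed.

Theorem pR_log_polynomial m : (2 <= m)%N -> log_polynomial m (@pR R) (@A_ R) (-1) (@delta_ R).
Proof.
move=> m2; have [n1 h1] := S_large (12 : R).
split=> //; split; first by right.
split; first by move=> n; rewrite ltr0n npart_gt0.
split; first by exists n1 => // n /= nn1; apply: delta_gt0; exact: h1.
split; first exact: delta_cvg0.
exists taylor_coef; split=> [k /andP[k3 _]|j /andP[j1 jm]].
  (* 3k < 2(2k - 1) holds exactly from k = 3 on. *)
  apply: (@sdecay_div_delta k.*2.-1); first by lia.
  by apply: taylor_coef_decay; lia.
(* 3(m + 1) < 2(2m + 1) holds exactly from m = 2 on. *)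
apply: (@sdecay_div_delta m.*2.+1); first by lia.
have := sdecayD (npart_log_ratio R j m.*2.+1) (log_phi_taylor m j).
apply: (@eq_sdecay _ _ _ n1) => n nn1; have s12 := h1 n nn1.
rewrite (@big_cat_nat _ _ _ 3 1 m.+1)//=.
rewrite big_nat_recr//= big_nat1 taylor_coef1 taylor_coef2// expr1.
by move: (\sum_(3 <= k < m.+1) _) => X; rewrite /S; ring.
Qed.

End LogPolynomial.

(** * From logarithmic expansions to Hermite polynomials *)

Section SequenceLimits.
Variable R : realType.
Implicit Types (u v : nat -> R) (l : R).

Lemma near_cvg_seq u v l : (\forall n \near \oo, u n = v n) -> u @ \oo --> l -> v @ \oo --> l.
Proof. by move=> uv; apply: cvg_trans; exact: near_eq_cvg. Qed.

Lemma eq_cvg_seq u v l : (forall n, u n = v n) -> u @ \oo --> l -> v @ \oo --> l.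
Proof. by move=> /funext ->. Qed.

Lemma cvg_sum_seq D (f : nat -> nat -> R) (l : nat -> R) :
  (forall k, (k < D)%N -> f k @ \oo --> l k) ->
  (fun n => \sum_(k < D) f k n) @ \oo --> (\sum_(k < D) l k : R).
Proof.
elim: D => [|D IH] h.
  by rewrite big_ord0; apply: (@eq_cvg_seq (fun=> 0)) => [n|]; [rewrite big_ord0|exact: cvg_cst].
rewrite big_ord_recr /=.
apply: (@eq_cvg_seq (fun n => \sum_(k < D) f k n + f D n)) => [n|]; first by rewrite big_ord_recr.
by apply: cvgD; [apply: IH => k kD; apply: h; exact: ltnW | exact: h].
Qed.

Lemma cvg_pow_seq u l k : u @ \oo --> l -> (fun n => u n ^+ k) @ \oo --> (l ^+ k : R).
Proof.
move=> ul; elim: k => [|k IH].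
  by apply: (@eq_cvg_seq (fun=> 1)) => [n|]; [rewrite expr0 | rewrite expr0; exact: cvg_cst].
rewrite exprS; apply: (@eq_cvg_seq (fun n => u n * u n ^+ k)) => [n|]; first by rewrite exprS.
exact: cvgM.
Qed.

Lemma cvgM_seq u v l l' : u @ \oo --> l -> v @ \oo --> l' -> (fun n => u n * v n) @ \oo --> (l * l' : R).
Proof. by move=> h1 h2; exact: cvgM. Qed.

Lemma cvgD_seq u v l l' : u @ \oo --> l -> v @ \oo --> l' -> (fun n => u n + v n) @ \oo --> (l + l' : R).
Proof. by move=> h1 h2; exact: cvgD. Qed.

Lemma cvgZ_seq (c : R) u l : u @ \oo --> l -> (fun n => c * u n) @ \oo --> (c * l : R).
Proof. by move=> h; apply: cvgM_seq h; exact: cvg_cst. Qed.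

End SequenceLimits.

(** * Finite differences of powers *)

Section FiniteDifference.
Variable R : comPzRingType.

Definition fdiff e (f : nat -> R) := \sum_(i < e.+1) (-1) ^+ (e - i) * 'C(e, i)%:R * f i.

Lemma fdiffM_nat e f : fdiff e.+1 (fun i => i%:R * f i) = e.+1%:R * fdiff e (fun i => f i.+1).
Proof.
rewrite /fdiff big_ord_recl /= mul0r mulr0 add0r mulr_sumr; apply: eq_bigr => i _.
rewrite /bump leq0n add1n subSS; have h := mul_bin_diag e.+1 i; rewrite /= in h.
have {}h : e.+1%:R * 'C(e, i)%:R = i.+1%:R * 'C(e.+1, i.+1)%:R :> R by rewrite -!natrM h.
transitivity ((-1) ^+ (e - i) * (i.+1%:R * 'C(e.+1, i.+1)%:R) * f i.+1); first by ring.
by rewrite -h; ring.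
Qed.

(** The base point [x] is carried along because splitting off one factor x + i lowers the order and
    moves the base point to x + 1. *)
Lemma fdiff_pow e k (x : nat) : (k <= e)%N ->
  fdiff e (fun i => (x + i)%:R ^+ k) = if k == e then e`!%:R else 0.
Proof.
elim: k e x => [|k IH] e x ke.
  rewrite /fdiff; under eq_bigr => i _ do rewrite expr0 mulr1 -[_ * _]mulr1 -[X in _ * X](expr1n R i) -mulrA mulr_natl mulrnAr.
  rewrite -exprDn addNr expr0n eq_sym; by case: e {ke}.
case: e ke => // e ke; have e1 : fdiff e.+1 (fun i => (x + i)%:R ^+ k.+1) =
   x%:R * fdiff e.+1 (fun i => (x + i)%:R ^+ k) + e.+1%:R * fdiff e (fun i => (x.+1 + i)%:R ^+ k).
  have -> : fdiff e (fun i => (x.+1 + i)%:R ^+ k) = fdiff e (fun i => (x + i.+1)%:R ^+ k).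
    by apply: eq_bigr => i _; rewrite addSnnS.
  rewrite -(fdiffM_nat e (fun i => (x + i)%:R ^+ k)) /fdiff mulr_sumr -big_split /=; apply: eq_bigr => i _.
  by rewrite exprS natrD; ring.
rewrite e1 (IH e.+1 x (leqW ke)) (IH e x.+1 ke) (ltn_eqF ke) mulr0 add0r.
change (k.+1 == e.+1) with (k == e).
by case: eqP => _; rewrite ?mulr0// factS natrM.
Qed.

Lemma fdiffD e f g : fdiff e (fun i => f i + g i) = fdiff e f + fdiff e g.
Proof. by rewrite /fdiff -big_split; apply: eq_bigr => i _ /=; rewrite mulrDr. Qed.

Lemma fdiffZ e c f : fdiff e (fun i => c * f i) = c * fdiff e f.
Proof. by rewrite /fdiff mulr_sumr; apply: eq_bigr => i _ /=; ring. Qed.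

Lemma fdiff_sum e D (f : nat -> nat -> R) :
  fdiff e (fun i => \sum_(k < D) f k i) = \sum_(k < D) fdiff e (f k).
Proof.
rewrite /fdiff exchange_big /=; apply: eq_bigr => i _; exact: mulr_sumr.
Qed.

End FiniteDifference.

(** * Asymptotic polynomials in delta *)

Section Jets.
Variables (R : realType) (delta : nat -> R).
Hypothesis delta_gt0 : \forall n \near \oo, 0 < delta n.
Hypothesis delta_cvg0 : delta @ \oo --> (0 : R).

Definition jet d (P : {poly R}) (E : nat -> nat -> R) :=
  exists D (Q : nat -> {poly R}), [/\ forall n, (size (Q n) <= D.+1)%N,
    forall k, (fun n => (Q n)`_k) @ \oo --> (P`_k : R) &
    forall x, (x <= d)%N ->
      (fun n => (E x n - (Q n).[delta n * x%:R]) / delta n ^+ d) @ \oo --> (0 : R)].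

Lemma horner_cvg D (Q : nat -> {poly R}) (P : {poly R}) x : (forall n, (size (Q n) <= D.+1)%N) ->
  (forall k, (fun n => (Q n)`_k) @ \oo --> (P`_k : R)) ->
  (fun n => (Q n).[delta n * x%:R]) @ \oo --> (P`_0 : R).
Proof.
move=> sQ cQ.
apply: (@eq_cvg_seq _ (fun n => \sum_(k < D.+1) (Q n)`_k * (delta n * x%:R) ^+ k)).
  by move=> n; rewrite (horner_coef_wide _ (sQ n)).
rewrite (_ : P`_0 = \sum_(k < D.+1) P`_k * (0 * x%:R) ^+ k); last first.
  rewrite big_ord_recl expr0 mulr1 big1 ?addr0// => k _.
  by rewrite lift0 mul0r expr0n mulr0.
apply: (@cvg_sum_seq _ D.+1 (fun k n => (Q n)`_k * (delta n * x%:R) ^+ k)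
   (fun k => P`_k * (0 * x%:R) ^+ k)) => k _.
apply: cvgM_seq => //; apply: cvg_pow_seq; apply: cvgM_seq => //; exact: cvg_cst.
Qed.

Lemma jet_cvg d P E x : jet d P E -> (x <= d)%N -> (fun n => E x n) @ \oo --> (P`_0 : R).
Proof.
move=> [D [Q [sQ cQ hE]]] xd.
have h1 := cvgD_seq (cvgM_seq (hE x xd) (cvg_pow_seq (k := d) delta_cvg0)) (horner_cvg x sQ cQ).
rewrite mul0r add0r in h1; apply: near_cvg_seq h1.
by apply: filterS delta_gt0 => n dn; rewrite divfK ?subrK// expf_neq0// gt_eqF.
Qed.

Lemma jet_perturb d P E F : jet d P E ->
  (forall x, (x <= d)%N -> (fun n => (F x n - E x n) / delta n ^+ d) @ \oo --> (0 : R)) -> jet d P F.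
Proof.
move=> [D [Q [sQ cQ hE]]] h; exists D, Q; split=> // x xd.
have := cvgD_seq (h x xd) (hE x xd); rewrite addr0; apply: eq_cvg_seq => n; ring.
Qed.

Lemma jet_cst d (c : R) : jet d c%:P (fun _ _ => c).
Proof.
exists 0%N, (fun=> c%:P); split=> [n|k|x _]; first by rewrite size_polyC leq_b1.
  exact: cvg_cst.
by apply: (@eq_cvg_seq _ (fun=> 0)) => [n|]; [rewrite hornerC subrr mul0r|exact: cvg_cst].
Qed.

Lemma jetD d P1 P2 E1 E2 : jet d P1 E1 -> jet d P2 E2 -> jet d (P1 + P2) (fun x n => E1 x n + E2 x n).
Proof.
move=> [D1 [Q1 [s1 c1 h1]]] [D2 [Q2 [s2 c2 h2]]].
exists (maxn D1 D2), (fun n => Q1 n + Q2 n); split=> [n|k|x xd].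
- apply: leq_trans (size_polyD _ _) _; rewrite -maxnSS geq_max.
  by rewrite (leq_trans (s1 n)) ?leq_maxl// (leq_trans (s2 n)) ?leq_maxr.
- by rewrite coefD; apply: eq_cvg_seq (cvgD_seq (c1 k) (c2 k)) => n; rewrite coefD.
have := cvgD_seq (h1 x xd) (h2 x xd); rewrite addr0; apply: eq_cvg_seq => n.
by rewrite hornerD; ring.
Qed.

Lemma jetM d P1 P2 E1 E2 : jet d P1 E1 -> jet d P2 E2 -> jet d (P1 * P2) (fun x n => E1 x n * E2 x n).
Proof.
move=> j1 j2; have [D1 [Q1 [s1 c1 h1]]] := j1; have [D2 [Q2 [s2 c2 h2]]] := j2.
exists (D1 + D2)%N, (fun n => Q1 n * Q2 n); split=> [n|k|x xd].
- apply: leq_trans (size_polyMleq _ _) _; have := s1 n; have := s2 n.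
  by move: (size _) (size _) => a b; clear; lia.
- rewrite coefM; apply: (@eq_cvg_seq _ (fun n => \sum_(j < k.+1) (Q1 n)`_j * (Q2 n)`_(k - j))).
    by move=> n; rewrite coefM.
  apply: (@cvg_sum_seq _ k.+1 (fun j n => (Q1 n)`_j * (Q2 n)`_(k - j)) (fun j => P1`_j * P2`_(k - j))).
  by move=> j _; exact: cvgM_seq.
have := cvgD_seq (cvgM_seq (jet_cvg j1 xd) (h2 x xd))
  (cvgM_seq (h1 x xd) (horner_cvg x s2 c2)).
rewrite mulr0 mul0r addr0; apply: eq_cvg_seq => n.
by rewrite hornerM; ring.
Qed.

Lemma jetX d P E k : jet d P E -> jet d (P ^+ k) (fun x n => E x n ^+ k).
Proof.
move=> h; elim: k => [|k IH].
  by have := @jet_cst d 1; rewrite polyC1 expr0; congr jet.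
have := jetM h IH; rewrite exprS; congr jet; apply/funext => x; apply/funext => n.
by rewrite exprS.
Qed.

Lemma jet_sum d N (P : nat -> {poly R}) (E : nat -> nat -> nat -> R) :
  (forall i, jet d (P i) (E i)) ->
  jet d (\sum_(i < N) P i) (fun x n => \sum_(i < N) E i x n).
Proof.
move=> h; elim: N => [|N IH].
  have := @jet_cst d 0; rewrite polyC0 big_ord0; congr jet; apply/funext => x; apply/funext => n.
  by rewrite big_ord0.
have := jetD IH (h N); rewrite big_ord_recr; congr jet; apply/funext => x; apply/funext => n.
by rewrite big_ord_recr.
Qed.

(** As [L] is O(delta), cutting the exponential series after degree d leaves O(delta^(d+1)). *)
Lemma jet_exp d P L : jet d P L ->
  (forall x, (x <= d)%N -> exists l : R, (fun n => L x n / delta n) @ \oo --> l) ->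
  jet d (\sum_(i < d.+1) (i`!%:R^-1)%:P * P ^+ i) (fun x n => expR (L x n)).
Proof.
move=> jL hL.
have jT : jet d (\sum_(i < d.+1) (i`!%:R^-1)%:P * P ^+ i)
    (fun x n => \sum_(i < d.+1) i`!%:R^-1 * L x n ^+ i).
  apply: (@jet_sum d d.+1 (fun i => (i`!%:R^-1)%:P * P ^+ i) (fun i x n => i`!%:R^-1 * L x n ^+ i)).
  by move=> i; apply: jetM (jetX i jL); exact: jet_cst.
apply: (jet_perturb jT) => x xd; have [l hl] := hL x xd.
have L0 : (fun n => L x n) @ \oo --> (0 : R).
  have := cvgM_seq hl delta_cvg0; rewrite mulr0; apply: near_cvg_seq.
  by apply: filterS delta_gt0 => n dn; rewrite divfK// gt_eqF.
have hb : (fun n => expR 1 * (`|L x n / delta n| ^+ d.+1 * delta n)) @ \oo --> (0 : R).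
  rewrite -[X in _ --> X](mulr0 (expR 1)) -[X in _ * X](mulr0 (`|l| ^+ d.+1)).
  apply: cvgM_seq; first exact: cvg_cst.
  by apply: cvgM_seq => //; apply: cvg_pow_seq; exact: cvg_norm.
apply: norm_cvg0; apply: (squeeze_cvgr _ (cvg_cst 0) hb).
have L1 : \forall n \near \oo, `|L x n| <= 1.
  move/cvgrPdist_le: L0 => /(_ 1 ltr01); apply: filterS => n /=.
  by rewrite sub0r normrN.
apply: filterS2 delta_gt0 L1 => n dn l1; rewrite normr_ge0 /=.
have dd : 0 < delta n ^+ d by rewrite exprn_gt0.
rewrite normrM [X in _ * X]ger0_norm ?invr_ge0 ?(ltW dd)// ler_pdivrMr//.
have h := expR_taylor d.+1 (L x n).
rewrite (eq_bigr (fun k : 'I_d.+1 => (k`!%:R)^-1 * L x n ^+ k)) in h; last by move=> i _; rewrite mulrC.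
apply: le_trans h _.
have -> : expR 1 * (`|L x n / delta n| ^+ d.+1 * delta n) * delta n ^+ d =
   expR 1 * (`|L x n / delta n| * delta n) ^+ d.+1 by rewrite exprMn !exprS; ring.
rewrite normrM [X in _ * X * _]ger0_norm ?invr_ge0 ?(ltW dn)// divfK ?gt_eqF//.
by rewrite ler_wpM2r ?exprn_ge0// ler_expR.
Qed.

Lemma jet_fdiff d P E e x : jet d P E -> (x + e <= d)%N ->
  (fun n => fdiff e (fun i => E (x + i)%N n) / delta n ^+ e) @ \oo --> (e`!%:R * P`_e : R).
Proof.
move=> [D [Q [sQ cQ hE]]] xed; have ed : (e <= d)%N by apply: leq_trans xed; exact: leq_addl.
pose fd k := fdiff e (fun i => (x + i)%:R ^+ k) : R.
(* Degrees below e are removed before the division by delta^e; they would bring in negative powers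
   of [delta]. *)
pose main n := \sum_(k < (D + e).+1) (Q n)`_k * ((if (k < e)%N then 0 else delta n ^+ (k - e)) * fd k).
have hmain : main @ \oo --> (e`!%:R * P`_e : R).
  rewrite (_ : _ * _ = \sum_(k < (D + e).+1) P`_k * ((if (k < e)%N then 0 else 0 ^+ (k - e)) * fd k)).
    apply: (@cvg_sum_seq _ _ (fun k n => (Q n)`_k * ((if (k < e)%N then 0 else delta n ^+ (k - e)) * fd k))
      (fun k => P`_k * ((if (k < e)%N then 0 else 0 ^+ (k - e)) * fd k))) => k _.
    apply: cvgM_seq => //; apply: cvgM_seq; last exact: cvg_cst.
    by case: ifP => _; [exact: cvg_cst | exact: cvg_pow_seq].
  have eD : (e < (D + e).+1)%N by rewrite ltnS leq_addl.
  rewrite (bigD1 (Ordinal eD))//= ltnn subnn expr0 mul1r /fd fdiff_pow// eqxx big1 ?addr0 1?mulrC//.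
  move=> k /eqP ke; case: ltnP => ke'; first by rewrite mul0r mulr0.
  have : (e < k)%N by rewrite ltn_neqAle ke' andbT; apply/eqP => h; apply: ke; apply: val_inj.
  by rewrite -subn_gt0 => h; rewrite expr0n gtn_eqF// mul0r mulr0.
have herr : (fun n => fdiff e (fun i => (E (x + i)%N n - (Q n).[delta n * (x + i)%:R]) / delta n ^+ d) *
    delta n ^+ (d - e)) @ \oo --> (0 : R).
  rewrite -[X in _ --> X](mul0r (0 ^+ (d - e))); apply: cvgM_seq; last exact: cvg_pow_seq.
  rewrite (_ : 0 = \sum_(i < e.+1) (-1) ^+ (e - i) * 'C(e, i)%:R * 0); last first.
    by rewrite big1// => i _; rewrite mulr0.
  apply: (@cvg_sum_seq _ e.+1 (fun i n => (-1) ^+ (e - i) * 'C(e, i)%:R *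
     ((E (x + i)%N n - (Q n).[delta n * (x + i)%:R]) / delta n ^+ d))
     (fun i => (-1) ^+ (e - i) * 'C(e, i)%:R * 0)) => i ie.
  apply: cvgM_seq; first exact: cvg_cst.
  by apply: hE; apply: leq_trans xed; rewrite leq_add2l -ltnS.
have := cvgD_seq herr hmain; rewrite add0r; apply: near_cvg_seq.
apply: filterS delta_gt0 => n dn; have dn0 : delta n != 0 by rewrite gt_eqF.
have e1 : fdiff e (fun i => (Q n).[delta n * (x + i)%:R]) = main n * delta n ^+ e.
  have -> : (fun i => (Q n).[delta n * (x + i)%:R]) =
      (fun i => \sum_(k < (D + e).+1) ((Q n)`_k * delta n ^+ k) * (x + i)%:R ^+ k).
    apply/funext => i; rewrite (@horner_coef_wide _ (D + e).+1).
      by apply: eq_bigr => k _; rewrite exprMn mulrA.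
    by apply: leq_trans (sQ n) _; rewrite ltnS leq_addr.
  rewrite (fdiff_sum e (D + e).+1 (fun k i => (Q n)`_k * delta n ^+ k * (x + i)%:R ^+ k)).
  rewrite mulr_suml; apply: eq_bigr => k _; rewrite fdiffZ -/(fd k).
  case: ltnP => ke; last first.
    by rewrite (_ : delta n ^+ k = delta n ^+ (k - e) * delta n ^+ e); [ring | rewrite -exprD subnK].
  by rewrite /fd fdiff_pow ?(ltnW ke)// (ltn_eqF ke); ring.
have -> : main n = fdiff e (fun i => (Q n).[delta n * (x + i)%:R]) / delta n ^+ e.
  by rewrite e1 mulfK// expf_neq0.
have -> : (fun i => (E (x + i)%N n - (Q n).[delta n * (x + i)%:R]) / delta n ^+ d) =
    (fun i => (delta n ^+ d)^-1 * (E (x + i)%N n + - 1 * (Q n).[delta n * (x + i)%:R])).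
  by apply/funext => i; rewrite mulrC mulN1r.
rewrite fdiffZ fdiffD fdiffZ.
rewrite (_ : delta n ^+ d = delta n ^+ (d - e) * delta n ^+ e); last by rewrite -exprD subnK.
by field; rewrite !expf_neq0.
Qed.

End Jets.

(** * Coefficients of the rescaled Jensen polynomials *)

Section HermiteJensen.
Variables (R : realType).

Lemma sign_sub m i : (i <= m)%N -> (-1) ^+ (m - i) = (-1) ^+ m * (-1) ^+ i :> R.
Proof.
by move=> im; rewrite -{2}(subnK im) exprD -mulrA -exprD addnn -(signr_odd _ i.*2) odd_double mulr1.
Qed.

Lemma coef_affine_pow (u : R) j k :
  ((u *: 'X - 1) ^+ j)`_k = 'C(j, k)%:R * u ^+ k * (-1) ^+ (j - k).
Proof.
rewrite addrC exprDn coef_sum.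
have tE (i : 'I_j.+1) : ((- 1 : {poly R}) ^+ (j - i) * (u *: 'X) ^+ i *+ 'C(j, i))`_k =
    if k == i :> nat then 'C(j, k)%:R * u ^+ k * (-1) ^+ (j - k) else 0.
  rewrite coefMn exprZn -polyC1 -polyCN -polyC_exp coefCM coefZ coefXn -mulr_natl.
  by case: eqP => [->|_]; rewrite ?mulr1 ?mulr0//; ring.
rewrite (eq_bigr _ (fun i _ => tE i)); have [kj|jk] := leqP k j.
  rewrite (bigD1 (Ordinal (kj : (k < j.+1)%N)))//= eqxx big1 ?addr0// => i /eqP ik.
  by case: eqP => // h; case: ik; exact: val_inj.
by rewrite bin_small// !mul0r big1// => i _; case: eqP.
Qed.

Lemma bin_absorb d k i : (k + i <= d)%N ->
  ('C(d, k + i) * 'C(k + i, k) = 'C(d, k) * 'C(d - k, i))%N.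
Proof.
move=> kid; have kd : (k <= d)%N by apply: leq_trans kid; exact: leq_addr.
have ik : (i <= d - k)%N by rewrite leq_subRL.
apply/eqP; rewrite -(eqn_pmul2r (_ : 0 < k`! * i`! * (d - (k + i))`!)%N); last first.
  by rewrite !muln_gt0 !fact_gt0.
have f1 := bin_fact kid; have f2 := bin_fact (leq_addr i k); rewrite addKn in f2.
have f3 := bin_fact kd; have f4 := bin_fact ik; rewrite -subnDA in f4.
apply/eqP; transitivity d`!.
  by rewrite -f1 -f2; ring.
by rewrite -f3 -f4; ring.
Qed.

(** Up to sign, the k-th coefficient is a finite difference of order d - k starting at k, which
    explains the factor delta^(k-d) in the normalisation. *)
Lemma coef_binomial_sum (F : nat -> R) (u : R) d k :
  (\sum_(j < d.+1) ('C(d, j)%:R * F j) *: (u *: 'X - 1) ^+ j)`_k =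
  if (k <= d)%N then 'C(d, k)%:R * u ^+ k *
     \sum_(i < (d - k).+1) (-1) ^+ i * 'C(d - k, i)%:R * F (k + i)%N else 0.
Proof.
rewrite coef_sum; under eq_bigr => j _ do rewrite coefZ coef_affine_pow.
case: leqP => kd; last first.
  by rewrite big1// => j _; rewrite (@bin_small j k) ?mul0r ?mulr0// (leq_trans (ltn_ord j)).
pose G j := 'C(d, j)%:R * F j * ('C(j, k)%:R * u ^+ k * (-1) ^+ (j - k)).
rewrite -(big_mkord xpredT G) (@big_cat_nat _ _ _ k 0 d.+1)//=; last exact: leqW.
rewrite big_nat big1 ?add0r => [|j /andP[_ jk]]; last by rewrite /G (@bin_small j k)// !mul0r mulr0.
rewrite -[X in \sum_(X <= _ < _) _](add0n k) big_addn subSn// big_mkord mulr_sumr.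
apply: eq_bigr => i _; have id : (k + i <= d)%N by rewrite -leq_subRL// -ltnS.
have := bin_absorb id; rewrite /G (addnC i k) addKn => /(congr1 (fun n => n%:R : R)).
rewrite !natrM => h.
transitivity (('C(d, k + i)%:R * 'C(k + i, k)%:R) * F (k + i)%N * u ^+ k * (-1) ^+ i); first by ring.
by rewrite h; ring.
Qed.

(* [t^e] of [exp(- t^2)] *)
Definition gauss_coef e : R := \sum_(b < e.+1 | (2 * b)%N == e) (-1) ^+ b / b`!%:R.

Lemma gauss_coef_sign e : (-1) ^+ e * gauss_coef e = gauss_coef e.
Proof.
rewrite /gauss_coef mulr_sumr; apply: eq_bigr => b /eqP be.
by rewrite -{1}be exprM sqrrN expr1n expr1n mul1r.
Qed.

Lemma coef_hermite d k : (hermite R d \Po (2^-1 *: 'X))`_k =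
  if (k <= d)%N then 'C(d, k)%:R * ((d - k)`!%:R * gauss_coef (d - k)) else 0.
Proof.
rewrite /hermite comp_polyZ coefZ raddf_sum coef_sum.
have tE (a : 'I_d.+1) : ((\sum_(b < d.+1 | (a + 2 * b)%N == d)
    ((-1) ^+ b / (a`!)%:R / (b`!)%:R) *: (2%:R *: 'X) ^+ a) \Po (2^-1 *: 'X))`_k =
  if k == a :> nat then \sum_(b < d.+1 | (k + 2 * b)%N == d) ((-1) ^+ b / (k`!)%:R / (b`!)%:R) else 0 :> R.
  rewrite raddf_sum coef_sum /=.
  have e (c : R) : ((c *: (2%:R *: 'X) ^+ a) \Po (2^-1 *: 'X))`_k = if k == a :> nat then c else 0.
    rewrite comp_polyZ exprZn comp_polyZ comp_Xn_poly exprZn !coefZ coefXn.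
    case: eqP => _; last by rewrite !mulr0.
    by rewrite mulr1 -exprMn mulfV ?expr1n ?mulr1// pnatr_eq0.
  under eq_bigr => b _ do rewrite e.
  by case: eqP => [->//|_]; rewrite big1.
rewrite (eq_bigr _ (fun a _ => tE a)); case: leqP => kd; last first.
  rewrite big1 ?mulr0// => a _; case: eqP => // h.
  by have := ltn_ord a; rewrite -h ltnS leqNgt kd.
rewrite (bigD1 (Ordinal (kd : (k < d.+1)%N)))//= eqxx [X in _ * (_ + X)]big1 ?addr0 => [|a /eqP ak]; last first.
  by case: eqP => // h; case: ak; exact: val_inj.
have dE : d`!%:R = 'C(d, k)%:R * (d - k)`!%:R * k`!%:R :> R.
  by rewrite -!natrM -(bin_fact kd); congr _%:R; ring.
rewrite dE /gauss_coef mulrA [RHS]mulr_sumr.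
have -> : \sum_(b < d.+1 | (k + 2 * b)%N == d) ((-1) ^+ b / k`!%:R / b`!%:R) =
   k`!%:R^-1 * \sum_(b < (d - k).+1 | (2 * b)%N == (d - k)%N) ((-1) ^+ b / b`!%:R) :> R.
  rewrite mulr_sumr.
  rewrite (big_ord_widen_cond d.+1 (fun b => (2 * b)%N == (d - k)%N)
     (fun b => k`!%:R^-1 * ((-1) ^+ b / b`!%:R))) ?ltnS ?leq_subr//.
  apply: eq_big => [b|b _]; last by ring.
  apply/eqP/andP => [h|[/eqP h _]]; last by rewrite h subnKC.
  have h' : (2 * b)%N = (d - k)%N by rewrite -[in RHS]h addKn.
  by split; [exact/eqP | rewrite ltnS -h' leq_pmull].
rewrite -mulr_sumr; move: (\sum_(b < _ | _) _) => X.
by field; rewrite pnatr_eq0 -lt0n fact_gt0.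
Qed.

Section FromJets.
Variable delta : nat -> R.
Hypothesis delta_gt0 : \forall n \near \oo, 0 < delta n.
Hypothesis delta_cvg0 : delta @ \oo --> (0 : R).

(** The series of exp(-t^2) truncated in the form that [jet_exp] produces; only its coefficients up
    to degree d are used. *)
Definition gauss_poly d : {poly R} := \sum_(i < d.+1) (i`!%:R^-1)%:P * (- 'X^2) ^+ i.

Lemma coef_gauss_poly d e : (e <= d)%N -> (gauss_poly d)`_e = gauss_coef e.
Proof.
move=> ed; rewrite /gauss_poly coef_sum /gauss_coef.
rewrite (big_ord_widen_cond d.+1 (fun b => (2 * b)%N == e) (fun b => (-1) ^+ b / b`!%:R)) ?ltnS//.
rewrite [RHS]big_mkcond; apply: eq_bigr => b _.
have -> : (- 'X^2 : {poly R}) ^+ b = ((-1) ^+ b)%:P * 'X^(2 * b).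
  by rewrite exprM (exprNn 'X^2) polyC_exp polyCN polyC1.
rewrite mulrA -polyCM coefCM coefXn (eq_sym e).
case: eqP => [h|_]; last by rewrite mulr0.
by rewrite mulr1 mulrC ifT// ltnS -h leq_pmull.
Qed.

(** [jensenJ] yields differences based at k and [jensenK], after the reversal j -> d - j,
    differences based at 0. They differ by the sign (-1)^(d-k), which is harmless because exp(-t^2)
    is even. *)
Lemma hermite_jensen_of_jet d (alpha A : nat -> R) : (1 <= d)%N -> (forall n, 0 < alpha n) ->
  jet delta d (gauss_poly d) (fun j n => alpha (n + j)%N / alpha n / expR (A n) ^+ j) ->
  hermite_jensen_neg d alpha A delta.
Proof.
move=> d1 a0 jE; split=> //; split=> // k.
set E := fun j n => _ in jE.
have an n : alpha n != 0 by rewrite gt_eqF.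
have en n : expR (A n) != 0 by rewrite gt_eqF ?expR_gt0.
have hJ n : ((delta n) ^- d / alpha n) *:
     (jensenJ alpha d n \Po ((expR (A n))^-1 *: (delta n *: 'X - 1))) =
     (delta n) ^- d *: \sum_(j < d.+1) ('C(d, j)%:R * E j n) *: (delta n *: 'X - 1) ^+ j.
  rewrite /jensenJ raddf_sum -!scalerA; congr (_ *: _); rewrite scaler_sumr; apply: eq_bigr => j _ /=.
  rewrite comp_polyZ comp_Xn_poly exprZn !scalerA; congr (_ *: _).
  by rewrite /E exprVn; field; rewrite an expf_neq0.
have hK n : ((expR (A n) * delta n) ^- d / alpha n) *:
     (jensenK alpha d n \Po (expR (A n) *: (delta n *: 'X - 1))) =
     (delta n) ^- d *: \sum_(j < d.+1) ('C(d, j)%:R * E (d - j)%N n) *: (delta n *: 'X - 1) ^+ j.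
  rewrite /jensenK raddf_sum exprMn invfM (mulrC (expR _ ^- d)) -!scalerA; congr (_ *: _).
  rewrite [RHS](reindex_inj rev_ord_inj) scalerA scaler_sumr; apply: eq_bigr => j _ /=.
  have jd : (j <= d)%N by rewrite -ltnS.
  rewrite subSS subKn// bin_sub// comp_polyZ comp_Xn_poly exprZn !scalerA; congr (_ *: _).
  rewrite /E -{1}(subnK jd) exprD; field.
  by rewrite an !expf_neq0.
rewrite coef_hermite; split.
- apply: (@eq_cvg_seq _ (fun n => (delta n) ^- d * (\sum_(j < d.+1) ('C(d, j)%:R * E j n) *:
     (delta n *: 'X - 1) ^+ j)`_k)) => [n|]; first by rewrite hJ coefZ.
  have [kd|dk] := leqP k d; last first.
    apply: (@eq_cvg_seq _ (fun=> 0)) => [n|]; last exact: cvg_cst.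
    by rewrite (coef_binomial_sum (fun j => E j n)) leqNgt dk mulr0.
  have kdk : (k + (d - k) <= d)%N by rewrite subnKC.
  have h := jet_fdiff delta_gt0 delta_cvg0 jE kdk.
  have h2 := @cvgZ_seq R ('C(d, k)%:R * (-1) ^+ (d - k)) _ _ h.
  rewrite (_ : 'C(d, k)%:R * (_ * _) = 'C(d, k)%:R * (-1) ^+ (d - k) *
     ((d - k)`!%:R * (gauss_poly d)`_(d - k))); last first.
    by rewrite coef_gauss_poly ?leq_subr// -[in LHS]gauss_coef_sign; ring.
  apply: near_cvg_seq h2; apply: filterS delta_gt0 => n dn.
  rewrite (coef_binomial_sum (fun j => E j n)) kd /fdiff.
  have -> : \sum_(i < (d - k).+1) (-1) ^+ (d - k - i) * 'C(d - k, i)%:R * E (k + i)%N n =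
     (-1) ^+ (d - k) * \sum_(i < (d - k).+1) (-1) ^+ i * 'C(d - k, i)%:R * E (k + i)%N n.
    rewrite mulr_sumr; apply: eq_bigr => i _.
    by rewrite sign_sub -1?ltnS//; move: (E _ _) => y; ring.
  rewrite (_ : delta n ^+ d = delta n ^+ k * delta n ^+ (d - k)); last by rewrite -exprD subnKC.
  move: (\sum_(i < _) _) => X.
  have s2 : (-1) ^+ (d - k) * (-1) ^+ (d - k) = 1 :> R by rewrite -exprD addnn -(signr_odd _ (d - k).*2) odd_double.
  rewrite mulrA (mulrA ('C(d, k)%:R * _)) -(mulrA 'C(d, k)%:R) s2 mulr1.
  by field; rewrite !expf_neq0 ?gt_eqF.
apply: (@eq_cvg_seq _ (fun n => (delta n) ^- d * (\sum_(j < d.+1) ('C(d, j)%:R * E (d - j)%N n) *: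
   (delta n *: 'X - 1) ^+ j)`_k)) => [n|]; first by rewrite hK coefZ.
have [kd|dk] := leqP k d; last first.
  apply: (@eq_cvg_seq _ (fun=> 0)) => [n|]; last exact: cvg_cst.
  by rewrite (coef_binomial_sum (fun j => E (d - j)%N n)) leqNgt dk mulr0.
have kdk : (0 + (d - k) <= d)%N by rewrite leq_subr.
have h := jet_fdiff delta_gt0 delta_cvg0 jE kdk.
have h2 := @cvgZ_seq R 'C(d, k)%:R _ _ h.
rewrite coef_gauss_poly ?leq_subr// in h2.
apply: near_cvg_seq h2; apply: filterS delta_gt0 => n dn.
rewrite (coef_binomial_sum (fun j => E (d - j)%N n)) kd /fdiff.
have -> : \sum_(i < (d - k).+1) (-1) ^+ i * 'C(d - k, i)%:R * E (d - (k + i))%N n =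
   \sum_(i < (d - k).+1) (-1) ^+ (d - k - i) * 'C(d - k, i)%:R * E (0 + i)%N n.
  rewrite (reindex_inj rev_ord_inj); apply: eq_bigr => i _ /=.
  have id : (i <= d - k)%N by rewrite -ltnS.
  by rewrite subSS bin_sub// subnDA subKn.
rewrite (_ : delta n ^+ d = delta n ^+ k * delta n ^+ (d - k)); last by rewrite -exprD subnKC.
  move: (\sum_(i < _) _) => X.
by field; rewrite !expf_neq0 ?gt_eqF.
Qed.

(** Written in powers of [delta n * j], the logarithm without its linear part tends to the
    polynomial -t^2; a linear coefficient that vanishes in the limit is still allowed, which makes
    the change of data possible. *)
Lemma hermite_jensen_of_log d m (alpha A : nat -> R) (c : nat -> nat -> R) :
  (1 <= d)%N -> (2 <= m)%N -> (forall n, 0 < alpha n) ->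
  (forall k, (1 <= k <= m)%N -> c k @ \oo --> (- (k == 2%N)%:R : R)) ->
  (forall j, (1 <= j <= d)%N -> (fun n => (ln (alpha (n + j)%N / alpha n) - A n * j%:R -
     \sum_(1 <= k < m.+1) c k n * (delta n * j%:R) ^+ k) / delta n ^+ d) @ \oo --> (0 : R)) ->
  hermite_jensen_neg d alpha A delta.
Proof.
move=> d1 m2 a0 hc herr; apply: hermite_jensen_of_jet => //.
pose L j n := ln (alpha (n + j)%N / alpha n) - A n * j%:R.
have -> : (fun j n => alpha (n + j)%N / alpha n / expR (A n) ^+ j) = (fun j n => expR (L j n)).
  apply/funext => j; apply/funext => n; rewrite /L expRD lnK ?posrE ?divr_gt0//.
  by rewrite expRN (mulrC (A n)) expRM_natl.
have sumE n y : (\poly_(k < m.+1) (if k == 0%N then 0 else c k n)).[y] =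
    \sum_(1 <= k < m.+1) c k n * y ^+ k.
  rewrite horner_poly big_ord_recl /= mul0r add0r big_add1 /= big_mkord.
  by apply: eq_bigr => k _.
have L0 n : L 0%N n = 0 by rewrite /L addn0 divff ?gt_eqF// ln1 mulr0 subrr.
have sum0 n : \sum_(1 <= k < m.+1) c k n * (delta n * 0) ^+ k = 0.
  rewrite big_nat big1// => k /andP[k1 _]; rewrite mulr0 expr0n.
  by rewrite (gtn_eqF k1) mulr0.
have herr' x : (x <= d)%N -> (fun n => (L x n -
     \sum_(1 <= k < m.+1) c k n * (delta n * x%:R) ^+ k) / delta n ^+ d) @ \oo --> (0 : R).
  case: x => [_|x xd]; last exact: herr.
  by apply: (@eq_cvg_seq _ (fun=> 0)) => [n|]; [rewrite L0 sum0 subrr mul0r|exact: cvg_cst].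
have jL : jet delta d (- 'X^2) L.
  exists m, (fun n => \poly_(k < m.+1) (if k == 0%N then 0 else c k n)); split=> [n|k|x xd].
  - exact: size_poly.
  - rewrite coefN coefXn.
    apply: (@eq_cvg_seq _ (fun n => if (k < m.+1)%N then if k == 0%N then 0 else c k n else 0)).
      by move=> n; rewrite coef_poly.
    case: ltnP => km; last first.
      rewrite gtn_eqF ?oppr0 ?(leq_ltn_trans m2)//; exact: cvg_cst.
    case: k km => [_|k km]; first by rewrite oppr0; exact: cvg_cst.
    exact: hc.
  by apply: eq_cvg_seq (herr' x xd) => n; rewrite sumE.
apply: (jet_exp delta_gt0 delta_cvg0 jL) => x xd.
eexists; have hsum : (fun n => \sum_(k < m) c k.+1 n * (delta n ^+ k * x%:R ^+ k.+1)) @ \oo -->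
     (\sum_(k < m) (- (k.+1 == 2%N)%:R) * (0 ^+ k * x%:R ^+ k.+1) : R).
  apply: (@cvg_sum_seq _ m (fun k n => c k.+1 n * (delta n ^+ k * x%:R ^+ k.+1))
     (fun k => - (k.+1 == 2%N)%:R * (0 ^+ k * x%:R ^+ k.+1))) => k km.
  apply: cvgM_seq; first exact: hc.
  by apply: cvgM_seq; [exact: cvg_pow_seq|exact: cvg_cst].
have := cvgD_seq (cvgM_seq (herr' x xd) (cvg_pow_seq (k := d.-1) delta_cvg0)) hsum.
apply: near_cvg_seq; apply: filterS delta_gt0 => n dn; have dn0 : delta n != 0 by rewrite gt_eqF.
rewrite big_add1 /= big_mkord.
have -> : \sum_(k < m) c k.+1 n * (delta n * x%:R) ^+ k.+1 =
    (\sum_(k < m) c k.+1 n * (delta n ^+ k * x%:R ^+ k.+1)) * delta n.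
  by rewrite mulr_suml; apply: eq_bigr => k _; rewrite exprMn !exprS; ring.
have -> : delta n ^+ d = delta n * delta n ^+ d.-1 by rewrite -exprS prednK.
move: (\sum_(k < m) _) => X.
by field; rewrite dn0 expf_neq0.
Qed.

End FromJets.

End HermiteJensen.

(** * The simplified data *)

Section Transfer.
Variable R : realType.

Lemma cvg_cst_seq (c : R) : (fun _ : nat => c) @ \oo --> (c : R).
Proof. exact: cvg_cst. Qed.

Lemma cvgV_seq (u : nat -> R) (l : R) : l != 0 -> u @ \oo --> l -> (fun n => (u n)^-1) @ \oo --> (l^-1 : R).
Proof. by move=> l0 ul; exact: cvgV. Qed.

Lemma hermite_jensen_of_log_polynomial (alpha A delta A' delta' : nat -> R) d : (1 <= d)%N ->
  (forall m, (2 <= m)%N -> log_polynomial m alpha A (-1) delta) ->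
  (\forall n \near \oo, 0 < delta' n) -> delta' @ \oo --> (0 : R) ->
  (fun n => (A n - A' n) / delta' n) @ \oo --> (0 : R) ->
  (fun n => delta n / delta' n) @ \oo --> (1 : R) ->
  hermite_jensen_neg d alpha A' delta'.
Proof.
(* Degree [m >= d] gives an error o(delta^(m+1)), more than the o(delta^d) that is needed. *)
move=> d1 hlp d'0 d'c hA hd; pose m := maxn 2 d.
have m2 : (2 <= m)%N := leq_maxl 2 d.
have dm : (d <= m.+1)%N by apply: leq_trans (leqnSn m); exact: leq_maxr.
have [_ [_ [a0 [dgt0 [dc [g [hg herr]]]]]]] := hlp m m2.
(* Coefficients in powers of [delta' n * j]: the discrepancy of [A] and [A'] becomes the linear
   one. *)
pose c k n : R := if k == 1%N then (A n - A' n) / delta' n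
  else if k == 2%N then - (delta n / delta' n) ^+ 2 else g k n / delta' n ^+ k.
apply: (@hermite_jensen_of_log R delta' d'0 d'c d m alpha A' c) => // [k /andP[k1 km]|j /andP[j1 jd]].
  rewrite /c; case: eqP => [->|/eqP k1']; first by rewrite oppr0.
  case: (k =P 2%N) => [_|/eqP k2'].
    rewrite (_ : - _ = -1 * 1 ^+ 2); last by rewrite expr1n mulr1.
    apply: (@eq_cvg_seq _ (fun n => -1 * (delta n / delta' n) ^+ 2)); first by move=> n; rewrite mulN1r.
    by apply: cvgZ_seq; apply: cvg_pow_seq.
  have k3 : (3 <= k <= m)%N by rewrite km; move: k1 k1' k2'; case: k {km} => [|[|[|]]].
  have := cvgM_seq (hg k k3) (cvg_pow_seq (k := k) hd); rewrite mul0r oppr0.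
  apply: near_cvg_seq; apply: filterS2 dgt0 d'0 => n dn d'n.
  by rewrite expr_div_n; field; rewrite !expf_neq0 ?gt_eqF.
have jm : (1 <= j <= m.+1)%N by rewrite j1 (leq_trans jd).
have := cvgM_seq (cvgM_seq (herr j jm) (cvg_pow_seq (k := m.+1 - d) dc)) (cvg_pow_seq (k := d) hd).
rewrite !mul0r; apply: near_cvg_seq; apply: filterS2 dgt0 d'0 => n dn d'n.
have d'z : delta' n != 0 by rewrite gt_eqF.
have dz : delta n != 0 by rewrite gt_eqF.
rewrite (_ : \sum_(1 <= k < m.+1) c k n * (delta' n * j%:R) ^+ k =
   (A n - A' n) * j%:R - delta n ^+ 2 * j%:R ^+ 2 + \sum_(3 <= k < m.+1) g k n * j%:R ^+ k); last first.
  rewrite (@big_cat_nat _ _ _ 3 1 m.+1)//= big_nat_recr//= big_nat1 /c /=; congr (_ + _).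
    by field.
  rewrite !big_nat; apply: eq_bigr => k /andP[k3 _].
  rewrite (gtn_eqF (ltnW k3)) (gtn_eqF k3) exprMn.
  by field; rewrite expf_neq0.
rewrite (_ : delta n ^+ m.+1 = delta n ^+ (m.+1 - d) * delta n ^+ d); last by rewrite -exprD subnK.
rewrite expr_div_n; move: (\sum_(3 <= k < m.+1) _) => X.
by field; rewrite !expf_neq0.
Qed.

End Transfer.

(** * Comparison of the two sets of data *)

Section StarData.
Variable R : realType.
Let a : R := pi ^+ 2 / 3.
Let S := S_ R.

Lemma sqr_cvg1 (u : nat -> R) : (\forall n \near \oo, 0 <= u n) ->
  (fun n => u n ^+ 2) @ \oo --> (1 : R) -> u @ \oo --> (1 : R).
Proof.
move=> u0 /cvgrPdist_le h; apply/cvgrPdist_le => e e0.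
apply: filterS2 u0 (h e e0) => n un /=; apply: le_trans.
have -> : 1 - u n ^+ 2 = (1 - u n) * (1 + u n) by ring.
by rewrite normrM ler_peMr// ger0_norm; lra.
Qed.

Lemma Astar_gt0 n : (0 < n)%N -> 0 < Astar R n.
Proof. by move=> n0; rewrite divr_gt0 ?pi_gt0// mulr_gt0 ?sqrtr_gt0// ltr0n. Qed.

Lemma Astar_sq n : (0 < n)%N -> Astar R n ^+ 2 = a / (2 * n%:R).
Proof.
move=> n0; have n1 : 0 < n%:R :> R by rewrite ltr0n.
rewrite /Astar expr_div_n exprMn !sqr_sqrtr//.
by rewrite /a; move: pi => p; field; rewrite gt_eqF.
Qed.

Lemma deltastar_gt0 n : (0 < n)%N -> 0 < deltastar R n.
Proof.
move=> n0; have n1 : 0 < n%:R :> R by rewrite ltr0n.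
by rewrite divr_gt0 ?sqrtr_gt0 ?pi_gt0// !mulr_gt0 ?sqrtr_gt0.
Qed.

Lemma deltastar_sq n : (0 < n)%N -> deltastar R n ^+ 2 = Astar R n / (4 * n%:R).
Proof.
move=> n0; have n1 : 0 < n%:R :> R by rewrite ltr0n.
rewrite /deltastar /Astar expr_div_n !exprMn !sqr_sqrtr ?sqrtr_ge0 ?(ltW n1) ?pi_ge0//.
have s6 : 0 < Num.sqrt 6 :> R by rewrite sqrtr_gt0.
have sn : 0 < Num.sqrt n%:R :> R by rewrite sqrtr_gt0.
move: (Num.sqrt 6) (Num.sqrt n%:R) pi s6 sn => x y p x0 y0.
by field; rewrite !gt_eqF.
Qed.

(** The square root of 2 a n, that is S(n) with 1/24 dropped. *)
Let Q n := a / Astar R n.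

Lemma Q_gt0 n : (0 < n)%N -> 0 < Q n.
Proof. by move=> n0; rewrite divr_gt0 ?Astar_gt0//; have := a_ge1 R; rewrite -/a; lra. Qed.

Lemma Q_sq n : (0 < n)%N -> Q n ^+ 2 = S n ^+ 2 + a / 12.
Proof.
move=> n0; rewrite /Q expr_div_n Astar_sq// /S S_sq// -/a.
have a1 := a_ge1 R; rewrite -/a in a1; have n1 : 0 < n%:R :> R by rewrite ltr0n.
move: a a1 => b b1; field.
by rewrite !gt_eqF//; lra.
Qed.

Lemma deltastar_sqQ n : (0 < n)%N -> deltastar R n ^+ 2 = a ^+ 2 / (2 * Q n ^+ 3).
Proof.
move=> n0; rewrite deltastar_sq// /Q.
have a1 := a_ge1 R; rewrite -/a in a1; have n1 : 0 < n%:R :> R by rewrite ltr0n.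
have A0 := Astar_gt0 n0; have e := Astar_sq n0.
have -> : n%:R = a / (2 * Astar R n ^+ 2) by rewrite e; move: a a1 => b b1; field; rewrite !gt_eqF//; lra.
move: (Astar R n) A0 a a1 => A A0 b b1.
by field; rewrite !gt_eqF//; lra.
Qed.

Lemma S_cvgs : [/\ (fun n => (Q n / S n) ^+ 2) @ \oo --> (1 : R) &
   (fun n => (1 - (S n)^-1)^-1) @ \oo --> (1 : R)].
Proof.
have h := @cvg_S_inv R; rewrite -/S in h; split.
  have := cvgD_seq (@cvg_cst_seq R 1) (cvgZ_seq (c := a / 12) (cvg_pow_seq (k := 2) h)).
  rewrite expr0n mulr0 addr0 => h2; apply: near_cvg_seq h2.
  exists 1%N => // n /= n1; have s1 := S_gt1 R n1; rewrite -/S in s1.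
  by rewrite expr_div_n Q_sq//; move: a => b; field; rewrite gt_eqF//; lra.
rewrite -[X in _ --> X]invr1; apply: cvgV_seq; first exact: oner_neq0.
have := cvgD_seq (@cvg_cst_seq R 1) (cvgZ_seq (c := -1) h); rewrite mulr0 addr0 => h2.
by apply: eq_cvg_seq h2 => n; rewrite mulN1r.
Qed.

Lemma delta_ratio_cvg : (fun n => delta_ R n / deltastar R n) @ \oo --> (1 : R).
Proof.
have [n1 h1] := S_large (12 : R).
apply: sqr_cvg1.
  exists (maxn n1 1) => // n /=; rewrite geq_max => /andP[nn1 n0].
  by rewrite divr_ge0// ltW ?deltastar_gt0//; apply: delta_gt0; exact: h1.
have [c1 c2] := S_cvgs.
have cQ : (fun n => Q n / S n) @ \oo --> (1 : R).
  apply: sqr_cvg1 => //; exists 1%N => // n /= n0.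
  by rewrite divr_ge0 ?(ltW (Q_gt0 n0))// S_ge0.
(* The squared ratio is (Q/S)^3 ((1 - 1/S)^-2 - 6/S). *)
have := cvgM_seq (cvg_pow_seq (k := 3) cQ)
  (cvgD_seq (cvg_pow_seq (k := 2) c2) (cvgZ_seq (c := -6) (@cvg_S_inv R))).
rewrite !expr1n mulr0 addr0 mulr1; apply: near_cvg_seq.
exists (maxn n1 1) => // n /=; rewrite geq_max => /andP[nn1 n0].
have s12 := h1 n nn1; rewrite -/S in s12 *; have q0 := Q_gt0 n0.
rewrite [RHS]expr_div_n delta_sqE// deltastar_sqQ// -/a -/(S n).
have a1 := a_ge1 R; rewrite -/a in a1.
move: (Q n) (S n) q0 s12 a a1 => q s q0 s12 b b1.
by field; rewrite !gt_eqF//; lra.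
Qed.

(** Q exceeds S by at most 1, so a/(S - 1) and a/Q differ by O(S^-2); this is smaller than
    [deltastar], which has order S^(-3/2). *)
Lemma A_sub_Astar_decay : sdecay 2 (fun n => A_ R n - Astar R n).
Proof.
have [n1 h1] := S_large (12 : R); have a1 := a_ge1 R; have /andP[_ a2] := pi2_3_bounds R.
rewrite -/a in a1 a2.
exists (7 * a); first by lra.
exists (maxn n1 1) => n; rewrite geq_max => /andP[nn1 n0].
have s12 := h1 n nn1; rewrite -/S in s12 *; have q0 := Q_gt0 n0.
have AQ : Astar R n = a / Q n.
  by rewrite /Q; have := Astar_gt0 n0; move: (Astar R n) a a1 => A b b1 A0; field; rewrite !gt_eqF//; lra.
have e := Q_sq n0.
rewrite AQ /A_ -/a -/(S n); move: (Q n) (S n) q0 s12 e => q s q0 s12 e.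
have qs : s <= q.
  by rewrite -ler_sqr ?nnegrE; [rewrite e lerDl; lra|lra|lra].
have qs1 : q <= s + 1 by rewrite -ler_sqr ?nnegrE; [nra|lra|lra].
have s0 : 0 < s by lra.
have -> : a * ((s - 1)^-1 - 3 / s ^+ 2) - a / q =
    a * ((q - s + 1) / ((s - 1) * q) - 3 / s ^+ 2).
  by move: a a1 a2 e => b b1 b2 e; field; rewrite !gt_eqF//; lra.
rewrite normrM (ger0_norm (_ : 0 <= a)); last by lra.
rewrite (_ : 7 * a / s ^+ 2 = a * (7 / s ^+ 2)); last by ring.
apply: ler_wpM2l; first by lra.
have s2 : 0 < s ^+ 2 by rewrite exprn_gt0.
apply: le_trans (ler_normB _ _) _.
have n1' : 0 <= (q - s + 1) / ((s - 1) * q) by rewrite divr_ge0 ?mulr_ge0//; lra.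
have n2' : 0 <= 3 / s ^+ 2 by rewrite divr_ge0// ltW.
rewrite (ger0_norm n1') (ger0_norm n2').
have : (q - s + 1) / ((s - 1) * q) <= 4 / s ^+ 2.
  rewrite ler_pdivrMr; last by rewrite mulr_gt0//; lra.
  rewrite mulrAC ler_pdivlMr//.
  have : 2 * s ^+ 2 <= 4 * ((s - 1) * q) by nra.
  have : (q - s + 1) * s ^+ 2 <= 2 * s ^+ 2 by rewrite ler_wpM2r//; lra.
  lra.
lra.
Qed.

Lemma deltastar_cvg0 : deltastar R @ \oo --> (0 : R).
Proof.
have h := cvgM_seq (@delta_cvg0 R) (cvgV_seq (oner_neq0 R) delta_ratio_cvg).
rewrite mul0r in h; apply: near_cvg_seq h; have [n1 h1] := S_large (12 : R).
exists (maxn n1 1) => // n /=; rewrite geq_max => /andP[nn1 n0].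
have d0 := delta_gt0 (h1 n nn1); have ds0 := deltastar_gt0 n0.
by move: (delta_ R n) (deltastar R n) d0 ds0 => x y x0 y0; field; rewrite !gt_eqF.
Qed.

Lemma A_star_cvg : (fun n => (A_ R n - Astar R n) / deltastar R n) @ \oo --> (0 : R).
Proof.
have h0 : (fun n => (A_ R n - Astar R n) / delta_ R n) @ \oo --> (0 : R).
  have := @sdecay_div_delta R 2 1 _ isT A_sub_Astar_decay.
  by apply: eq_cvg_seq => n; rewrite expr1.
have h := cvgM_seq h0 delta_ratio_cvg; rewrite mul0r in h; apply: near_cvg_seq h.
have [n1 h1] := S_large (12 : R).
exists (maxn n1 1) => // n /=; rewrite geq_max => /andP[nn1 n0].
have d0 := delta_gt0 (h1 n nn1); have ds0 := deltastar_gt0 n0.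
move: (delta_ R n) (deltastar R n) d0 ds0 => x y x0 y0.
by field; rewrite !gt_eqF.
Qed.

End StarData.

Theorem theorem2p2 (R : realType) :
  (forall m : nat, (2 <= m)%N ->
     log_polynomial m (@pR R) (@A_ R) (-1) (@delta_ R)) /\
  (forall d : nat, (1 <= d)%N ->
     hermite_jensen_neg d (@pR R) (@A_ R) (@delta_ R)) /\
  (forall d : nat, (1 <= d)%N ->
     hermite_jensen_neg d (@pR R) (@Astar R) (@deltastar R)).
Proof.
have lp m : (2 <= m)%N -> log_polynomial m (@pR R) (@A_ R) (-1) (@delta_ R).
  exact: pR_log_polynomial.
have [n1 h1] := S_large (12 : R).
have d0 : \forall n \near \oo, 0 < delta_ R n.
  by exists n1 => // n /= nn1; apply: delta_gt0; exact: h1.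
(* The first set of data is the trivial case A' = A, delta' = delta of the transfer. *)
split=> //; split=> d dd; apply: (hermite_jensen_of_log_polynomial dd lp).
- exact: d0.
- exact: delta_cvg0.
- by apply: (@eq_cvg_seq _ (fun=> 0)) => [n|]; [rewrite subrr mul0r|exact: cvg_cst].
- apply: (@near_cvg_seq _ (fun=> 1)); last exact: cvg_cst.
  by apply: filterS d0 => n dn; rewrite divff// gt_eqF.
- by exists 1%N => // n /= n0; exact: deltastar_gt0.
- exact: deltastar_cvg0.
- exact: A_star_cvg.
exact: delta_ratio_cvg.
Qed.
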